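(* Let $G$ be a finite reflection group on $\mathbb{R}^d$ with root system $\mathcal{R}$, normalized so that $\langle v,v\rangle=2$ for all $v\in\mathcal{R}$, let $\mathcal{R}_+$ be a positive subsystem, let $\kappa:\mathcal{R}\to[0,\infty)$ be a $G$-invariant function, let $\mu\ge0$, and let $$W^B_{\kappa,\mu}(x)=\left(\prod_{v\in\mathcal{R}_+}|\langle x,v\rangle|^{2\kappa_v}\right)(1-\|x\|^2)^{\mu-1/2},\qquad x\in\mathbb{B}^d.$$ Then there is a constant $C_{d,\kappa,\mu}>0$, depending only on $d,\kappa,\mu$, such that for every real-valued $f\in C^1(\mathbb{B}^d)$ with $\int_{\mathbb{B}^d}f(x)W^B_{\kappa,\mu}(x)\,dx=0$ and $\int_{\mathbb{B}^d}|f(x)|^2W^B_{\kappa,\mu}(x)\,dx=1$, $$\left[\min_{y\in\mathbb{B}^d}\int_{\mathbb{B}^d}(1-\langle x,y\rangle)|f(x)|^2W^B_{\kappa,\mu}(x)\,dx\right]\left[\int_{\mathbb{B}^d}\left|\sqrt{-\Delta^B_{\kappa,\mu}}\,f(x)\right|^2W^B_{\kappa,\mu}(x)\,dx\right]\ge C_{d,\kappa,\mu}.$$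
   Context: $\mathbb{B}^d=\{x\in\mathbb{R}^d:\|x\|\le1\}$ is the closed unit ball; $\langle\cdot,\cdot\rangle$ and $\|\cdot\|$ are the Euclidean inner product and norm. $\mathcal{R}=\mathcal{R}_+\cup(-\mathcal{R}_+)$, $\kappa_v=\kappa(v)$, $|\kappa|=\sum_{v\in\mathcal{R}_+}\kappa_v$. $\Delta^B_{\kappa,\mu}$ is the analogue on $\mathbb{B}^d$ of the Dunkl–Laplace–Beltrami operator. It is the second order differential-difference operator for which the space $\mathcal{V}_n^d(W^B_{\kappa,\mu})$ of orthogonal polynomials of degree $n$ (polynomials in $d$ variables of degree at most $n$ that are orthogonal, in $L^2(\mathbb{B}^d;W^B_{\kappa,\mu}\,dx)$, to all polynomials of degree at most $n-1$) is an eigenspace with eigenvalue $-n(n+2\lambda)$, where $\lambda=|\kappa|+\mu+\frac{d-1}{2}$. For $\alpha\in\mathbb{R}$, its fractional power is defined in the distributional sense by $\mathrm{proj}_n((-\Delta^B_{\kappa,\mu})^\alpha f)=(n(n+2\lambda))^\alpha\,\mathrm{proj}_n(f)$ for $n=0,1,2,\dots$, where $\mathrm{proj}_n$ is the orthogonal projection of $L^2(\mathbb{B}^d;W^B_{\kappa,\mu}\,dx)$ onto $\mathcal{V}_n^d(W^B_{\kappa,\mu})$, and $\sqrt{-\Delta^B_{\kappa,\mu}}=(-\Delta^B_{\kappa,\mu})^{1/2}$. Equivalently, $(-\Delta^B_{\kappa,\mu})^\alpha f(x)=(-\Delta_{\tilde\kappa,0})^\alpha\tilde f(\phi(x))$ for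 $x\in\mathbb{B}^d$, where $\phi(x)=(x,\sqrt{1-\|x\|^2})\in\mathbb{S}^d$, $\tilde f(x,x_{d+1})=f(x)$ for $(x,x_{d+1})\in\mathbb{S}^d$, and $\Delta_{\tilde\kappa,0}$ is the Dunkl–Laplace–Beltrami operator on $\mathbb{S}^d\subset\mathbb{R}^{d+1}$ associated with the weight $h_{\tilde\kappa}(x,x_{d+1})=|x_{d+1}|^\mu\prod_{v\in\mathcal{R}_+}|\langle x,v\rangle|^{\kappa_v}$. That is, $\Delta_{\tilde\kappa,0}g=\sum_{j=1}^{d+1}\mathcal{D}_j^2[g(z/\|z\|)]$ restricted to $\mathbb{S}^d$, with $\mathcal{D}_j$ the Dunkl operators on $\mathbb{R}^{d+1}$ for the reflection group and multiplicity function corresponding to $h_{\tilde\kappa}$; its fractional powers are likewise defined spectrally. *)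

(* Defs.v *)
From HB Require Import structures.
From mathcomp Require Import all_boot all_order all_algebra finmap.
From mathcomp Require Import all_classical all_reals all_analysis.
(* The notations of mpoly clash with those of all_analysis. *)
From mathcomp Require Import (canonicals, coercions) mpoly.

Set Implicit Arguments.
Unset Strict Implicit.
Unset Printing Implicit Defensive.

Import Order.TTheory GRing.Theory Num.Theory.
Import numFieldNormedType.Exports.

Local Open Scope classical_set_scope.
Local Open Scope ring_scope.

(* The sigma-algebra on R^n generated by the coordinates, as the library does
   for n.-tuple T. *)
Section measurable_rV.
Context {R : realType}.
Variable n : nat.

Definition coord_rV (i : 'I_n) (x : 'rV[R]_n) : measurableTypeR R := x 0 i.

Let rV_set0 : g_sigma_preimage coord_rV set0.
Proof. exact: sigma_algebra0. Qed.

Let rV_setC A : g_sigma_preimage coord_rV A -> g_sigma_preimage coord_rV (~` A).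
Proof. exact: sigma_algebraC. Qed.

Let rV_bigcup (F : _^nat) : (forall i, g_sigma_preimage coord_rV (F i)) ->
  g_sigma_preimage coord_rV (\bigcup_i (F i)).
Proof. exact: sigma_algebra_bigcup. Qed.

HB.instance Definition _ := @isMeasurable.Build default_measure_display
  'rV[R]_n (g_sigma_preimage coord_rV) rV_set0 rV_setC rV_bigcup.

Lemma measurable_coord_rV (i : 'I_n) :
  measurable_fun [set: 'rV[R]_n] (coord_rV i).
Proof.
move=> _ Y mY; rewrite setTI; apply: sub_sigma_algebra => /=.
rewrite -bigcup_seq/=; exists i => /=; first by rewrite mem_index_enum.
by exists Y => //; rewrite setTI.
Qed.

Lemma measurable_fun_rVP d (T : measurableType d) (f : T -> 'rV[R]_n) :
  (forall i, measurable_fun [set: T] (coord_rV i \o f)) ->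
  measurable_fun [set: T] f.
Proof.
move=> mf.
have prefS : g_sigma_preimage (fun i => coord_rV i \o f) `<=` measurable.
  apply: smallest_sub; first exact: sigma_algebra_measurable.
  move=> A; rewrite -bigcup_seq => -[i _] /= [B mB <-].
  exact: mf.
rewrite g_sigma_preimage_comp in prefS.
by move=> _ A mA; apply: prefS; exists A.
Qed.

End measurable_rV.

Section lebesgue_rV.
Context {R : realType}.

Definition cons_rV n (p : measurableTypeR R * 'rV[R]_n) : 'rV[R]_n.+1 :=
  row_mx (p.1 : R)%:M p.2 : 'rV[R]_(1 + n).

Definition uncons_rV n (x : 'rV[R]_n.+1) : measurableTypeR R * 'rV[R]_n :=
  (x 0 0, \row_j x 0 (lift ord0 j)).

Lemma uncons_rVK n : cancel (@uncons_rV n) (@cons_rV n).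
Proof.
move=> x; apply/rowP => i; rewrite /cons_rV /uncons_rV mxE.
case: split_ordP => j ->; rewrite !mxE.
  by rewrite ord1 eqxx mulr1n; congr (x _ _); exact/val_inj.
by congr (x _ _); exact/val_inj.
Qed.

Lemma cons_rVK n : cancel (@cons_rV n) (@uncons_rV n).
Proof.
move=> [a x]; congr pair; rewrite /cons_rV /=.
  rewrite mxE; case: split_ordP => j /(congr1 val) //= _.
  by rewrite ord1 mxE eqxx mulr1n.
apply/rowP => i; rewrite !mxE; case: split_ordP => j /(congr1 val).
  by rewrite ord1.
by move=> -[ij]; congr (x _ _); exact/esym/val_inj.
Qed.

Lemma measurable_cons_rV n : measurable_fun setT (@cons_rV n).
Proof.
apply: measurable_fun_rVP => i; rewrite /comp /coord_rV.
case: (unliftP ord0 i) => [j ->|->].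
  rewrite (_ : (fun _ => _) = coord_rV j \o snd); last first.
    apply/funext => p /=; rewrite -{2}(cons_rVK p) /coord_rV /= mxE.
    by [].
  by apply: measurableT_comp; [exact: measurable_coord_rV|].
rewrite (_ : (fun _ => _) = fst) //.
by apply/funext => p; rewrite -{2}(cons_rVK p).
Qed.

Lemma measurable_uncons_rV n : measurable_fun setT (@uncons_rV n).
Proof.
apply: measurable_fun_pair; first exact: measurable_coord_rV.
apply: measurable_fun_rVP => i.
rewrite (_ : _ \o _ = coord_rV (lift ord0 i)); first exact: measurable_coord_rV.
by apply/funext => x; rewrite /coord_rV /= mxE.
Qed.

Section step.
Variables (n : nat) (m : {sigma_finite_measure set 'rV[R]_n -> \bar R}).

Definition lebesgue_cons : set 'rV[R]_n.+1 -> \bar R :=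
  pushforward (lebesgue_measure \x m)%E (@cons_rV n).

Let m' : {measure set 'rV[R]_n.+1 -> \bar R} :=
  measure_function_pushforward__canonical__measure_function_Measure
    (lebesgue_measure \x m)%E (@measurable_cons_rV n).

Let lebesgue_cons0 : lebesgue_cons set0 = 0%E.
Proof. exact: (measure0 m'). Qed.

Let lebesgue_cons_ge0 A : (0 <= lebesgue_cons A)%E.
Proof. exact: (measure_ge0 m'). Qed.

Let lebesgue_cons_sigma_additive : semi_sigma_additive lebesgue_cons.
Proof. exact: (@measure_semi_sigma_additive _ _ _ m'). Qed.

HB.instance Definition _ := isMeasure.Build _ _ _ lebesgue_cons
  lebesgue_cons0 lebesgue_cons_ge0 lebesgue_cons_sigma_additive.

Let lebesgue_cons_sigma_finite : sigma_finite setT lebesgue_cons.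
Proof.
have /sigma_finiteP[F [TF ndF Foo]] := sigma_finiteT (@lebesgue_measure R).
have /sigma_finiteP[H [TH ndH Hoo]] := sigma_finiteT m.
exists (fun k => @uncons_rV n @^-1` (F k `*` H k)).
  rewrite -preimage_bigcup (_ : \bigcup_k _ = setT) ?preimage_setT//.
  apply/seteqP; split => // -[x y] _.
  have : [set: measurableTypeR R] x by [].
  have : [set: 'rV[R]_n] y by [].
  rewrite TF TH => -[i _ Hiy] [j _ Fjx]; exists (maxn i j) => //; split => /=.
    by move: x Fjx; exact/subsetPset/ndF/leq_maxr.
  by move: y Hiy; exact/subsetPset/ndH/leq_maxl.
move=> k; have [mF Fk] := Foo k; have [mH Hk] := Hoo k; split.
  by rewrite -[X in measurable X]setTI; apply: measurable_uncons_rV => //;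
    exact: measurableX.
rewrite /lebesgue_cons /pushforward (_ : _ @^-1` _ = F k `*` H k).
  by rewrite product_measure1E// lte_mul_pinfty// ge0_fin_numE.
by apply/seteqP; split => p; rewrite /preimage /mkset cons_rVK.
Qed.

HB.instance Definition _ := Measure_isSigmaFinite.Build _ _ _ lebesgue_cons
  lebesgue_cons_sigma_finite.

End step.

Fixpoint lebesgue_rV n : {sigma_finite_measure set 'rV[R]_n -> \bar R} :=
  if n isn't n'.+1 then dirac (0 : 'rV[R]_0) else lebesgue_cons (lebesgue_rV n').

End lebesgue_rV.

Section euclidean.
Context {R : realType} {d : nat}.

Definition dotv (x y : 'rV[R]_d) : R := \sum_(i < d) x 0 i * y 0 i.

(* `|x| is the sup norm on 'rV[R]_d. *)
Definition enorm (x : 'rV[R]_d) : R := Num.sqrt (dotv x x).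

Definition unit_ball : set 'rV[R]_d := [set x | enorm x <= 1].

(* C^1 on the closed ball: continuous there, with partial derivatives in the
   interior that extend continuously to the closed ball. *)
Definition C1_unit_ball (f : 'rV[R]_d -> R) :=
  {within unit_ball, continuous f} /\
  exists g : 'I_d -> 'rV[R]_d -> R, forall i,
    {within unit_ball, continuous (g i)} /\
    forall x, enorm x < 1 -> is_derive x (delta_mx 0 i) f (g i x).

(* x *m refl_mx v = x - 2 <x, v> / <v, v> v *)
Definition refl_mx (v : 'rV[R]_d) : 'M[R]_d :=
  1%:M - (2 / dotv v v) *: (v^T *m v).

Definition root_system (Rts : {fset 'rV[R]_d}) :=
  [/\ forall v, v \in Rts -> v != 0,
      forall v w, v \in Rts -> w \in Rts -> w *m refl_mx v \in Rts
    & forall v c, v \in Rts -> c *: v \in Rts -> c = 1 \/ c = -1].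

Definition mx_group (G : set 'M[R]_d) :=
  [/\ G 1%:M, forall g h, G g -> G h -> G (g *m h)
    & forall g, G g -> G (invmx g)].

Definition finite_reflection_group (Rts : {fset 'rV[R]_d}) (G : set 'M[R]_d) :=
  [/\ root_system Rts, finite_set G
    & G = smallest mx_group [set refl_mx v | v in [set` Rts]]].

Definition positive_subsystem (Rts Rp : {fset 'rV[R]_d}) :=
  exists u : 'rV[R]_d,
    (forall v, v \in Rts -> dotv u v != 0) /\
    forall v, (v \in Rp) = (v \in Rts) && (0 < dotv u v).

End euclidean.
Arguments unit_ball {R} d.

Section weighted_ball.
Context {R : realType} {d : nat}.
Variables (Rp : {fset 'rV[R]_d}) (kappa : 'rV[R]_d -> R) (mu : R).
Implicit Types (f g : 'rV[R]_d -> R) (p q : mpoly.mpoly d R) (n : nat).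

Definition ball_weight (x : 'rV[R]_d) : R :=
  (\prod_(v <- Rp) `|dotv x v| `^ (2 * kappa v))
  * (1 - enorm x ^+ 2) `^ (mu - 1 / 2).

Definition ball_int f : R :=
  \int[lebesgue_rV d]_(x in unit_ball d) (f x * ball_weight x).

Definition ball_L2 : set ('rV[R]_d -> R) := [set f : 'rV[R]_d -> R |
  measurable_fun (unit_ball d) f /\
  (\int[lebesgue_rV d]_(x in unit_ball d)
     (f x ^+ 2 * ball_weight x)%:E < +oo)%E].

Definition poly_fun p (x : 'rV[R]_d) : R := mpoly.meval (fun i => x 0 i) p.

(* [msize p <= n.+1] means that p has degree at most n. *)
Definition ball_orthopoly n : set (mpoly.mpoly d R) := [set p |
  (mpoly.msize p <= n.+1)%N /\
  forall q, (mpoly.msize q <= n)%N ->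
    ball_int (fun x => poly_fun p x * poly_fun q x) = 0].

(* [xget] returns the unique p in the set: the projection of f exists, since
   [ball_orthopoly n] has finite dimension. *)
Definition ball_proj n f : mpoly.mpoly d R := xget 0 [set p |
  ball_orthopoly n p /\
  forall q, ball_orthopoly n q ->
    ball_int (fun x => (f x - poly_fun p x) * poly_fun q x) = 0].

Definition ball_lambda : R :=
  (\sum_(v <- Rp) kappa v) + mu + (d%:R - 1) / 2.

(* g represents (- Delta)^a f in L^2, Delta being the operator with eigenspaces
   [ball_orthopoly n] and eigenvalues - n (n + 2 lambda). *)
Definition is_ball_laplace_pow (a : R) f g :=
  ball_L2 g /\
  forall n, ball_proj n g =
    (n%:R * (n%:R + 2 * ball_lambda)) `^ a *: ball_proj n f.

(* (- Delta)^a f as a function: any representative of its L^2 class, which is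
   determined by its projections. *)
Definition ball_laplace_pow (a : R) f : 'rV[R]_d -> R :=
  xget (fun=> 0) [set g | is_ball_laplace_pow a f g].

End weighted_ball.

(* Main.v *)
Require Import Defs.
From mathcomp Require Import all_boot all_order all_algebra finmap.
From mathcomp Require Import all_classical all_reals all_analysis measurable_realfun.
From mathcomp Require Import ring lra.
From mathcomp Require Import (canonicals, coercions) mpoly.

(** Why the theorem holds.  Let [W] be the weight, [u = <x, y>] for a unit vector
    [y], and let [E] be the Dirichlet form with density [energy_density]: the
    gradient form [<grad f, grad h> - <x, grad f> <x, grad h>] plus a quotient of
    differences across each mirror.  Integration by parts gives
    [E(f, p) = - int f (ball_lap p) W] for [f] of class C^1 and [p] polynomial
    ([energy_poly]).  The operator [ball_lap] maps polynomials of degree [n] to such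
    polynomials, with top degree part multiplied by [- n (n + 2 lambda)], and it is
    symmetric; so its eigenspaces are those of the orthogonal polynomials
    ([ball_lap_eigen]).  Since [E] is nonnegative, Bessel's inequality bounds the sum
    of the [n (n + 2 lambda) |f_n|^2], with [f_n] the components of [f], by [E(f, f)].
    Hence the square root of the operator is defined on [f] by a series that
    converges in mean square ([laplace_sqrt_exists]), and the square [S] of the norm
    of its value bounds [E(P, P)] for each partial sum [P] of the [f_n]
    ([laplace_sqrt_energy]).

    By the normalization of [f], the integral to be minimized is [1 - <X, y>] with
    [X = int x f^2 W], so a unit vector [y] in the direction of [X] is a minimum
    point.  As [u] is an eigenfunction of eigenvalue [- (1 + 2 lambda)],
<<
      (1 + 2 lambda) int u P^2 W = E(P^2, u).
>>
    The gradient part of the right hand side is handled by Cauchy-Schwarz, since the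
    form takes the value [1 - u^2 <= 2 (1 - u)] at [u].  For the root [v], put
    [t = <x, v>] and [D = (|P| - |P o s|) / t] with [s] the reflection.  The
    difference of [u] across the mirror is [t <v, y>], and by invariance under [s]
    the contribution of [v] is the integral of [2 kappa_v D |P| <v, y> W].  In
    [<v, y> = <v, y - x> + t], the first term is small near [y] and the second one
    contributes at most [2 kappa_v P^2].  This gives ([poly_uncertainty]), for [e > 0],
<<
      (1 + 2 lambda) int u P^2 W <= e E(P, P)
          + ((2 + 4 |kappa|) / e) int (1 - u) P^2 W + 2 |kappa| int P^2 W.
>>
    The point is that [1 + 2 lambda - 2 |kappa| = d + 2 mu] is positive.  As the
    partial sums converge to [f] in mean square ([proj_dense]), [d + 2 mu] is bounded
    by [e S + (c / e + c') delta] with [delta = int (1 - u) f^2 W] and constants [c],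
    [c'].  If [delta] is small, the choice of [e] bounds [delta S] from below; if not,
    [S >= (1 + 2 lambda) / 2] is enough, which holds because [f] has mean zero
    ([uncertainty_product]).

    Integration by parts is the analytic core: [W] is singular at the sphere and its
    gradient at the mirrors.  It is proved for smooth approximations that are cut off
    near the sphere, after the singular terms have been averaged over the
    reflections, and passes to the limit by dominated convergence
    ([ibp_identity]). *)

Set Implicit Arguments.
Unset Strict Implicit.
Unset Printing Implicit Defensive.

Import Order.TTheory GRing.Theory Num.Theory.
Import numFieldNormedType.Exports.

Local Open Scope classical_set_scope.
Local Open Scope ring_scope.

(** * Lebesgue measure on row vectors *)

Section measure_rV.
Context {R : realType}.
Notation lam n := (@lebesgue_rV R n).

Lemma measurable_coord n (i : 'I_n) :
  measurable_fun [set: 'rV[R]_n] (fun x => x 0 i : R).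
Proof. exact: measurable_coord_rV. Qed.

Lemma measurable_box n (q : 'rV[R]_n) (r : R) :
  measurable [set x : 'rV[R]_n | forall i, `|x 0 i - q 0 i| < r].
Proof.
rewrite (_ : [set x | _] =
    \big[setI/setT]_(i < n) [set x : 'rV[R]_n | `|x 0 i - q 0 i| < r]).
  apply: bigsetI_measurable => i _.
  have mf : measurable_fun setT (fun x : 'rV[R]_n => `|x 0 i - q 0 i|).
    apply: measurableT_comp => //; apply: measurable_funB => //.
    exact: measurable_coord.
  have := mf measurableT `]-oo, r[%classic (measurable_itv _).
  rewrite setTI; congr measurable; apply/seteqP; split => x /=;
    by rewrite in_itv.
apply/seteqP; split => x /=.
  by move=> h; rewrite -bigcap_seq => i _ /=.
by rewrite -bigcap_seq => h i; apply: (h i); rewrite /= mem_index_enum.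
Qed.

Lemma ball_boxP n (x : 'rV[R]_n) (e : R) y :
  ball x e y <-> 0 < e /\ forall i, `|x 0 i - y 0 i| < e.
Proof.
split=> -[e0 h]; split=> //; first by move=> i; exact: (h 0 i).
by move=> i j; rewrite (ord1 i); exact: h.
Qed.

Lemma open_measurable_rV n (U : set 'rV[R]_n) : open U -> measurable U.
Proof.
move=> oU.
pose box (p : 'rV[rat]_n * rat) : set 'rV[R]_n :=
  [set x | forall i, `|x 0 i - (map_mx ratr p.1 : 'rV[R]_n) 0 i| < ratr p.2].
pose F p : set 'rV[R]_n := if `[< box p `<=` U >] then box p else set0.
rewrite (_ : U = \bigcup_p F p).
  apply: countable_bigcupT_measurable; first exact: countableP.
  by move=> p; rewrite /F; case: asboolP => // _; exact: measurable_box.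
apply/seteqP; split => [x Ux|x [p _]]; last first.
  by rewrite /F; case: asboolP => // + xp; apply.
have /nbhs_ballP[e /= e0 eU] : nbhs x U by exact: open_nbhs_nbhs.
have /rat_in_itvoo[r] : 0 < e / 2 by rewrite divr_gt0.
rewrite in_itv/= => /andP[r0 re].
have hq i : exists q : rat, `|x 0 i - ratr q| < (ratr r : R).
  have /rat_in_itvoo[q] : x 0 i - ratr r < x 0 i + ratr r :> R.
    by rewrite ltrBlDr -addrA ltrDl addr_gt0.
  by rewrite in_itv/= => /andP[h1 h2]; exists q; rewrite ltr_norml; lra.
have [q qP] := choice hq.
have xb : box (\row_i q i, r) x by move=> i; rewrite !mxE; exact: qP.
exists (\row_i q i, r) => //; rewrite /F; case: asboolP => // -[] y yb.
apply/eU/ball_boxP; split=> // i.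
have := xb i; have := yb i; rewrite !ltr_norml; lra.
Qed.

Lemma continuous_measurable_rV n (D : set 'rV[R]_n) (F : 'rV[R]_n -> R) :
  measurable D -> {within D, continuous F} -> measurable_fun D F.
Proof.
move=> mD /continuousP cf; apply: (measurability _ (RGenOpens.measurableE R)).
move=> _ [_ [a [b ->] <-]].
have oF : open (F @^-1` `]a, b[%classic : set (subspace D)).
  by apply: cf; exact: interval_open.
move/open_subspaceP : oF => [V oV VE].
by rewrite setIC -VE; apply: measurableI => //; exact: open_measurable_rV.
Qed.

Lemma measurable_translate n (c : 'rV[R]_n) :
  measurable_fun setT (fun x : 'rV[R]_n => x + c).
Proof.
apply: measurable_fun_rVP => i.
rewrite (_ : _ \o _ = (fun x : 'rV_n => x 0 i + c 0 i)).
  by apply: measurable_funD => //; exact: measurable_coord.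
by apply/funext => x; rewrite /= /coord_rV !mxE.
Qed.

Lemma measurable_mulmxr n (A : 'M[R]_n) :
  measurable_fun setT (fun x : 'rV[R]_n => x *m A).
Proof.
apply: measurable_fun_rVP => i.
rewrite (_ : _ \o _ = (fun x : 'rV_n => \sum_j x 0 j * A j i)).
  apply: measurable_sum => j; apply: measurable_funM => //.
  exact: measurable_coord.
by apply/funext => x; rewrite /= /coord_rV !mxE.
Qed.

Lemma lebesgue_translate1 (c : R) (A : set (measurableTypeR R)) : measurable A ->
  lebesgue_measure ((fun x => x + c) @^-1` A) = lebesgue_measure A :> \bar R.
Proof.
move=> mA.
have mf : measurable_fun setT (fun x : measurableTypeR R => x + c : measurableTypeR R).
  by apply: measurable_funD.
pose m' := measure_function_pushforward__canonical__measure_function_Measure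
  (@lebesgue_measure R) mf.
rewrite -[LHS]/(m' A); apply/esym/lebesgue_measure_unique => // _ [[a b] _ <-].
rewrite /m' /= /pushforward.
have -> : (fun x => x + c) @^-1` `]a, b] = `]a - c, b - c]%classic.
  by apply/seteqP; split => x /=; rewrite !in_itv/= ltrBlDr lerBrDr.
rewrite !lebesgue_measure_itv/= !lte_fin ltrD2r.
by case: ifPn => // _; rewrite -!EFinB; congr EFin; ring.
Qed.

Lemma lebesgue_consE n (A : set 'rV[R]_n.+1) :
  lam n.+1 A = (lebesgue_measure \x lam n)%E (@cons_rV R n @^-1` A).
Proof. by []. Qed.

Lemma cons_rVD n (a c : R) (x y : 'rV[R]_n) :
  cons_rV (a, x) + cons_rV (c, y) = cons_rV (a + c, x + y).
Proof.
apply/rowP => i; rewrite /cons_rV !mxE; case: split_ordP => j _; rewrite !mxE//=.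
by rewrite mulrnDl.
Qed.

(** By induction on the dimension, from the uniqueness of product measures. *)
Lemma lebesgue_translate n (c : 'rV[R]_n) (A : set 'rV[R]_n) : measurable A ->
  lam n ((fun x => x + c) @^-1` A) = lam n A.
Proof.
elim: n c A => [c A mA|n IH c A mA].
  by congr (lam 0 _); apply/seteqP; split => x /=; rewrite (thinmx0 (x + c)) (thinmx0 x).
rewrite !lebesgue_consE.
have [c0 [c' cE]] : exists c0 c', c = cons_rV (c0, c').
  by case E : (uncons_rV c) => [c0 c']; exists c0, c'; rewrite -E uncons_rVK.
pose T (p : measurableTypeR R * 'rV[R]_n) : measurableTypeR R * 'rV[R]_n :=
  (p.1 + c0, p.2 + c').
have mT : measurable_fun setT T.
  apply: measurable_fun_pair.
    by apply: (@measurable_funD _ _ _ setT fst (cst c0)).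
  exact: measurableT_comp (measurable_translate c') measurable_snd.
pose m' := measure_function_pushforward__canonical__measure_function_Measure
  (lebesgue_measure \x lam n)%E mT.
have mcA : measurable (@cons_rV R n @^-1` A).
  by rewrite -[X in measurable X]setTI; apply: measurable_cons_rV.
rewrite (_ : _ @^-1` (_ @^-1` A) = T @^-1` (@cons_rV R n @^-1` A)); last first.
  by apply/seteqP; split => -[a x] /=; rewrite cE cons_rVD.
rewrite -[LHS]/(m' _); apply/esym/product_measure_unique => // X Y mX mY.
rewrite /m' /= /pushforward (_ : T @^-1` _ =
    ((fun x => x + c0) @^-1` X) `*` ((fun x => x + c') @^-1` Y)); last first.
  by apply/seteqP; split => -[a x].
rewrite product_measure1E.
- by congr (_ * _)%E; [exact: lebesgue_translate1|exact: IH].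
- rewrite -[X in measurable X]setTI.
  suff mf : measurable_fun setT (fun x : measurableTypeR R => x + c0 : measurableTypeR R).
    exact: mf.
  by apply: measurable_funD.
- by rewrite -[X in measurable X]setTI; apply: measurable_translate.
Qed.

Lemma cvg_sumr (T I : Type) (F : set_system T) (FF : Filter F) (r : seq I)
    (P : pred I) (f : I -> T -> R) (l : I -> R) :
  (forall i, f i x @[x --> F] --> l i) ->
  \sum_(i <- r | P i) f i x @[x --> F] --> \sum_(i <- r | P i) l i.
Proof.
move=> fl; elim: r => [|i r IH].
  by rewrite big_nil; under eq_fun do rewrite big_nil; exact: cvg_cst.
rewrite big_cons; under eq_fun do rewrite big_cons.
by case: (P i) => //; apply: cvgD.
Qed.

Lemma dotvE n (x y : 'rV[R]_n) : dotv x y = (x *m y^T) 0 0.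
Proof. by rewrite mxE /dotv; apply: eq_bigr => i _; rewrite mxE. Qed.

Lemma dotvC n (x y : 'rV[R]_n) : dotv x y = dotv y x.
Proof. by apply: eq_bigr => i _; rewrite mulrC. Qed.

Lemma dotvDl n (x y z : 'rV[R]_n) : dotv (x + y) z = dotv x z + dotv y z.
Proof. by rewrite !dotvE mulmxDl mxE. Qed.

Lemma dotvZl n a (x z : 'rV[R]_n) : dotv (a *: x) z = a * dotv x z.
Proof. by rewrite !dotvE -scalemxAl mxE. Qed.

Lemma dotvNl n (x z : 'rV[R]_n) : dotv (- x) z = - dotv x z.
Proof. by rewrite -scaleN1r dotvZl mulN1r. Qed.

Lemma dotvBl n (x y z : 'rV[R]_n) : dotv (x - y) z = dotv x z - dotv y z.
Proof. by rewrite dotvDl dotvNl. Qed.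

Lemma dotvDr n (x y z : 'rV[R]_n) : dotv x (y + z) = dotv x y + dotv x z.
Proof. by rewrite dotvC dotvDl !(dotvC x). Qed.

Lemma dotvZr n a (x z : 'rV[R]_n) : dotv x (a *: z) = a * dotv x z.
Proof. by rewrite dotvC dotvZl dotvC. Qed.

Lemma dotvNr n (x z : 'rV[R]_n) : dotv x (- z) = - dotv x z.
Proof. by rewrite dotvC dotvNl dotvC. Qed.

Lemma dotvBr n (x y z : 'rV[R]_n) : dotv x (y - z) = dotv x y - dotv x z.
Proof. by rewrite dotvDr dotvNr. Qed.

Lemma dotv_ge0 n (x : 'rV[R]_n) : 0 <= dotv x x.
Proof. by apply: sumr_ge0 => i _; rewrite -expr2 sqr_ge0. Qed.

Lemma dotv_eq0 n (x : 'rV[R]_n) : (dotv x x == 0) = (x == 0).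
Proof.
apply/eqP/eqP => [|->]; last by rewrite /dotv big1// => i _; rewrite mxE mul0r.
move/eqP; rewrite psumr_eq0 => [/allP h|i _]; last by rewrite -expr2 sqr_ge0.
apply/rowP => i; rewrite mxE; apply/eqP; rewrite -sqrf_eq0 expr2.
by apply: h; rewrite mem_index_enum.
Qed.

Lemma sqr_enorm n (x : 'rV[R]_n) : enorm x ^+ 2 = dotv x x.
Proof. by rewrite /enorm sqr_sqrtr// dotv_ge0. Qed.

Lemma enorm_lt1 n (x : 'rV[R]_n) : (enorm x < 1) = (dotv x x < 1).
Proof. by rewrite -sqr_enorm -[in RHS](expr1n _ 2) ltr_pXn2r// nnegrE// sqrtr_ge0. Qed.

Lemma enorm_le1 n (x : 'rV[R]_n) : (enorm x <= 1) = (dotv x x <= 1).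
Proof. by rewrite -sqr_enorm -[in RHS](expr1n _ 2) ler_pXn2r// nnegrE// sqrtr_ge0. Qed.

(** Cauchy-Schwarz, from the sign of [|dotv x y *: x - dotv x x *: y|^2]. *)
Lemma dotv_CS n (x y : 'rV[R]_n) : dotv x y ^+ 2 <= dotv x x * dotv y y.
Proof.
have [->|x0] := eqVneq x 0.
  by rewrite -(scale0r (0 : 'rV_n)) !dotvZl !mul0r expr0n.
have xx : 0 < dotv x x by rewrite lt_def dotv_ge0 dotv_eq0 x0.
have := dotv_ge0 (dotv x y *: x - dotv x x *: y).
rewrite dotvBl !dotvBr !dotvZl !dotvZr (dotvC y x) => h.
rewrite -(ler_pM2l xx); nra.
Qed.

Lemma coord_le_dotv n (x : 'rV[R]_n) i : x 0 i ^+ 2 <= dotv x x.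
Proof.
rewrite /dotv (bigD1 i)//= -expr2 lerDl; apply: sumr_ge0 => j _.
by rewrite -expr2 sqr_ge0.
Qed.

Lemma continuous_sqnorm n : continuous (fun x : 'rV[R]_n => dotv x x).
Proof. by move=> x; apply: (cvg_sumr (nbhs_filter x)) => i; apply: cvgM; exact: coord_continuous. Qed.

Definition open_ball n : set 'rV[R]_n := [set x | enorm x < 1].
Arguments open_ball n : clear implicits.

Lemma open_open_ball n : open (open_ball n).
Proof.
rewrite (_ : open_ball n = (fun x => dotv x x) @^-1` [set r | r < 1]).
  apply: open_comp; last exact: open_lt.
  by move=> x _; exact: continuous_sqnorm.
by apply/seteqP; split => x; rewrite /open_ball /preimage /mkset enorm_lt1.
Qed.

Lemma measurable_open_ball n : measurable (open_ball n).
Proof. by apply: open_measurable_rV; exact: open_open_ball. Qed.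

Lemma measurable_unit_ball n : measurable (@unit_ball R n).
Proof.
rewrite -[unit_ball n]setCK; apply: measurableC; apply: open_measurable_rV.
rewrite (_ : ~` _ = (fun x => dotv x x) @^-1` [set r | 1 < r]).
  apply: open_comp; last exact: open_gt.
  by move=> x _; exact: continuous_sqnorm.
by apply/seteqP; split => x /=; rewrite /unit_ball/= enorm_le1 ltNge => /negP.
Qed.

Lemma lebesgue_box n (q : 'rV[R]_n) (r : R) : 0 < r ->
  lam n [set x : 'rV[R]_n | forall i, `|x 0 i - q 0 i| < r] = ((2 * r) ^+ n)%:E.
Proof.
move=> r0; elim: n q => [q|n IH q].
  rewrite /= /dirac indicE mem_set//; by case.
rewrite lebesgue_consE.
have [a [q' ->]] : exists (a : R) q', q = cons_rV (a, q').
  by case E : (uncons_rV q) => [a q']; exists a, q'; rewrite -E uncons_rVK.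
rewrite (_ : _ @^-1` _ = `]a - r, a + r[%classic `*`
    [set x : 'rV[R]_n | forall i, `|x 0 i - q' 0 i| < r]).
  rewrite product_measure1E//; last exact: measurable_box.
  have leb : lebesgue_measure `]a - r, a + r[%classic = (2 * r)%:E :> \bar R.
    rewrite lebesgue_measure_itv/= lte_fin ifT; last by lra.
    by rewrite -EFinB; congr EFin; ring.
  transitivity ((2 * r)%:E * ((2 * r) ^+ n)%:E)%E; last by rewrite -EFinM exprS.
  by rewrite -leb -(IH q').
have E0 b (x : 'rV[R]_n) : cons_rV (b, x) 0 ord0 = b.
  by have := cons_rVK (b, x); case.
have ES b (x : 'rV[R]_n) i : cons_rV (b, x) 0 (lift ord0 i) = x 0 i.
  by have := cons_rVK (b, x); rewrite /uncons_rV => -[_ /rowP/(_ i)]; rewrite mxE.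
apply/seteqP; split => -[b x] /=.
  move=> h; split => [|i]; last by have := h (lift ord0 i); rewrite !ES.
  by have := h ord0; rewrite !E0 in_itv/= ltr_norml; lra.
rewrite in_itv/= => -[h0 h] i; case: (unliftP ord0 i) => [j ->|->].
  by rewrite !ES.
by rewrite !E0 ltr_norml; lra.
Qed.

Lemma lebesgue_unit_ball_fin n : (lam n (@unit_ball R n) < +oo)%E.
Proof.
apply: (@le_lt_trans _ _ (lam n [set x : 'rV[R]_n | forall i, `|x 0 i - (0 : 'rV_n) 0 i| < 2])).
  apply: le_measure; rewrite ?inE; [exact: measurable_unit_ball|exact: measurable_box|].
  move=> x; rewrite /unit_ball/= enorm_le1 => x1 i; rewrite mxE subr0.
  have := coord_le_dotv x i; rewrite ltr_norml; nra.
by rewrite lebesgue_box// ltry.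
Qed.

Lemma open_ball_unit_ball n : open_ball n `<=` unit_ball n.
Proof. by move=> x /ltW. Qed.

Lemma lebesgue_open_ball_fin n : (lam n (open_ball n) < +oo)%E.
Proof.
apply: le_lt_trans (lebesgue_unit_ball_fin n).
by apply: le_measure; rewrite ?inE; [exact: measurable_open_ball
  |exact: measurable_unit_ball|exact: open_ball_unit_ball].
Qed.

Lemma lebesgue_open_gt0 n (U : set 'rV[R]_n) x : open U -> U x -> (0 < lam n U)%E.
Proof.
move=> oU Ux.
have /nbhs_ballP[e /= e0 eU] : nbhs x U by exact: open_nbhs_nbhs.
apply: (@lt_le_trans _ _ (lam n [set y : 'rV[R]_n | forall i, `|y 0 i - x 0 i| < e])).
  by rewrite lebesgue_box// lte_fin exprn_gt0// mulr_gt0.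
apply: le_measure; rewrite ?inE; [exact: measurable_box|exact: open_measurable_rV|].
by move=> y h; apply/eU/ball_boxP; split=> // i; rewrite distrC.
Qed.

(** A change of variables without determinants.  Let [E] be the unit ball and
    [tau x = x *m A].  The sets of pairs [(x, y)] with [x \in S, x - tau y \in E]
    and with [x \in E, x + tau y \in S] have slices at fixed [y] that are
    translates of each other, hence the same measure; their slices at fixed [x]
    give the values [|E| |S|] and [|E| |tau^-1 S|]. *)
Lemma lebesgue_orth n (A : 'M[R]_n) (S : set 'rV[R]_n) :
  A *m A = 1%:M -> (forall x : 'rV[R]_n, dotv (x *m A) (x *m A) = dotv x x) ->
  measurable S -> lam n ((fun x => x *m A) @^-1` S) = lam n S.
Proof.
move=> AA Anorm mS.
pose E := open_ball n; pose tau (x : 'rV[R]_n) := x *m A.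
have tauK x : tau (tau x) = x by rewrite /tau -mulmxA AA mulmx1.
have tauD x y : tau (x + y) = tau x + tau y by rewrite /tau mulmxDl.
have mE : measurable E := @measurable_open_ball n.
have mp (X Y : set 'rV[R]_n) (s : R) : measurable X -> measurable Y ->
    measurable [set p : 'rV[R]_n * 'rV[R]_n | X p.1 /\ Y (p.1 + s *: tau p.2)].
  move=> mX mY.
  rewrite (_ : [set p | _] = (X `*` setT) `&` (fun p : 'rV[R]_n * 'rV[R]_n => p.1 + s *: tau p.2) @^-1` Y).
    apply: measurableI; first exact: measurableX.
    have mf : measurable_fun setT (fun p : 'rV[R]_n * 'rV[R]_n => p.1 + s *: tau p.2).
      apply: measurable_fun_rVP => i.
      rewrite (_ : _ \o _ = (fun p : 'rV[R]_n * 'rV[R]_n => p.1 0 i + s * (tau p.2) 0 i)); last first.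
        by apply/funext => p; rewrite /= /coord_rV !mxE.
      have m1 : measurable_fun setT (fun p : 'rV[R]_n * 'rV[R]_n => p.1 0 i : R).
        exact: (measurableT_comp (measurable_coord i) measurable_fst).
      have m2 : measurable_fun setT (fun p : 'rV[R]_n * 'rV[R]_n => tau p.2 0 i : R).
        apply: (measurableT_comp (measurable_coord i)).
        exact: (measurableT_comp (measurable_mulmxr A) measurable_snd).
      by apply: measurable_funD => //; exact: measurable_funM.
    by rewrite -[X in measurable X]setTI; apply: mf.
  by apply/seteqP; split => -[x y]; [move=> [? ?]|move=> [[? _] ?]].
pose S1 := [set p : 'rV[R]_n * 'rV[R]_n | S p.1 /\ E (p.1 + (-1) *: tau p.2)].
pose S2 := [set p : 'rV[R]_n * 'rV[R]_n | E p.1 /\ S (p.1 + 1 *: tau p.2)].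
have mS1 : measurable S1 by exact: mp.
have mS2 : measurable S2 by exact: mp.
have mtau (X : set 'rV[R]_n) : measurable X -> measurable (tau @^-1` X).
  by move=> mX; rewrite -[X in measurable X]setTI; apply: measurable_mulmxr.
have Etau : tau @^-1` E = E.
  by apply/seteqP; split => x /=; rewrite /E /open_ball/= !enorm_lt1 Anorm.
have mul_indic (X : set 'rV[R]_n) (c : \bar R) : measurable X -> (0 <= c)%E ->
    (\int[lam n]_x (c * (\1_X x)%:E) = c * lam n X)%E.
  move=> mX c0; rewrite ge0_integralZl//.
  - by rewrite integral_indic// setIT.
  exact/measurable_EFinP/measurable_indic.
have Ekey x y : E (x + (-1) *: tau y) <-> E (y - tau x).
  rewrite /E /open_ball /mkset !enorm_lt1 -(Anorm (x + _)) -/(tau (x + _)).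
  have -> : tau (x + (-1) *: tau y) = - (y - tau x).
    by rewrite tauD scaleN1r opprB {2}/tau mulNmx -/(tau (tau y)) tauK.
  by rewrite dotvNl dotvNr opprK.
have P1 : (lam n \x lam n)%E S1 = (lam n E * lam n S)%E.
  rewrite -mul_indic//; apply: eq_integral => x _ /=.
  rewrite indicE; case: (boolP (x \in S)) => [/set_mem xS|/negP xS].
    rewrite mule1 -(lebesgue_translate (- tau x) (A := E))//.
    by congr (lam n _); apply/seteqP; split => y; rewrite /xsection/= inE /S1/=;
      [move=> [_ /Ekey]|move=> h; split=> //; exact/Ekey].
  rewrite mule0 (_ : xsection _ _ = set0) ?measure0//.
  apply/seteqP; split => y //; rewrite /xsection/= inE /S1/= => -[xS' _].
  by apply: xS; rewrite inE.
have P2 : (lam n \x lam n)%E S2 = (lam n (tau @^-1` S) * lam n E)%E.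
  rewrite -mul_indic//; apply: eq_integral => x _ /=.
  rewrite indicE; case: (boolP (x \in E)) => [/set_mem xE|/negP xE].
    rewrite mule1 -[RHS](lebesgue_translate (tau x)); last exact: mtau.
    congr (lam n _); apply/seteqP; split => y; rewrite /xsection/= inE /S2/=.
      by move=> [_]; rewrite tauD tauK scale1r addrC.
    by move=> h; split=> //; move: h; rewrite tauD tauK scale1r addrC.
  rewrite mule0 (_ : xsection _ _ = set0) ?measure0//.
  apply/seteqP; split => y //; rewrite /xsection/= inE /S2/= => -[xE' _].
  by apply: xE; rewrite inE.
have P3 (X : set ('rV[R]_n * 'rV[R]_n)) : measurable X ->
    ((lam n \x lam n) X = \int[lam n]_y lam n (ysection X y))%E.
  move=> mX; transitivity ((lam n \x^ lam n)%E X); last by [].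
  by apply: product_measure_unique => //= Y Z mY mZ; rewrite product_measure2E.
have P12 : (lam n \x lam n)%E S1 = (lam n \x lam n)%E S2.
  rewrite !P3//; apply: eq_integral => y _.
  rewrite -[LHS](lebesgue_translate (tau y)); last exact: measurable_ysection.
  congr (lam n _); apply/seteqP; split => x; rewrite /ysection/= !inE /S1 /S2/=;
  by rewrite scaleN1r addrK scale1r => -[].
have : (lam n E * lam n S = lam n E * lam n (tau @^-1` S))%E.
  by rewrite -P1 P12 P2 muleC.
have Efin : lam n E \is a fin_num by rewrite ge0_fin_numE// lebesgue_open_ball_fin.
have E0 : (0 < lam n E)%E.
  apply: (@lebesgue_open_gt0 _ _ 0); first exact: open_open_ball.
  by rewrite /E /open_ball/= enorm_lt1 (_ : dotv _ _ = 0) ?ltr01//; apply/eqP; rewrite dotv_eq0.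
move=> /(congr1 (fun z => (lam n E)^-1 * z)%E).
by rewrite !muleA !(muleC (lam n E)^-1%E) !divee// ?gt_eqF// !mul1e => ->.
Qed.

End measure_rV.
Arguments open_ball {R} n.

(** * Integrals over the ball *)

Section integral_rV.
Context {R : realType}.
Notation lam n := (@lebesgue_rV R n).

Lemma tonelli_rV n (F : 'rV[R]_n.+1 -> \bar R) : measurable_fun setT F ->
  (forall x, 0 <= F x)%E ->
  (\int[lam n.+1]_x F x =
   \int[lam n]_y \int[lebesgue_measure]_a F (cons_rV (a : measurableTypeR R, y)))%E.
Proof.
move=> mF F0.
transitivity (\int[pushforward (lebesgue_measure \x lam n)%E (@cons_rV R n)]_x F x)%E.
  by [].
rewrite ge0_integral_pushforward//; last exact: measurable_cons_rV.
rewrite preimage_setT fubini_tonelli2//.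
exact: measurableT_comp (@measurable_cons_rV R n).
by move=> p; exact: F0.
Qed.

Lemma dotv_cons n (a b : R) (x y : 'rV[R]_n) :
  dotv (cons_rV (a : measurableTypeR R, x)) (cons_rV (b : measurableTypeR R, y))
  = a * b + dotv x y.
Proof.
have E0 (c : R) (z : 'rV[R]_n) : cons_rV (c : measurableTypeR R, z) 0 ord0 = c.
  by have := cons_rVK (c : measurableTypeR R, z); case.
have ES (c : R) (z : 'rV[R]_n) i : cons_rV (c : measurableTypeR R, z) 0 (lift ord0 i) = z 0 i.
  have := cons_rVK (c : measurableTypeR R, z).
  by rewrite /uncons_rV => -[_ /rowP/(_ i)]; rewrite mxE.
by rewrite /dotv big_ord_recl !E0; congr (_ + _); apply: eq_bigr => i _; rewrite !ES.
Qed.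

Lemma measurable_sqnorm n : measurable_fun setT (fun x : 'rV[R]_n => dotv x x).
Proof.
by apply: measurable_sum => i; apply: measurable_funM; exact: measurable_coord.
Qed.

(** A line parallel to the first axis meets the sphere in at most two points. *)
Lemma lebesgue_sphere n : lam n.+1 [set x : 'rV[R]_n.+1 | enorm x = 1] = 0%E.
Proof.
rewrite (_ : [set x | _] = [set x : 'rV[R]_n.+1 | dotv x x = 1]); last first.
  apply/seteqP; split => x /=.
    by move=> x1; rewrite -sqr_enorm x1 expr1n.
  by rewrite /enorm => ->; rewrite sqrtr1.
set S := [set x | _].
have mS : measurable S.
  rewrite (_ : S = setT `&` (fun x => dotv x x) @^-1` [set 1]).
    by apply: measurable_sqnorm => //; exact: measurable_set1.
  by rewrite setTI.
rewrite -(setIT S) -integral_indic// tonelli_rV//; last first.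
- exact/measurable_EFinP/measurable_indic.
apply: integral0_eq => y _.
have -> : (\int[lebesgue_measure]_a (\1_S (cons_rV (a : measurableTypeR R, y)))%:E =
    \int[lebesgue_measure]_a (\1_[set a : measurableTypeR R | (a : R) ^+ 2 + dotv y y = 1%R] a)%:E :> \bar R)%E.
  apply: eq_integral => a _; rewrite !indicE; congr ((nat_of_bool _)%:R%:E).
  by apply/idP/idP; rewrite !inE /S/= dotv_cons expr2.
have fS : finite_set [set a : R | a ^+ 2 + dotv y y = 1].
  apply: (@sub_finite_set _ _ [set Num.sqrt (1 - dotv y y); - Num.sqrt (1 - dotv y y)]).
    move=> a /= h; have -> : 1 - dotv y y = a ^+ 2 by rewrite -h; ring.
    rewrite sqrtr_sqr; have [a0|a0] := leP 0 a; [left|right]; first by rewrite ger0_norm.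
    by rewrite ltr0_norm// opprK.
  by rewrite finite_setU; split; exact: finite_set1.
rewrite integral_indic//; last exact: countable_measurable (finite_set_countable fS).
by rewrite setIT; apply: countable_lebesgue_measure0; exact: finite_set_countable.
Qed.

Lemma integral_inv_sqrt (r c : R) : 0 < r -> r ^+ 2 < c ->
  (\int[lebesgue_measure]_(a in `[(- r)%R, r]) ((Num.sqrt (c - a ^+ 2))^-1)%:E <= (pi : R)%:E)%E.
Proof.
move=> r0 rc; have c0 : 0 < c by apply: le_lt_trans rc; exact: sqr_ge0.
have sc0 : 0 < Num.sqrt c by rewrite sqrtr_gt0.
pose F := (@asin R) \o ((Num.sqrt c)^-1 \*: (@idfun R^o : R -> R^o)).
have ab (a : R) : -r <= a <= r -> a ^+ 2 < c.
  by move=> /andP[h1 h2]; apply: le_lt_trans rc; nra.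
have ab1 (a : R) : -r <= a <= r -> -1 < (Num.sqrt c)^-1 * a < 1.
  move=> /ab h; rewrite -ltr_norml normrM (gtr0_norm (x := (_^-1))) ?invr_gt0//.
  by rewrite mulrC ltr_pdivrMr// mul1r -sqrtr_sqr ltr_sqrt.
have dF (a : R) : -r <= a <= r -> is_derive a (1 : R) F (Num.sqrt (c - a ^+ 2))^-1.
  move=> h; have dA := is_derive1_asin (ab1 _ h).
  have dl : is_derive a (1 : R) ((Num.sqrt c)^-1 \*: (@idfun R^o : R -> R^o)) ((Num.sqrt c)^-1 *: (1 : R^o)).
    exact: is_deriveZ.
  have := is_derive1_comp dA dl; congr is_derive.
  rewrite /GRing.scale/= mulr1 -invfM -sqrtrM; last first.
    by have /andP[] := ab1 _ h; nra.
  congr (Num.sqrt _)^-1; rewrite exprMn exprVn sqr_sqrtr ?ltW//.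
  by rewrite mulrBl mul1r mulrAC mulVf ?gt_eqF// mul1r.
have cF (a : R) : -r <= a <= r -> {for a, continuous F}.
  by move=> /dF h; apply/differentiable_continuous/derivable1_diffP.
have cf (a : R) : -r <= a <= r -> {for a, continuous (fun a : R => (Num.sqrt (c - a ^+ 2))^-1)}.
  move=> h; apply: cvgV.
    by rewrite gt_eqF// sqrtr_gt0 subr_gt0 ab.
  apply: continuous_comp; last exact: sqrt_continuous.
  by apply: cvgB; [exact: cvg_cst|exact: exprn_continuous].
rewrite (@continuous_FTC2 _ _ F)//.
- rewrite -EFinB lee_fin /F/=.
  have := @asin_lepi2 R ((Num.sqrt c)^-1 * r).
  have := @asin_geNpi2 R ((Num.sqrt c)^-1 * - r).
  have /andP[h1 h2] := ab1 r ltac:(lra).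
  have /andP[h3 h4] := ab1 (- r) ltac:(lra).
  move=> /(_ ltac:(lra)) h5 /(_ ltac:(lra)) h6.
  rewrite /GRing.scale/=; lra.
- by lra.
- apply: continuous_in_subspaceT => a; rewrite inE/= in_itv/= => h; exact: cf.
- split.
  + by move=> a; rewrite in_itv/= => h; have [] := dF a ltac:(lra).
  + by apply: cvg_at_right_filter; apply: cF; lra.
  + by apply: cvg_at_left_filter; apply: cF; lra.
- move=> a; rewrite in_itv/= => h; rewrite derive1E.
  by have [_ ->] := dF a ltac:(lra).
Qed.

Lemma measurable_invr : measurable_fun setT (fun x : R => x^-1).
Proof.
(* Reduces to the measurability of powers with real exponents; at 0, both sides are 0. *)
have -> : (fun x : R => x^-1) = (fun x => x * (x ^+ 2) `^ (-1)).
  apply/funext => x; rewrite powR_inv1 ?sqr_ge0//.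
  have [->|x0] := eqVneq x 0; first by rewrite invr0 mul0r.
  by rewrite expr2 invfM mulrA divff ?mul1r.
apply: measurable_funM => //.
apply: (measurableT_comp (measurable_powR _)); exact: measurable_funX.
Qed.

Lemma measurable_fun_inv d (T : measurableType d) (D : set T) (f : T -> R) :
  measurable_fun D f -> measurable_fun D (fun x => (f x)^-1).
Proof. exact: (measurableT_comp measurable_invr). Qed.

Lemma measurable_fun_sqrt d (T : measurableType d) (D : set T) (f : T -> R) :
  measurable_fun D f -> measurable_fun D (fun x => Num.sqrt (f x)).
Proof.
apply: measurableT_comp; apply: continuous_measurable_fun; exact: sqrt_continuous.
Qed.

Lemma measurable_sqr (D : set (measurableTypeR R)) :
  measurable_fun D (fun a : measurableTypeR R => (a : R) ^+ 2).
Proof.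
have m1 : measurable_fun D (@idfun R : measurableTypeR R -> R) by exact: measurable_id.
exact: (measurable_funM m1 m1).
Qed.

Lemma inv_sqrt_slice (y2 e : R) : 0 < e -> 0 <= y2 < 1 ->
  (\int[lebesgue_measure]_(a in [set a : measurableTypeR R | ((a : R) ^+ 2 + y2 < 1)%R])
     ((Num.sqrt (1 - ((a : R) ^+ 2 + y2) + e))^-1)%:E <= (pi : R)%:E)%E.
Proof.
move=> e0 /andP[y0 y1].
pose r := Num.sqrt (1 - y2).
have r0 : 0 < r by rewrite sqrtr_gt0; lra.
have r2 : r ^+ 2 = 1 - y2 by rewrite sqr_sqrtr; lra.
apply: le_trans (@integral_inv_sqrt r (1 - y2 + e) r0 _); last by lra.
have mg (D : set (measurableTypeR R)) : measurable_fun D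
    (fun a : measurableTypeR R => (Num.sqrt (1 - y2 + e - (a : R) ^+ 2))^-1).
  apply: measurable_fun_inv; apply: measurable_fun_sqrt; apply: measurable_funB => //.
have E0 (a : R) : 1 - (a ^+ 2 + y2) + e = 1 - y2 + e - a ^+ 2 by ring.
under eq_integral do rewrite E0.
apply: ge0_subset_integral => //=.
- have mf : measurable_fun setT (fun a : measurableTypeR R => (a : R) ^+ 2 + y2).
    by apply: measurable_funD => //; exact: measurable_sqr.
  have := mf measurableT `]-oo, (1:R)[%classic (measurable_itv _).
  by rewrite setTI set_itvE.
- exact/measurable_EFinP.
move=> a /=; rewrite in_itv/= -ler_norml -sqrtr_sqr => h.
  by rewrite /r ler_sqrt; lra.
Qed.

(** On a line parallel to the first axis, the integrand is the derivative of an
    arcsine, and its integral is at most [pi].  The approximations [g k] are bounded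
    up to the sphere. *)
Lemma integrable_inv_sqrt n :
  (\int[lam n.+1]_(x in open_ball n.+1) ((Num.sqrt (1 - dotv x x))^-1)%:E < +oo)%E.
Proof.
pose g (k : nat) (x : 'rV[R]_n.+1) : \bar R := ((Num.sqrt (1 - dotv x x + k.+1%:R^-1))^-1)%:E.
have mo m := @measurable_open_ball R m.
have mo1 := mo n.+1.
have mg k D : measurable_fun D (g k).
  apply/measurable_EFinP; apply: measurable_fun_inv; apply: measurable_fun_sqrt.
  apply: measurable_funD => //; apply: measurable_funB => //.
  apply: measurable_funTS; exact: measurable_sqnorm.
have g0 k x : (0 <= g k x)%E by rewrite lee_fin invr_ge0 sqrtr_ge0.
have gb k : (\int[lam n.+1]_(x in open_ball n.+1) g k x <= (pi : R)%:E * lam n (open_ball n))%E.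
  rewrite integral_mkcond tonelli_rV; last 2 first.
  - by apply/(measurable_restrictT _ (mo _)); exact: mg.
  - by move=> x; rewrite patchE; case: ifP.
  have -> : ((pi : R)%:E * lam n (open_ball n) =
      \int[lam n]_y ((pi : R)%:E * (\1_(open_ball n) y)%:E))%E.
    rewrite ge0_integralZl//; last 2 first.
    - apply/measurable_EFinP; apply: measurable_indic; exact: mo.
    - by rewrite lee_fin pi_ge0.
    rewrite integral_indic ?setIT//; first exact: mo.
  apply: ge0_le_integral => //.
  - move=> y _; apply: integral_ge0 => a _; rewrite patchE; case: ifP => // _.
  - apply: (@measurable_fun_fubini_tonelli_G _ _ _ _ _ lebesgue_measure (fun p => (g k \_ (open_ball n.+1)) (cons_rV p))).
      apply: (measurableT_comp _ (@measurable_cons_rV R n)).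
      by apply/(measurable_restrictT _ (mo _)); exact: mg.
    by move=> p; rewrite patchE; case: ifP.
  - by apply: measurable_funeM; apply/measurable_EFinP; apply: measurable_indic; exact: mo.
  move=> y _.
  have E1 (a : measurableTypeR R) : (g k \_ (open_ball n.+1)) (cons_rV (a, y)) =
      ((fun a : measurableTypeR R => ((Num.sqrt (1 - ((a : R) ^+ 2 + dotv y y) + k.+1%:R^-1))^-1)%:E) \_
        [set a : measurableTypeR R | ((a : R) ^+ 2 + dotv y y < 1)%R]) a.
    rewrite !patchE /g dotv_cons -expr2.
    have -> : (cons_rV (a, y) \in open_ball n.+1) =
       (a \in [set a : measurableTypeR R | ((a : R) ^+ 2 + dotv y y < 1)%R]) => //.
    by apply/idP/idP; rewrite !inE /open_ball/= enorm_lt1 dotv_cons -expr2.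
  under eq_integral do rewrite E1.
  rewrite -integral_mkcond indicE; case: (boolP (y \in _)) => /=.
    rewrite inE /open_ball/= enorm_lt1 mule1 => y1; apply: inv_sqrt_slice.
      by rewrite invr_gt0.
    by rewrite dotv_ge0.
  rewrite notin_setE /open_ball/= enorm_lt1 mule0 => /negP; rewrite -leNgt => y1.
  rewrite (_ : [set a | _] = set0) ?integral_set0//.
  apply/seteqP; split => a //=; rewrite ltNge => /negP; apply.
  by rewrite (le_trans y1)// lerDr sqr_ge0.
have : (\int[lam n.+1]_(x in open_ball n.+1) g k x)%E @[k --> \oo] -->
    (\int[lam n.+1]_(x in open_ball n.+1) limn (g^~ x))%E.
  apply: cvg_monotone_convergence => // x; rewrite /open_ball/= enorm_lt1 => x1 k l kl.
  have p (m : nat) : 0 < 1 - dotv x x + m.+1%:R^-1.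
    by rewrite addr_gt0 ?invr_gt0// subr_gt0.
  rewrite lee_fin lef_pV2 ?posrE ?sqrtr_gt0; [|exact: (p k)|exact: (p l)].
  by apply: ler_wsqrtr; rewrite lerD2l lef_pV2 ?posrE// ler_nat.
move=> h; have {}h := cvg_lim (@ereal_hausdorff R) h.
have -> : (\int[lam n.+1]_(x in open_ball n.+1) ((Num.sqrt (1 - dotv x x))^-1)%:E =
    \int[lam n.+1]_(x in open_ball n.+1) limn (g^~ x))%E.
  apply: eq_integral => x; rewrite inE /open_ball/= enorm_lt1 => x1.
  apply/esym/cvg_lim => //; apply: cvg_EFin; first exact: nearW.
  rewrite /comp/=; apply: cvgV; first by rewrite gt_eqF// sqrtr_gt0; lra.
  apply: continuous_cvg; first exact: sqrt_continuous.
  rewrite -[X in _ --> X]addr0; apply: cvgD; first exact: cvg_cst.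
  exact: cvg_harmonic.
rewrite -h; apply: (@le_lt_trans _ _ ((pi : R)%:E * lam n (open_ball n))%E).
  apply: lime_le; last exact: nearW.
  apply: ereal_nondecreasing_is_cvgn => k l kl; apply: ge0_le_integral => // x.
  rewrite /open_ball/= enorm_lt1 => x1.
  have p (m : nat) : 0 < 1 - dotv x x + m.+1%:R^-1.
    by rewrite addr_gt0 ?invr_gt0// subr_gt0.
  rewrite lee_fin lef_pV2 ?posrE ?sqrtr_gt0; [|exact: (p k)|exact: (p l)].
  by apply: ler_wsqrtr; rewrite lerD2l lef_pV2 ?posrE// ler_nat.
have := @lebesgue_open_ball_fin R n; rewrite -ge0_fin_numE// => /fineK <-.
by rewrite -EFinM ltry.
Qed.

End integral_rV.

(** * Directional derivatives *)

Section difference_quotient.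
Context {R : realType} {V : normedModType R}.
Implicit Types (f g : V -> R) (x v : V) (l : R).

Lemma is_deriveP f x v l : is_derive x v (f : V -> R^o) l <->
  h^-1 * (f (h *: v + x) - f x) @[h --> (0 : R)^'] --> l.
Proof.
split=> [[df <-]|h]; first exact: df.
have df : derivable (f : V -> R^o) x v by apply/cvg_ex; exists l.
by apply: DeriveDef => //; exact: (cvg_lim (@Rhausdorff R) h).
Qed.

End difference_quotient.

Section directional.
Context {R : realType} {V : normedModType R}.
Implicit Types (f g : V -> R) (x v : V) (l : R).

Lemma is_derive_line f x v t l : is_derive (t *: v + x) v (f : V -> R^o) l <->
  is_derive t (1 : R) (fun s => f (s *: v + x) : R^o) l.
Proof.
have E : (fun h : R => h^-1 * (f (h *: v + (t *: v + x)) - f (t *: v + x))) =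
   (fun h : R => h^-1 * (f ((h *: (1 : R^o) + t : R) *: v + x) - f (t *: v + x))).
  by apply/funext => h; rewrite addrA -scalerDl [h *: _]mulr1.
split=> [/is_deriveP h|/(@is_deriveP R R^o) h].
  by apply/(@is_deriveP R R^o); rewrite -E.
by apply/is_deriveP; rewrite E.
Qed.

Lemma is_derive_comp_R (g : R -> R) f x v l m : is_derive x v (f : V -> R^o) l ->
  is_derive (f x) (1 : R) (g : R -> R^o) m -> is_derive x v (g \o f : V -> R^o) (m * l).
Proof.
move=> df dg.
have {}df : is_derive (0 : R) (1 : R) (fun s => f (s *: v + x) : R^o) l.
  by apply/is_derive_line; rewrite scale0r add0r.
have := @is_derive1_comp _ g (fun s => f (s *: v + x)) 0 m l.
rewrite scale0r add0r => /(_ dg df) h.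
have := (is_derive_line (g \o f) x v 0 (m * l)).2.
by rewrite scale0r add0r; apply.
Qed.

Lemma lipschitz_line f x v (df : R -> R) (M b : R) : 0 <= b ->
  (forall t, 0 <= t <= b -> is_derive (t *: v + x) v (f : V -> R^o) (df t)) ->
  (forall t, 0 <= t <= b -> `|df t| <= M) ->
  `|f (b *: v + x) - f x| <= M * b.
Proof.
rewrite le_eqVlt => /predU1P[<- _ _|b0 dfE dfM].
  by rewrite scale0r add0r subrr normr0 mulr0.
pose F (s : R) := f (s *: v + x).
have dF t : 0 <= t <= b -> is_derive t (1 : R) F (df t).
  by move=> tb; apply/is_derive_line/dfE.
have cF t : 0 <= t <= b -> {for t, continuous F}.
  by move=> /dF h; apply/differentiable_continuous/derivable1_diffP.
have [c cb] : exists2 c, c \in `]0, b[%R & F b - F 0 = df c * (b - 0).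
  apply: MVT => //; first by move=> t; rewrite in_itv/= => h; apply: dF; lra.
  apply: continuous_in_subspaceT => a; rewrite inE/= in_itv/=; exact: cF.
rewrite /F scale0r add0r subr0 => ->; rewrite normrM (gtr0_norm b0) ler_pM2r//.
by apply: dfM; move: cb; rewrite in_itv/=; lra.
Qed.

End directional.

(** * Polynomials and their Dunkl difference quotients *)

Section polynomials.
Context {R : realType} {d : nat}.
Notation mp := (mpoly.mpoly d R).
Notation msize p := (mpoly.msize p).
Notation mderiv := mpoly.mderiv.
Notation X_ i := (mpoly.mpolyX R (mpoly.mnm1 i)).
Implicit Types (c : R) (p q : mp) (x : 'rV[R]_d) (n : nat).

Lemma poly_funD p q x : poly_fun (p + q) x = poly_fun p x + poly_fun q x.
Proof. exact: mpoly.mevalD. Qed.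

Lemma poly_funN p x : poly_fun (- p) x = - poly_fun p x.
Proof. exact: mpoly.mevalN. Qed.

Lemma poly_funB p q x : poly_fun (p - q) x = poly_fun p x - poly_fun q x.
Proof. exact: mpoly.mevalB. Qed.

Lemma poly_funM p q x : poly_fun (p * q) x = poly_fun p x * poly_fun q x.
Proof. exact: mpoly.mevalM. Qed.

Lemma poly_funZ c p x : poly_fun (c *: p) x = c * poly_fun p x.
Proof. exact: mpoly.mevalZ. Qed.

Lemma poly_funC c x : poly_fun (mpoly.mpolyC d c) x = c.
Proof. exact: mpoly.mevalC. Qed.

Lemma poly_funX i x : poly_fun (X_ i) x = x 0 i.
Proof. exact: mpoly.mevalXU. Qed.

Lemma poly_fun0 x : poly_fun (0 : mp) x = 0.
Proof. exact: mpoly.meval0. Qed.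

Lemma poly_fun_sum I (r : seq I) (P : pred I) (F : I -> mp) x :
  poly_fun (\sum_(i <- r | P i) F i) x = \sum_(i <- r | P i) poly_fun (F i) x.
Proof. by elim/big_rec2 : _ => [|i y p _ <-]; rewrite ?poly_fun0// poly_funD. Qed.

Lemma msizeD n p q : (msize p <= n)%N -> (msize q <= n)%N -> (msize (p + q) <= n)%N.
Proof.
move=> pn qn; apply: leq_trans (mpoly.msizeD_le p q) _.
by rewrite geq_max pn.
Qed.

Lemma msizeZ n c p : (msize p <= n)%N -> (msize (c *: p) <= n)%N.
Proof. exact/leq_trans/mpoly.msizeZ_le. Qed.

Lemma msizeN n p : (msize p <= n)%N -> (msize (- p) <= n)%N.
Proof. by rewrite -scaleN1r; exact: msizeZ. Qed.

Lemma msizeB n p q : (msize p <= n)%N -> (msize q <= n)%N -> (msize (p - q) <= n)%N.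
Proof. by move=> pn qn; apply: msizeD => //; exact: msizeN. Qed.

Lemma msize_sum n I (r : seq I) (P : pred I) (F : I -> mp) :
  (forall i, P i -> msize (F i) <= n)%N -> (msize (\sum_(i <- r | P i) F i) <= n)%N.
Proof.
move=> Fn; elim/big_ind : _ => //; first by rewrite mpoly.msize0.
by move=> p q; exact: msizeD.
Qed.

Lemma msizeXM n i p : (msize p <= n)%N -> (msize (X_ i * p) <= n.+1)%N.
Proof.
move=> pn; have [->|p0] := eqVneq p 0; first by rewrite mulr0 mpoly.msize0.
rewrite mpoly.msizeM ?mpoly.msizeX ?mpoly.mdeg1//.
by rewrite -mpoly.msize_poly_eq0 mpoly.msizeX.
Qed.

Lemma msizeC n c : (msize (mpoly.mpolyC d c) <= n.+1)%N.
Proof. by rewrite mpoly.msizeC; case: (c != 0). Qed.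

(** The index is a strict bound of the degree, so that index 0 only concerns the
    null polynomial. *)
Lemma mpoly_deg_ind (Q : nat -> mp -> Prop) :
  (forall n, Q n 0) ->
  (forall n c, Q n.+1 (mpoly.mpolyC d c)) ->
  (forall n p q, Q n p -> Q n q -> Q n (p + q)) ->
  (forall n i p, Q n p -> Q n.+1 (X_ i * p)) ->
  forall n p, (msize p <= n)%N -> Q n p.
Proof.
move=> Q0 QC QD QX n p pn.
have QM m : forall n c, (mpoly.mdeg m < n)%N -> Q n (c *: mpoly.mpolyX R m).
  have [k] := ubnP (mpoly.mdeg m); elim: k m => // k IH m mk [//|l] c; rewrite ltnS => mn.
  have [->|m0] := eqVneq m mpoly.mnm0.
    by rewrite mpoly.mpolyX0 -mpoly.mpolyC1 -mpoly.mul_mpolyC -mpoly.mpolyCM mulr1; exact: QC.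
  have [i mi] : exists i, (m i != 0)%N.
    apply/existsP; apply: contra_neqT m0; rewrite negb_exists => /forallP h.
    apply/mpoly.mnmP => i; rewrite mpoly.mnm0E; apply/eqP.
    by have := h i; rewrite negbK.
  have mE : m = (mpoly.mnm_add (mpoly.mnm1 i) (mpoly.mnm_sub m (mpoly.mnm1 i))).
    apply/mpoly.mnmP => j; rewrite mpoly.mnmDE mpoly.mnmBE mpoly.mnm1E.
    by case: eqVneq => [<-|]; rewrite ?subn0// subnKC// lt0n.
  have dE : mpoly.mdeg m = (mpoly.mdeg (mpoly.mnm_sub m (mpoly.mnm1 i))).+1.
    by rewrite {1}mE mpoly.mdegD mpoly.mdeg1.
  rewrite mE mpoly.mpolyXD scalerAr; apply: QX; apply: IH.
    by rewrite -ltnS -dE.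
  by rewrite -dE.
rewrite (mpoly.mpolyE p) big_seq; elim/big_ind : _ => //; first exact: QD.
move=> m mp_; apply: QM; exact: leq_trans (mpoly.msize_mdeg_lt mp_) pn.
Qed.

Lemma mpoly_ind (Q : mp -> Prop) :
  (forall c, Q (mpoly.mpolyC d c)) -> (forall p q, Q p -> Q q -> Q (p + q)) ->
  (forall i p, Q p -> Q (X_ i * p)) -> forall p, Q p.
Proof.
move=> QC QD QX p; apply: (@mpoly_deg_ind (fun _ => Q)) (leqnn _) => // n.
by have := QC 0; rewrite mpoly.mpolyC0.
Qed.

Lemma continuous_poly_fun p : continuous (poly_fun p).
Proof.
elim/mpoly_ind : p => [c|p q cp cq|i p cp] x.
- rewrite (_ : poly_fun _ = fun=> c); first exact: cst_continuous.
  by apply/funext => y; rewrite poly_funC.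
- rewrite (_ : poly_fun _ = poly_fun p \+ poly_fun q); first exact: (continuousD (cp x) (cq x)).
  by apply/funext => y; rewrite poly_funD.
- rewrite (_ : poly_fun _ = (fun y : 'rV[R]_d => y 0 i) \* poly_fun p).
    apply: continuousM; [exact: coord_continuous|exact: cp].
  by apply/funext => y; rewrite poly_funM poly_funX.
Qed.

Lemma mderivXi i j : mderiv i (X_ j) = mpoly.mpolyC d (i == j)%:R.
Proof.
rewrite mpoly.mderivX mpoly.mnm1E eq_sym; case: eqVneq => [->|_].
  have -> : mpoly.mnm_sub (mpoly.mnm1 j) (mpoly.mnm1 j) = mpoly.mnm0 :> mpoly.multinom d.
    by apply/mpoly.mnmP => k; rewrite mpoly.mnmBE subnn mpoly.mnm0E.
  by rewrite scale1r mpoly.mpolyX0 mpoly.mpolyC1.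
by rewrite scale0r mpoly.mpolyC0.
Qed.

Lemma is_derive_coord x i j :
  is_derive x (delta_mx 0 i) (fun y : 'rV[R]_d => y 0 j : R^o) ((i == j)%:R : R).
Proof.
apply/is_deriveP; apply: cvg_near_cst.
near=> h; rewrite !mxE addrK eqxx/= (eq_sym j) mulrA mulVf ?mul1r//.
by near: h; exact: nbhs_dnbhs_neq.
Unshelve. all: by end_near. Qed.

Lemma is_derive_poly_fun p x i :
  is_derive x (delta_mx 0 i) (poly_fun p : 'rV[R]_d -> R^o) (poly_fun (mderiv i p) x).
Proof.
elim/mpoly_ind : p x => [c|p q cp cq|j p cp] x.
- rewrite (_ : poly_fun _ = cst c).
    by rewrite mpoly.mderivC poly_fun0; exact: is_derive_cst.
  by apply/funext => y; rewrite poly_funC.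
- rewrite (_ : poly_fun _ = (poly_fun p : _ -> R^o) + (poly_fun q : _ -> R^o)).
    by rewrite mpoly.mderivD poly_funD; exact: is_deriveD.
  by apply/funext => y; rewrite poly_funD.
- rewrite (_ : poly_fun _ = (fun y : 'rV[R]_d => y 0 j : R^o) * (poly_fun p : _ -> R^o)).
    rewrite mpoly.mderivM mderivXi poly_funD !poly_funM poly_funC poly_funX.
    rewrite addrC (mulrC _%:R); apply: is_deriveM; exact: is_derive_coord.
  by apply/funext => y; rewrite poly_funM poly_funX.
Qed.

Lemma msize_mderiv n i p : (msize p <= n.+1)%N -> (msize (mderiv i p) <= n)%N.
Proof.
suff h m : (msize p <= m)%N -> (msize p <= m)%N /\ (msize (mderiv i p) <= m.-1)%N by move=> /h[].
elim/mpoly_deg_ind : m p / => [m|m c|m p q [p1 p2] [q1 q2]|m j p [p1 p2]].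
- by rewrite mpoly.mderiv0 mpoly.msize0.
- by rewrite mpoly.mderivC mpoly.msize0 msizeC.
- by rewrite mpoly.mderivD; split; exact: msizeD.
split; first exact: msizeXM.
rewrite mpoly.mderivM mderivXi mpoly.mul_mpolyC; apply: msizeD; first exact: msizeZ.
case: m p1 p2 => [|m] p1 p2 /=; last exact: msizeXM.
by move: p1; rewrite leqn0 mpoly.msize_poly_eq0 => /eqP ->; rewrite mpoly.mderiv0 mulr0 mpoly.msize0.
Qed.

(** By induction on the degree: the partial derivatives vanish, so [p] is constant. *)
Lemma poly_fun_open_eq0 p (U : set 'rV[R]_d) : open U -> U !=set0 ->
  (forall x, U x -> poly_fun p x = 0) -> p = 0.
Proof.
move=> oU [x0 Ux0]; have [k] := ubnP (msize p).
elim: k p => // k IH p pk p0.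
have dp0 i : mderiv i p = 0.
  case: k IH pk => [_|k IH pk].
    rewrite ltnS leqn0 mpoly.msize_poly_eq0 => /eqP ->; exact: mpoly.mderiv0.
  apply: IH => [|x Ux]; first by rewrite ltnS; exact: msize_mderiv.
  have h := is_derive_poly_fun p x i.
  have h0 : is_derive x (delta_mx 0 i) (poly_fun p : 'rV[R]_d -> R^o) 0.
    have nz : \forall y \near x, (cst 0 : 'rV[R]_d -> R^o) y = poly_fun p y.
      have : nbhs x U by exact: open_nbhs_nbhs.
      by apply: filterS => y /p0 ->.
    exact: (near_eq_is_derive nz (@is_derive_cst R _ R^o 0 _ _)).
  by case: h => _ <-; case: h0 => _ <-.
have pC : p = mpoly.mpolyC d (mpoly.mcoeff mpoly.mnm0 p).
  apply/mpoly.mpolyP => m; rewrite mpoly.mcoeffC.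
  have [->|m0] := eqVneq m mpoly.mnm0; first by rewrite mulr1.
  rewrite mulr0; have [i mi] : exists i, (m i != 0)%N.
    apply/existsP; apply: contra_neqT m0; rewrite negb_exists => /forallP h.
    apply/mpoly.mnmP => i; rewrite mpoly.mnm0E; apply/eqP.
    by have := h i; rewrite negbK.
  have := mpoly.mcoeff_deriv i (mpoly.mnm_sub m (mpoly.mnm1 i)) p.
  rewrite dp0 mpoly.mcoeff0 (_ : mpoly.mnm_add _ _ = m).
    by move/esym/eqP; rewrite mulrn_eq0/= => /eqP.
  apply/mpoly.mnmP => j; rewrite mpoly.mnmDE mpoly.mnmBE mpoly.mnm1E.
  by case: eqVneq => [<-|]; rewrite ?subn0 ?addn0// subnK// lt0n.
have := p0 _ Ux0; rewrite pC poly_funC => ->.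
exact: mpoly.mpolyC0.
Qed.

(** The Euler operator, whose eigenspaces are the homogeneous polynomials. *)
Definition euler p : mp := \sum_(i < d) X_ i * mderiv i p.

Lemma eulerD p q : euler (p + q) = euler p + euler q.
Proof. by rewrite /euler -big_split; apply: eq_bigr => i _; rewrite mpoly.mderivD mulrDr. Qed.

Lemma eulerC c : euler (mpoly.mpolyC d c) = 0.
Proof. by rewrite /euler big1// => i _; rewrite mpoly.mderivC mulr0. Qed.

Lemma euler0 : euler 0 = 0.
Proof. by rewrite /euler big1// => i _; rewrite mpoly.mderiv0 mulr0. Qed.

Lemma eulerXM i p : euler (X_ i * p) = X_ i * p + X_ i * euler p.
Proof.
rewrite /euler mulr_sumr.
under eq_bigr do rewrite mpoly.mderivM mderivXi mpoly.mul_mpolyC mulrDr -scalerAr.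
rewrite big_split/=; congr (_ + _).
  rewrite (bigD1 i)//= eqxx scale1r big1 ?addr0// => j ji.
  by rewrite (negbTE ji) scale0r.
by apply: eq_bigr => j _; rewrite mulrCA.
Qed.

(** The top degree part of [p] is an eigenvector of the Euler operator. *)
Lemma msize_euler_sub n p : (msize p <= n.+1)%N ->
  (msize (euler p - n%:R *: p) <= n)%N.
Proof.
suff h m : (msize p <= m)%N -> (msize p <= m)%N /\
    (msize (euler p - m.-1%:R *: p) <= m.-1)%N by move=> /h[].
elim/mpoly_deg_ind : m p / => [m|m c|m p q [p1 p2] [q1 q2]|m j p [p1 p2]].
- by rewrite euler0 scaler0 subr0 mpoly.msize0.
- split; first exact: msizeC.
  rewrite eulerC sub0r; apply: msizeN; case: m => [|m]; last exact/msizeZ/msizeC.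
  by rewrite scale0r mpoly.msize0.
- rewrite eulerD scalerDr opprD addrACA; split; exact: msizeD.
split; first exact: msizeXM.
case: m p1 p2 => [|m] p1 p2.
  move: p1; rewrite leqn0 mpoly.msize_poly_eq0 => /eqP ->.
  by rewrite mulr0 euler0 scaler0 subr0 mpoly.msize0.
rewrite eulerXM /= (_ : _ - _ = X_ j * (euler p - m%:R *: p)); first exact: msizeXM.
rewrite -natr1 scalerDl scale1r mulrBr scalerAr [X in _ - X]addrC opprD addrA.
by congr (_ - _); rewrite addrC addKr.
Qed.

Lemma msize_euler n p : (msize p <= n)%N -> (msize (euler p) <= n)%N.
Proof.
case: n => [|n pn].
  rewrite leqn0 mpoly.msize_poly_eq0 => /eqP ->.
  by rewrite euler0 mpoly.msize0.
rewrite -(subrK (n%:R *: p) (euler p)); apply: msizeD; last exact: msizeZ.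
exact: leqW (msize_euler_sub pn).
Qed.

Definition deriv_dir (v : 'rV[R]_d) p : mp := \sum_(i < d) v 0 i *: mderiv i p.

Lemma deriv_dirD v p q : deriv_dir v (p + q) = deriv_dir v p + deriv_dir v q.
Proof. by rewrite /deriv_dir -big_split; apply: eq_bigr => i _; rewrite mpoly.mderivD scalerDr. Qed.

Lemma deriv_dirXM v i p : deriv_dir v (X_ i * p) = v 0 i *: p + X_ i * deriv_dir v p.
Proof.
rewrite /deriv_dir mulr_sumr.
under eq_bigr do rewrite mpoly.mderivM mderivXi mpoly.mul_mpolyC scalerDr scalerA.
rewrite big_split/=; congr (_ + _).
  rewrite (bigD1 i)//= eqxx mulr1 big1 ?addr0// => j ji.
  by rewrite (negbTE ji) mulr0 scale0r.
by apply: eq_bigr => j _; rewrite scalerAr.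
Qed.

Lemma mulmx_refl (v x : 'rV[R]_d) : dotv v v = 2 ->
  x *m refl_mx v = x - dotv x v *: v.
Proof.
move=> v2; rewrite /refl_mx v2 divff ?pnatr_eq0// scale1r mulmxBr mulmx1.
congr (_ - _); rewrite mulmxA [x *m _]mx11_scalar mul_scalar_mx.
by rewrite dotvE.
Qed.

(** Both [p - p \o s] and [2 t D_v p - 2 (p - p \o s)], with [s] the reflection
    in [v] and [t = <x, v>], are divisible in the ring of polynomials, by [t]
    and by [t ^ 2]; so the difference part of the Dunkl Laplacian maps
    polynomials to polynomials and lowers the degree. *)
Lemma dunkl_quotients (v : 'rV[R]_d) n p : dotv v v = 2 -> (msize p <= n)%N ->
  exists q : mp, (msize q <= n.-1)%N /\
    forall x, dotv x v ^+ 2 * poly_fun q x =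
      2 * dotv x v * poly_fun (deriv_dir v p) x -
      2 * (poly_fun p x - poly_fun p (x *m refl_mx v)).
Proof.
move=> v2 pn.
suff [q1 [q2 [_ [_ [q2n [_ q2E]]]]]] : exists q1 q2 : mp,
    (msize p <= n)%N /\ (msize q1 <= n.-1)%N /\ (msize q2 <= n.-1)%N /\
    (forall x, dotv x v * poly_fun q1 x = poly_fun p x - poly_fun p (x *m refl_mx v)) /\
    forall x, dotv x v ^+ 2 * poly_fun q2 x =
      2 * dotv x v * poly_fun (deriv_dir v p) x -
      2 * (poly_fun p x - poly_fun p (x *m refl_mx v)) by exists q2.
have dC (c : R) : deriv_dir v (mpoly.mpolyC d c) = 0.
  by rewrite /deriv_dir big1// => i _; rewrite mpoly.mderivC scaler0.
elim/mpoly_deg_ind : n p / pn => [n|n c|n p q [p1 [p2 [pn [a [b [e f]]]]]] [q1 [q2 [qn [a' [b' [e' f']]]]]]|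
    n i p [p1 [p2 [pn [a [b [e f]]]]]]].
- exists 0, 0; rewrite mpoly.msize0; do 3 (split; first by []); split=> x.
    by rewrite !poly_fun0 mulr0 subrr.
  by rewrite -(mpoly.mpolyC0 d R) dC !poly_funC; ring.
- exists 0, 0; rewrite mpoly.msize0 msizeC; do 3 (split; first by []); split=> x.
    by rewrite poly_fun0 !poly_funC; ring.
  by rewrite dC !poly_fun0 !poly_funC; ring.
- exists (p1 + q1), (p2 + q2); split; first exact: msizeD.
  split; first exact: msizeD.
  split; first exact: msizeD.
  split=> x; first by rewrite !poly_funD mulrDr e e'; ring.
  by rewrite deriv_dirD !poly_funD mulrDr f f'; ring.
pose t : mp := \sum_(j < d) v 0 j *: X_ j.
have tE x : poly_fun t x = dotv x v.
  by rewrite poly_fun_sum; apply: eq_bigr => j _; rewrite poly_funZ poly_funX mulrC.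
(* Leibniz rules for the product with [X_ i], which the reflection maps to [X_ i - v 0 i *: t]. *)
exists (v 0 i *: p + (X_ i * p1 - v 0 i *: (t * p1))), (X_ i * p2 + (2 * v 0 i) *: p1).
split; first exact: msizeXM.
have XM q j : (msize q <= n.-1)%N -> (msize (X_ j * q) <= n)%N.
  case: {pn a b} n => [|n]/=; last exact: msizeXM.
  by rewrite leqn0 mpoly.msize_poly_eq0 => /eqP ->; rewrite mulr0 mpoly.msize0.
split.
  apply: msizeD; first exact: msizeZ.
  apply: msizeB; first exact: XM.
  apply: msizeZ; rewrite /t mulr_suml; apply: msize_sum => j _.
  by rewrite -scalerAl; apply: msizeZ; exact: XM.
split.
  apply: msizeD; first exact: XM.
  by apply: msizeZ; exact: leq_trans a (leq_pred _).
have sE x : (x *m refl_mx v) 0 i = x 0 i - dotv x v * v 0 i.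
  by rewrite mulmx_refl// !mxE.
split=> x.
  rewrite !poly_funD !poly_funZ poly_funN !poly_funZ !poly_funM !poly_funX tE sE.
  transitivity (x 0 i * (dotv x v * poly_fun p1 x) + v 0 i * dotv x v * poly_fun p x
    - v 0 i * dotv x v * (dotv x v * poly_fun p1 x)); first by ring.
  by rewrite e; ring.
rewrite deriv_dirXM !poly_funD !poly_funZ !poly_funM !poly_funX sE.
have ex := e x; have fx := f x.
transitivity (x 0 i * (dotv x v ^+ 2 * poly_fun p2 x) +
   2 * v 0 i * dotv x v * (dotv x v * poly_fun p1 x)); first by ring.
by rewrite fx ex; ring.
Qed.

End polynomials.

(** * Multivariate Bernstein polynomials *)

Section bernstein.
Context {R : realType} {d : nat}.
Notation mp := (mpoly.mpoly d R).
Notation X_ i := (mpoly.mpolyX R (mpoly.mnm1 i)).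
Implicit Types (g h : ('I_d -> nat) -> R) (w : seq 'I_d) (j : 'I_d -> nat) (x : 'rV[R]_d).

(** [bern w g j] is the mean of [g] at the end of a walk in [nat ^ d] that starts
    at [j] and whose successive steps increment the coordinates listed in [w],
    coordinate [i] with probability [(1 + x_i) / 2].  This is the multivariate
    Bernstein polynomial of [g], and the recursive form gives its moments by
    induction. *)
Fixpoint bern w g j : mp :=
  if w is i :: w' then
    2^-1 *: ((1 + X_ i) * bern w' g (fun k => (j k + (k == i))%N)
           + (1 - X_ i) * bern w' g j)
  else mpoly.mpolyC d (g j).

Let cube x := forall i, -1 <= x 0 i <= 1.

Lemma bernE i w g j x : poly_fun (bern (i :: w) g j) x =
  2^-1 * ((1 + x 0 i) * poly_fun (bern w g (fun k => (j k + (k == i))%N)) x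
        + (1 - x 0 i) * poly_fun (bern w g j) x).
Proof.
rewrite [bern _ _ _]/= poly_funZ poly_funD !poly_funM poly_funD poly_funB !poly_funX.
by rewrite -mpoly.mpolyC1 !poly_funC.
Qed.

Lemma bern_le w g h j x : cube x -> (forall k, g k <= h k) ->
  poly_fun (bern w g j) x <= poly_fun (bern w h j) x.
Proof.
move=> cx gh; elim: w j => [j|i w IH j]; first by rewrite /= !poly_funC.
rewrite !bernE; have /andP[x1 x2] := cx i.
rewrite ler_pM2l ?invr_gt0// lerD// ler_wpM2l ?IH//; lra.
Qed.

Lemma bernD w g h j x : poly_fun (bern w (fun k => g k + h k) j) x =
  poly_fun (bern w g j) x + poly_fun (bern w h j) x.
Proof.
elim: w j => [j|i w IH j]; first by rewrite /= !poly_funC.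
by rewrite !bernE !IH; ring.
Qed.

Lemma bernZ w c g j x : poly_fun (bern w (fun k => c * g k) j) x =
  c * poly_fun (bern w g j) x.
Proof.
elim: w j => [j|i w IH j]; first by rewrite /= !poly_funC.
by rewrite !bernE !IH; ring.
Qed.

Lemma bern_cst w c j x : poly_fun (bern w (fun=> c) j) x = c.
Proof.
elim: w j => [j|i w IH j]; first by rewrite /= !poly_funC.
by rewrite !bernE !IH; lra.
Qed.

Lemma bern_sum w (I : Type) (r : seq I) (G : I -> ('I_d -> nat) -> R) j x :
  poly_fun (bern w (fun k => \sum_(i <- r) G i k) j) x =
  \sum_(i <- r) poly_fun (bern w (G i) j) x.
Proof.
elim: r => [|i r IH].
  rewrite big_nil -[RHS](bern_cst w 0 j x); congr (poly_fun (bern _ _ _) _).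
  by apply/funext => k; rewrite big_nil.
rewrite big_cons -IH -bernD; congr (poly_fun (bern _ _ _) _).
by apply/funext => k; rewrite big_cons.
Qed.

Lemma bern_variance w i c j x :
  poly_fun (bern w (fun k => ((k i)%:R - c) ^+ 2) j) x =
  (count_mem i w)%:R * ((1 + x 0 i) / 2 * ((1 - x 0 i) / 2)) +
  ((j i)%:R + (count_mem i w)%:R * ((1 + x 0 i) / 2) - c) ^+ 2.
Proof.
elim: w j => [j|l w IH j]; first by rewrite /= !poly_funC; ring.
rewrite bernE !IH /= !natrD eq_sym.
by case: eqVneq => [->|_] /=; rewrite ?mulr1n ?mulr0n; field.
Qed.

Definition bern_word k : seq 'I_d := flatten [seq nseq k i | i <- enum 'I_d].

Lemma count_bern_word k i : count_mem i (bern_word k) = k.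
Proof.
rewrite /bern_word count_flatten -map_comp sumnE big_map big_enum/=.
rewrite (bigD1 i)//= count_nseq /= eqxx mul1n big1 ?addn0// => l li.
by rewrite count_nseq /= (negbTE li).
Qed.

Definition grid k j : 'rV[R]_d := \row_i (2 * (j i)%:R / k.+1%:R - 1).

(** The walk takes [k + 1] steps in each direction, and [grid] rescales its end
    points to the cube [-1, 1]^d. *)
Definition bernstein (F : 'rV[R]_d -> R) k : mp :=
  bern (bern_word k.+1) (fun j => F (grid k j)) (fun=> 0%N).

Lemma bernstein_bounded (F : 'rV[R]_d -> R) (M : R) k x : cube x ->
  (forall y, `|F y| <= M) -> `|poly_fun (bernstein F k) x| <= M.
Proof.
move=> cx FM; rewrite ler_norml; apply/andP; split.
  rewrite -[X in X <= _](bern_cst (bern_word k.+1) (- M) (fun=> 0%N) x).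
  by apply: bern_le => // j; have := FM (grid k j); rewrite ler_norml => /andP[].
rewrite -[X in _ <= X](bern_cst (bern_word k.+1) M (fun=> 0%N) x).
by apply: bern_le => // j; have := FM (grid k j); rewrite ler_norml => /andP[].
Qed.

(** Chebyshev's argument: [|F x - F y| <= e / 2 + B |y - x|^2] for all [y], and the
    mean of [|y - x|^2] at the end of the walk is at most [d / (k + 1)]. *)
Lemma bernstein_cvg (F : 'rV[R]_d -> R) (M : R) x : cube x ->
  (forall y, `|F y| <= M) -> {for x, continuous F} ->
  poly_fun (bernstein F k) x @[k --> \oo] --> F x.
Proof.
move=> cx FM cF; apply/cvgrPdist_le => e e0.
have e20 : 0 < e / 2 by lra.
have /nbhs_ballP[r /= r0 rP] : nbhs x [set y | `|F x - F y| < e / 2].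
  by move/cvgrPdist_lt : cF => /(_ _ e20).
have M0 : 0 <= M by exact: le_trans (FM x).
pose B := 2 * M / r ^+ 2.
have B0 : 0 <= B by rewrite divr_ge0// ?sqr_ge0// mulr_ge0.
have key k : `|F x - poly_fun (bernstein F k) x| <= e / 2 + B * d%:R / k.+1%:R.
  have pt y : `|F x - F y| <= e / 2 + B * \sum_(i < d) (y 0 i - x 0 i) ^+ 2.
    have S0 : 0 <= \sum_(i < d) (y 0 i - x 0 i) ^+ 2.
      by apply: sumr_ge0 => i _; exact: sqr_ge0.
    have [/existsP[i ri]|] := boolP [exists i, r <= `|x 0 i - y 0 i|].
      apply: (@le_trans _ _ (2 * M)).
        by rewrite (le_trans (ler_normB _ _))// (_ : 2 * M = M + M) ?lerD//; ring.
      rewrite -[X in X <= _]add0r; apply: lerD; first exact: ltW.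
      have -> : 2 * M = B * r ^+ 2 by rewrite /B divfK// sqrf_eq0 gt_eqF.
      rewrite ler_wpM2l// (bigD1 i)//= -[X in X <= _]addr0; apply: lerD.
        by rewrite -(sqrrN (y 0 i - _)) opprB -[leRHS]real_normK ?num_real// ler_pXn2r ?nnegrE// ltW.
      by apply: sumr_ge0 => j _; exact: sqr_ge0.
    rewrite negb_exists => /forallP h.
    have : `|F x - F y| < e / 2.
      by apply: rP; apply/ball_boxP; split => // i; rewrite ltNge; exact: h.
    by move=> /ltW/le_trans; apply; rewrite lerDl mulr_ge0.
  pose G j := e / 2 + B * \sum_(i < d) (grid k j 0 i - x 0 i) ^+ 2.
  have EG : poly_fun (bern (bern_word k.+1) G (fun=> 0%N)) x <= e / 2 + B * d%:R / k.+1%:R.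
    rewrite bernD bern_cst bernZ bern_sum -mulrA lerD2l ler_wpM2l//.
    apply: (@le_trans _ _ (\sum_(i < d) k.+1%:R^-1)); last first.
      by rewrite sumr_const card_ord -[X in X <= _]mulr_natl.
    apply: ler_sum => i _.
    rewrite (_ : (fun j => _) = (fun j => (2 / k.+1%:R) ^+ 2 *
       ((j i)%:R - (k.+1%:R * ((1 + x 0 i) / 2))) ^+ 2)); last first.
      apply/funext => j; rewrite mxE -exprMn; congr (_ ^+ 2).
      by field.
    rewrite bernZ bern_variance count_bern_word add0r subrr expr0n/= addr0.
    have -> : (2 / k.+1%:R) ^+ 2 * (k.+1%:R * ((1 + x 0 i) / 2 * ((1 - x 0 i) / 2))) =
      k.+1%:R^-1 * (1 - x 0 i ^+ 2) :> R by field.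
    by rewrite ler_piMr ?invr_ge0// lerBlDr lerDl sqr_ge0.
  rewrite distrC ler_norml; apply/andP; split; last first.
    rewrite lerBlDr; apply: le_trans (lerD EG (lexx _)).
    rewrite -[F x in X in _ <= X](bern_cst (bern_word k.+1) (F x) (fun=> 0%N) x) -bernD.
    apply: bern_le => // j; rewrite -lerBlDr.
    by apply: le_trans (pt _); rewrite distrC ler_norm.
  rewrite lerBrDr addrC lerBlDr; apply: le_trans (lerD (lexx _) EG).
  rewrite -bernD -[X in X <= _](bern_cst (bern_word k.+1) (F x) (fun=> 0%N) x).
  apply: bern_le => // j; rewrite -lerBlDl.
  by apply: le_trans (pt _); rewrite ler_norm.
have : B * d%:R / k.+1%:R @[k --> \oo] --> (0 : R).
  rewrite -(mulr0 (B * d%:R)); apply: cvgM; first exact: cvg_cst.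
  exact: cvg_harmonic.
move=> /cvgrPdist_lt /(_ _ e20); apply: filterS => k /=.
rewrite sub0r normrN => /ltW h; apply: le_trans (key k) _.
by rewrite [leRHS]splitr lerD2l; exact: le_trans (ler_norm _) h.
Qed.

End bernstein.

(** * Completeness of the space of square integrable functions *)

Section L2_complete.
Context d (T : measurableType d) (R : realType) (mu : {measure set T -> \bar R}).
Variables (D : set T) (u : nat -> T -> R).
Hypotheses (mD : measurable D) (muD : (mu D < +oo)%E).
Hypothesis mu_ : forall n, measurable_fun D (u n).
Hypothesis cauchy_u : forall e : R, 0 < e -> exists N, forall m n, (N <= m)%N -> (N <= n)%N ->
  (\int[mu]_(x in D) ((u m x - u n x) ^+ 2)%:E <= e%:E)%E.

(** Along a subsequence whose increments have norm at most [2 ^ - k], the series of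
    increments converges absolutely in [L^1], hence almost everywhere, and Fatou's
    lemma passes the Cauchy estimates to the limit. *)
Lemma L2_complete : exists g : T -> R, measurable_fun D g /\
  forall e : R, 0 < e -> exists N, forall n, (N <= n)%N ->
  (\int[mu]_(x in D) ((g x - u n x) ^+ 2)%:E <= e%:E)%E.
Proof.
have [M M0 MD] : exists2 M : R, 0 <= M & mu D = M%:E.
  by exists (fine (mu D)); rewrite ?fine_ge0// fineK// ge0_fin_numE.
have /choice[phi phiP] (k : nat) : exists N, forall m n, (N <= m)%N -> (N <= n)%N ->
    (\int[mu]_(x in D) ((u m x - u n x) ^+ 2)%:E <= ((4^-1 : R) ^+ k)%:E)%E.
  by apply: cauchy_u; rewrite exprn_gt0// invr_gt0.
(* [k] is added for [nu] to tend to infinity with [k]. *)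
pose nu k := (k + \sum_(j < k.+1) phi j)%N.
have nu_ge k m : (m <= k)%N -> (phi m <= nu k)%N.
  by move=> mk; rewrite /nu (bigD1 (Ordinal (mk : m < k.+1)%N))//= addnCA leq_addr.
pose v k := u (nu k).
have mv k : measurable_fun D (v k) by exact: mu_.
pose del k x := `|v k.+1 x - v k x|.
have mdel k : measurable_fun D (del k).
  by apply: measurableT_comp => //; exact: measurable_funB.
have idel k : (\int[mu]_(x in D) (del k x)%:E <= (((2^-1 : R) ^+ k) * (1 + M) / 2)%:E)%E.
  have h2 : 0 < (2 : R) ^+ k by rewrite exprn_gt0.
  apply: (@le_trans _ _ (\int[mu]_(x in D) ((2 ^+ k / 2)%:E * ((v k.+1 x - v k x) ^+ 2)%:E
      + ((2^-1 : R) ^+ k / 2)%:E)))%E.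
    apply: ge0_le_integral => //.
    - by move=> x _; rewrite lee_fin normr_ge0.
    - exact/measurable_EFinP.
    - apply: emeasurable_funD => //; apply: measurable_funeM; apply/measurable_EFinP.
      by apply: measurable_funX; exact: measurable_funB.
    move=> x _; rewrite -EFinM -EFinD lee_fin /del.
    set a := v k.+1 x - v k x.
    have h := sqr_ge0 (2 ^+ k * `|a| - 1).
    rewrite exprVn -(ler_pM2l h2).
    have -> : 2 ^+ k * (2 ^+ k / 2 * a ^+ 2 + (2 ^+ k)^-1 / 2) =
      ((2 ^+ k * `|a|) ^+ 2 + 1) / 2.
      rewrite exprMn (@real_normK _ a) ?num_real//; field.
      by rewrite gt_eqF.
    nra.
  have msq : measurable_fun D (fun x => ((v k.+1 x - v k x) ^+ 2)%:E).
    by apply/measurable_EFinP; apply: measurable_funX; exact: measurable_funB.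
  have sq0 x : D x -> (0 <= ((v k.+1 x - v k x) ^+ 2)%:E)%E by rewrite lee_fin sqr_ge0.
  have c0 : (0 <= (2 ^+ k / 2 : R)%:E)%E by rewrite lee_fin divr_ge0// ltW.
  rewrite ge0_integralD//; [|by move=> x Dx; rewrite mule_ge0// sq0|exact: measurable_funeM].
  rewrite ge0_integralZl//.
  rewrite integral_cst//= MD.
  have hk : (\int[mu]_(x in D) ((v k.+1 x - v k x) ^+ 2)%:E <= ((4^-1 : R) ^+ k)%:E)%E.
    by apply: phiP; exact: nu_ge.
  apply: (@le_trans _ _ ((2 ^+ k / 2)%:E * ((4^-1 : R) ^+ k)%:E + ((2^-1 : R) ^+ k / 2)%:E * M%:E))%E.
    by apply: leeD => //; exact: lee_wpmul2l.
  rewrite -!EFinM -EFinD lee_fin.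
  have -> : (4^-1 : R) = 2^-1 * 2^-1 by field.
  rewrite exprMn !exprVn le_eqVlt; apply/orP; left; apply/eqP; field.
  by rewrite gt_eqF.
pose h x := (\sum_(0 <= k <oo) (del k x)%:E)%E.
have mh : measurable_fun D h.
  apply: ge0_emeasurable_sum => // [k x Dx _|k _]; first by rewrite lee_fin normr_ge0.
  exact/measurable_EFinP.
have ih : mu.-integrable D h.
  apply/integrableP; split=> //.
  under eq_integral => x _.
    rewrite gee0_abs; last by apply: nneseries_ge0 => k _ _; rewrite lee_fin normr_ge0.
    over.
  rewrite integral_nneseries//; last 2 first.
  - by move=> k; exact/measurable_EFinP.
  - by move=> k x _; rewrite lee_fin normr_ge0.
  apply: (@le_lt_trans _ _ (1 + M)%:E); last exact: ltry.
  apply: lime_le.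
    by apply: is_cvg_nneseries => k _ _; apply: integral_ge0 => x _; rewrite lee_fin normr_ge0.
  apply: nearW => n.
  apply: (@le_trans _ _ (\sum_(0 <= k < n) (((2^-1 : R) ^+ k) * (1 + M) / 2)%:E)%E).
    by apply: lee_sum => k _; exact: idel.
  rewrite sumEFin lee_fin -mulr_suml -mulr_suml.
  have -> : \sum_(0 <= k < n) (2^-1 : R) ^+ k = 2 - 2 * 2^-1 ^+ n.
    elim: n => [|n IH]; first by rewrite big_geq// expr0; ring.
    by rewrite big_nat_recr//= IH exprS; field.
  have : 0 <= (2^-1 : R) ^+ n by rewrite exprn_ge0// invr_ge0.
  nra.
have cvg_v x : h x \is a fin_num -> cvgn (v^~ x).
  move=> hx; rewrite (_ : v^~ x = fun n => v 0%N x + series (telescope (v^~ x)) n); last first.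
    by apply/funext => n; rewrite -eq_sum_telescope.
  apply: is_cvgD; first exact: is_cvg_cst.
  have E n : [normed series (telescope (v^~ x))] n = \sum_(0 <= k < n) del k x by rewrite /series.
  apply: (@normed_cvg R R^o); apply: nondecreasing_is_cvgn.
    apply/nondecreasing_seqP => n; rewrite !E big_nat_recr//= lerDl; exact: normr_ge0.
  exists (fine (h x)) => _ [n _ <-]; rewrite -lee_fin fineK//.
  rewrite E -sumEFin; apply: nneseries_lim_ge.
  by move=> k _ _; rewrite lee_fin normr_ge0.
pose g x := fine (limn_esup (fun k => (v k x)%:E)).
have mg : measurable_fun D g.
  apply: measurableT_comp => //; apply: measurable_fun_limn_esup => k.
  exact/measurable_EFinP.
have vg x : h x \is a fin_num -> v k x @[k --> \oo] --> g x.
  move=> /cvg_v cv; rewrite /g is_cvg_limn_esupE; last first.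
    by apply/cvg_ex; eexists; apply: cvg_EFin cv; exact: nearW.
  by rewrite (EFin_lim (f := v^~ x)).
exists g; split=> // e e0; have [N NP] := cauchy_u e0; exists N => n Nn.
have hfin := integrable_ae mD ih.
have mvn k : measurable_fun D (fun x => ((v k x - u n x) ^+ 2)%:E).
  by apply/measurable_EFinP; apply: measurable_funX; exact: measurable_funB.
apply: (@le_trans _ _ (\int[mu]_(x in D) limn_einf (fun k => ((v k x - u n x) ^+ 2)%:E))%E).
  apply: ae_ge0_le_integral => //.
  - by move=> x _; rewrite lee_fin sqr_ge0.
  - by apply/measurable_EFinP; apply: measurable_funX; exact: measurable_funB.
  - move=> x _; rewrite limn_einf_lim; apply: lime_ge; first exact: is_cvg_einfs.
    by apply: nearW => k; apply: le_ereal_inf_tmp => _ [m _ <-]; rewrite lee_fin sqr_ge0.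
  - rewrite (_ : (fun x => _) = fun x => (- limn_esup (fun k => - ((v k x - u n x) ^+ 2)%:E))%E).
      apply: measurableT_comp => //; apply: measurable_fun_limn_esup => k.
      exact: measurableT_comp.
    by apply/funext.
  apply: filterS hfin => x hx Dx; have {}hx := hx Dx.
  rewrite is_cvg_limn_einfE; last first.
    apply/cvg_ex; eexists; apply: cvg_EFin; first exact: nearW.
    rewrite /comp/=; apply: cvgM; apply: cvgB; [exact: vg|exact: cvg_cst|exact: vg|exact: cvg_cst].
  rewrite le_eqVlt; apply/orP; left; apply/eqP/esym/cvg_lim => //.
  apply: cvg_EFin; first exact: nearW.
  rewrite /comp/=; apply: cvgM; apply: cvgB; [exact: vg|exact: cvg_cst|exact: vg|exact: cvg_cst].
apply: le_trans (fatou _ _ _ _) _ => //; first by move=> k x _; rewrite lee_fin sqr_ge0.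
rewrite limn_einf_lim; apply: lime_le; first exact: is_cvg_einfs.
apply: nearW => k.
apply: (@le_trans _ _ (\int[mu]_(x in D) ((v (maxn k N) x - u n x) ^+ 2)%:E)%E).
  by apply: ereal_inf_lbound; exists (maxn k N) => //=; exact: leq_maxl.
apply: NP => //; apply: (@leq_trans (maxn k N)); first exact: leq_maxr.
by rewrite /nu leq_addr.
Qed.

End L2_complete.

(** * Integrals against a finite weight *)

Section dominated_Rintegral.
Context d (T : measurableType d) (R : realType) (mu : {measure set T -> \bar R}).
Variables (D : set T) (mD : measurable D).

Lemma dominated_Rintegral (F : nat -> T -> R) (f g : T -> R) :
  (forall k, measurable_fun D (F k)) -> mu.-integrable D (EFin \o g) ->
  (forall x, D x -> F k x @[k --> \oo] --> f x) ->
  (forall k x, D x -> `|F k x| <= g x) ->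
  mu.-integrable D (EFin \o f) /\
  \int[mu]_(x in D) F k x @[k --> \oo] --> \int[mu]_(x in D) f x.
Proof.
move=> mF ig cF Fg.
have mf : measurable_fun D f by exact: measurable_fun_cvg cF.
have [] := @dominated_convergence _ _ _ mu D mD (fun k => EFin \o F k) (EFin \o f) (EFin \o g).
- by move=> k; exact/measurable_EFinP.
- exact/measurable_EFinP.
- by apply: aeW => x Dx; apply: cvg_EFin; [exact: nearW|exact: cF].
- exact: ig.
- by apply: aeW => x k Dx; rewrite lee_fin Fg.
move=> fi _ cv; split=> //; apply: fine_cvg; rewrite /Rintegral fineK//.
exact: integrable_fin_num.
Qed.

End dominated_Rintegral.

Section weighted_integral.
Context d (T : measurableType d) (R : realType) (mu : {measure set T -> \bar R}).
Variables (D : set T) (W : T -> R).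
Implicit Types (f g : T -> R) (c : R).

(** The weight is a factor of the integrand rather than a density of the measure,
    so that the invariance properties of [mu] apply directly. *)
Definition wint f : R := \int[mu]_(x in D) (f x * W x).

Definition wintegrable f := mu.-integrable D (EFin \o (fun x => f x * W x)).

Definition wL2 f := measurable_fun D f /\ wintegrable (fun x => f x ^+ 2).

Record finite_weight : Prop := FiniteWeight {
  fw_measurable : measurable D;
  fw_measurable_fun : measurable_fun D W;
  fw_ge0 : forall x, D x -> 0 <= W x;
  fw_integrable : mu.-integrable D (EFin \o W) }.

Hypothesis H : finite_weight.
Let mD := fw_measurable H.
Let mW := fw_measurable_fun H.
Let W0 := fw_ge0 H.
Let iW := fw_integrable H.

Lemma eq_wint f g : (forall x, D x -> f x = g x) -> wint f = wint g.
Proof. by move=> fg; apply: eq_Rintegral => x /set_mem Dx; rewrite fg. Qed.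

Lemma eq_wintegrable f g : (forall x, D x -> f x = g x) -> wintegrable f -> wintegrable g.
Proof. by move=> fg; apply: eq_integrable => // x /set_mem Dx /=; rewrite fg. Qed.

Lemma wintegrable_le f g : measurable_fun D f -> wintegrable g ->
  (forall x, D x -> `|f x| <= g x) -> wintegrable f.
Proof.
move=> mf ig fg; apply: le_integrable ig => //.
  by apply/measurable_EFinP; exact: measurable_funM.
move=> x Dx /=; rewrite lee_fin !normrM ler_wpM2r//.
exact: le_trans (fg _ Dx) (ler_norm _).
Qed.

Lemma wintegrable_bounded M f : measurable_fun D f ->
  (forall x, D x -> `|f x| <= M) -> wintegrable f.
Proof.
move=> mf fM; apply: (@wintegrable_le _ (cst M)) => //.
have := @integrableZl _ _ _ mu D mD M _ iW.
by apply: eq_integrable => // x _ /=; rewrite EFinM.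
Qed.

Lemma wintegrableZ c f : wintegrable f -> wintegrable (fun x => c * f x).
Proof.
move=> fi; have := @integrableZl _ _ _ mu D mD c _ fi.
by apply: eq_integrable => // x _ /=; rewrite -mulrA EFinM.
Qed.

Lemma wintegrableD f g : wintegrable f -> wintegrable g -> wintegrable (fun x => f x + g x).
Proof.
move=> fi gi; have := @integrableD _ _ _ mu D mD _ _ fi gi.
by apply: eq_integrable => // x _ /=; rewrite mulrDl EFinD.
Qed.

Lemma wintegrableN f : wintegrable f -> wintegrable (fun x => - f x).
Proof. by move/(wintegrableZ (-1)); apply: eq_wintegrable => x _; rewrite mulN1r. Qed.

Lemma wintegrableB f g : wintegrable f -> wintegrable g -> wintegrable (fun x => f x - g x).
Proof. by move=> fi gi; apply: wintegrableD => //; exact: wintegrableN. Qed.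

Lemma wintegrable_sum (I : eqType) (r : seq I) (F : I -> T -> R) :
  (forall i, i \in r -> wintegrable (F i)) -> wintegrable (fun x => \sum_(i <- r) F i x).
Proof.
elim: r => [_|i r IH Fi].
  apply: (@wintegrable_bounded 0) => [|x _]; rewrite ?big_nil ?normr0//.
  by under eq_fun do rewrite big_nil; exact: measurable_cst.
under eq_fun do rewrite big_cons; apply: wintegrableD; first by apply: Fi; rewrite mem_head.
by apply: IH => j jr; apply: Fi; rewrite inE jr orbT.
Qed.

Lemma wintD f g : wintegrable f -> wintegrable g ->
  wint (fun x => f x + g x) = wint f + wint g.
Proof.
by move=> fi gi; rewrite /wint; under eq_fun do rewrite mulrDl; exact: RintegralD.
Qed.

Lemma wintZ c f : wintegrable f -> wint (fun x => c * f x) = c * wint f.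
Proof.
by move=> fi; rewrite /wint; under eq_fun do rewrite -mulrA; exact: RintegralZl.
Qed.

Lemma wintN f : wintegrable f -> wint (fun x => - f x) = - wint f.
Proof.
by move=> fi; rewrite -mulN1r -wintZ//; apply: eq_wint => x _; rewrite mulN1r.
Qed.

Lemma wintB f g : wintegrable f -> wintegrable g ->
  wint (fun x => f x - g x) = wint f - wint g.
Proof. by move=> fi gi; rewrite wintD ?wintN//; exact: wintegrableN. Qed.

Lemma wint0 : wint (fun=> 0) = 0.
Proof.
rewrite /wint /Rintegral; under eq_integral do rewrite mul0r.
by rewrite integral0.
Qed.

Lemma wint_sum (I : eqType) (r : seq I) (F : I -> T -> R) :
  (forall i, i \in r -> wintegrable (F i)) ->
  wint (fun x => \sum_(i <- r) F i x) = \sum_(i <- r) wint (F i).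
Proof.
elim: r => [_|i r IH Fi].
  by rewrite big_nil -[RHS]wint0; apply: eq_wint => x _; exact: big_nil.
have Fr j : j \in r -> wintegrable (F j) by move=> jr; apply: Fi; rewrite inE jr orbT.
rewrite big_cons -(IH Fr) -wintD//; [|by apply: Fi; rewrite mem_head|exact: wintegrable_sum].
by apply: eq_wint => x _; rewrite big_cons.
Qed.

Lemma wint_ge0 f : (forall x, D x -> 0 <= f x) -> 0 <= wint f.
Proof. by move=> f0; apply: Rintegral_ge0 => x Dx; rewrite mulr_ge0 ?f0 ?W0. Qed.

Lemma wint_le f g : wintegrable f -> wintegrable g ->
  (forall x, D x -> f x <= g x) -> wint f <= wint g.
Proof.
by move=> fi gi fg; apply: le_Rintegral => // x Dx; rewrite ler_wpM2r ?fg ?W0.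
Qed.

Lemma wL2_bounded M f : measurable_fun D f -> (forall x, D x -> `|f x| <= M) -> wL2 f.
Proof.
move=> mf fM; split=> //; apply: (@wintegrable_bounded (M ^+ 2)).
  exact: measurable_funX.
by move=> x Dx; rewrite normrX lerXn2r ?nnegrE ?(le_trans _ (fM _ Dx))// fM.
Qed.

Lemma wL2_mul f g : wL2 f -> wL2 g -> wintegrable (fun x => f x * g x).
Proof.
move=> [mf f2] [mg g2]; apply: (@wintegrable_le _ (fun x => f x ^+ 2 + g x ^+ 2)).
- exact: measurable_funM.
- exact: wintegrableD.
move=> x Dx; rewrite ler_norml; have := sqr_ge0 (f x + g x).
have := sqr_ge0 (f x - g x); have := sqr_ge0 (f x); have := sqr_ge0 (g x); nra.
Qed.

Lemma wL2D f g : wL2 f -> wL2 g -> wL2 (fun x => f x + g x).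
Proof.
move=> f2 g2; split; first by apply: measurable_funD; [case: f2|case: g2].
have := wintegrableD (wintegrableD f2.2 g2.2) (wintegrableZ 2 (wL2_mul f2 g2)).
by apply: eq_wintegrable => x _; ring.
Qed.

End weighted_integral.

(** * Reflections and the weight of a root system *)

Section reflections.
Context {R : realType} {d : nat}.
Implicit Types (x v w : 'rV[R]_d).

Lemma dotv_refll v x w : dotv v v = 2 ->
  dotv (x *m refl_mx v) w = dotv x (w *m refl_mx v).
Proof.
move=> v2; rewrite !mulmx_refl// dotvBl dotvBr dotvZl dotvZr (dotvC v w).
by congr (_ - _); rewrite mulrC.
Qed.

Lemma dotv_refl_root v x : dotv v v = 2 -> dotv (x *m refl_mx v) v = - dotv x v.
Proof. by move=> v2; rewrite mulmx_refl// dotvBl dotvZl v2; ring. Qed.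

Lemma mulmx_reflK v x : dotv v v = 2 -> x *m refl_mx v *m refl_mx v = x.
Proof.
move=> v2; rewrite [LHS]mulmx_refl// dotv_refl_root// mulmx_refl//.
by rewrite scaleNr opprK subrK.
Qed.

Lemma refl_mxK v : dotv v v = 2 -> refl_mx v *m refl_mx v = 1%:M.
Proof.
by move=> v2; apply/row_matrixP => i; rewrite !rowE mulmxA mulmx_reflK// mulmx1.
Qed.

Lemma dotv_refl v x y : dotv v v = 2 ->
  dotv (x *m refl_mx v) (y *m refl_mx v) = dotv x y.
Proof. by move=> v2; rewrite dotv_refll// mulmx_reflK. Qed.

Lemma open_ball_refl v x : dotv v v = 2 -> open_ball d x -> open_ball d (x *m refl_mx v).
Proof. by move=> v2; rewrite /open_ball/= !enorm_lt1 dotv_refl. Qed.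

Lemma integral_refl v (G : 'rV[R]_d -> \bar R) : dotv v v = 2 ->
  measurable_fun (open_ball d) G ->
  (\int[lebesgue_rV d]_(x in open_ball d) G (x *m refl_mx v) =
   \int[lebesgue_rV d]_(x in open_ball d) G x)%E.
Proof.
move=> v2.
have mo : measurable (open_ball d : set 'rV[R]_d) by exact: measurable_open_ball.
pose s x := x *m refl_mx v.
have ms : measurable_fun setT s by exact: measurable_mulmxr.
have sB : s @^-1` open_ball d = open_ball d.
  apply/seteqP; split => x /=; last exact: open_ball_refl.
  by move=> h; rewrite -(mulmx_reflK x v2); exact: open_ball_refl.
have ge0 (F : 'rV[R]_d -> \bar R) : measurable_fun (open_ball d) F ->
    (forall x, 0 <= F x)%E ->
    (\int[lebesgue_rV d]_(x in open_ball d) F (s x) =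
     \int[lebesgue_rV d]_(x in open_ball d) F x)%E.
  move=> mF F0.
  transitivity (\int[pushforward (lebesgue_rV d) s]_(x in open_ball d) F x)%E.
    rewrite (@ge0_integral_pushforward _ _ _ _ _ s)//; first by rewrite sB.
  apply: eq_measure_integral => A mA _; apply: lebesgue_orth => //.
    exact: refl_mxK.
  by move=> x; exact: dotv_refl.
move=> mG; rewrite integralE [RHS]integralE; congr (_ - _)%E.
  rewrite -(ge0 _ (measurable_funepos mG)) => [|x]; last exact: funepos_ge0.
  by apply: eq_integral => x _; rewrite !funeposE.
rewrite -(ge0 _ (measurable_funeneg mG)) => [|x]; last exact: funeneg_ge0.
by apply: eq_integral => x _; rewrite !funenegE.
Qed.

End reflections.

(** The form in which a positive subsystem is used: the reflection in a positive
    root permutes the positive roots up to signs, and [tau] is this permutation. *)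
Record root_weight (R : realType) (d : nat) (Rp : {fset 'rV[R]_d})
    (kappa : 'rV[R]_d -> R) (mu : R) : Prop := RootWeight {
  rw_norm : forall v, v \in Rp -> dotv v v = 2;
  rw_kappa : forall v, v \in Rp -> 0 <= kappa v;
  rw_mu : 0 <= mu;
  rw_perm : forall v, v \in Rp -> exists tau : 'rV[R]_d -> 'rV[R]_d,
    perm_eq (map tau Rp) Rp /\
    forall w, w \in Rp -> kappa (tau w) = kappa w /\
      forall x, dotv x (tau w) ^+ 2 = dotv (x *m refl_mx v) w ^+ 2 }.

Section weight.
Context {R : realType} {n : nat}.
Notation d := n.+1.
Context {Rp : {fset 'rV[R]_d}} {kappa : 'rV[R]_d -> R} {mu : R}.
Hypothesis H : root_weight Rp kappa mu.
Notation W := (ball_weight Rp kappa mu).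
Notation lam := (lebesgue_rV d).
Notation Bo := (open_ball d : set 'rV[R]_d).
Implicit Types (x v w : 'rV[R]_d).

Lemma ball_weightE x : W x = (\prod_(v <- Rp) (dotv x v ^+ 2) `^ kappa v)
  * (1 - dotv x x) `^ (mu - 1 / 2).
Proof.
rewrite /ball_weight sqr_enorm; congr (_ * _); apply: eq_bigr => v _.
by rewrite powRrM powR_mulrn// real_normK ?num_real.
Qed.

Lemma sum_root_refl v x (phi : R -> R) : v \in Rp ->
  \sum_(w <- Rp) kappa w * phi (dotv (x *m refl_mx v) w ^+ 2) =
  \sum_(w <- Rp) kappa w * phi (dotv x w ^+ 2).
Proof.
move=> vR; have [tau [tp tauE]] := rw_perm H vR.
rewrite -[RHS](perm_big _ tp)/= big_map; apply: eq_big_seq => w wR.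
by have [-> ->] := tauE w wR.
Qed.

Lemma ball_weight_refl v x : v \in Rp -> W (x *m refl_mx v) = W x.
Proof.
move=> vR; have [tau [tp tauE]] := rw_perm H vR.
rewrite !ball_weightE (dotv_refl _ _ (rw_norm H vR)); congr (_ * _).
rewrite -[RHS](perm_big _ tp)/= big_map; apply: eq_big_seq => w wR.
by have [-> ->] := tauE w wR.
Qed.

Lemma measurable_dotv w : measurable_fun setT (fun x : 'rV[R]_d => dotv x w).
Proof.
by apply: measurable_sum => i; apply: measurable_funM => //; exact: measurable_coord.
Qed.

Lemma measurable_ball_weight D : measurable_fun D W.
Proof.
apply: (@measurable_funS _ _ _ _ setT) => //.
rewrite (_ : W = (fun x => \prod_(v <- Rp) (dotv x v ^+ 2) `^ kappa v) \*
    (fun x => (1 - dotv x x) `^ (mu - 1 / 2))); last first.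
  by apply/funext => x; exact: ball_weightE.
apply: measurable_funM.
  apply: measurable_prod => v _; apply: (measurableT_comp (measurable_powR _)).
  by apply: measurable_funX; exact: measurable_dotv.
apply: (measurableT_comp (measurable_powR _)); apply: measurable_funB => //.
exact: measurable_sqnorm.
Qed.

Lemma ball_weight_ge0 x : 0 <= W x.
Proof. by rewrite mulr_ge0 ?powR_ge0// prodr_ge0// => v _; exact: powR_ge0. Qed.

Lemma dotv_root_le v x : v \in Rp -> Bo x -> dotv x v ^+ 2 <= 2.
Proof.
move=> vR; rewrite /open_ball/= enorm_lt1 => x1.
apply: le_trans (dotv_CS x v) _; rewrite (rw_norm H vR).
by rewrite -[leRHS]mul1r ler_wpM2r// ltW.
Qed.

(** As [mu >= 0], the exponent [- 1 / 2] is the worst case. *)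
Lemma radial_weight_le x : Bo x ->
  (1 - dotv x x) `^ (mu - 1 / 2) <= (Num.sqrt (1 - dotv x x))^-1.
Proof.
rewrite /open_ball/= enorm_lt1 => x1; have x0 := dotv_ge0 x.
rewrite -powR12_sqrt -?powRN; last by rewrite subr_ge0 ltW.
have h : 0 < 1 - dotv x x <= 1 by rewrite subr_gt0 x1 gerBl.
by apply: (ger_powR h); have := rw_mu H; lra.
Qed.

Lemma ball_weight_bound : exists2 C : R, 0 <= C &
  forall x, \prod_(v <- Rp) (dotv x v ^+ 2) `^ kappa v <= C \/ ~ Bo x.
Proof.
exists (\prod_(v <- Rp) 2 `^ kappa v).
  by apply: prodr_ge0 => v _; exact: powR_ge0.
move=> x; have [Bx|] := pselect (Bo x); [left|by right].
rewrite big_seq [leRHS]big_seq; apply: ler_prod => v vR.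
rewrite powR_ge0/=; apply: ge0_ler_powR; rewrite ?nnegrE ?sqr_ge0 ?(rw_kappa H)//.
exact: dotv_root_le.
Qed.

Lemma integrable_radial_weight :
  lam.-integrable Bo (EFin \o (fun x => (1 - dotv x x) `^ (mu - 1 / 2))).
Proof.
have mo : measurable Bo by exact: measurable_open_ball.
have ms : measurable_fun Bo (fun x : 'rV[R]_d => (Num.sqrt (1 - dotv x x))^-1).
  apply: measurable_fun_inv; apply: measurable_fun_sqrt; apply: measurable_funB => //.
  by apply: measurable_funTS; exact: measurable_sqnorm.
apply: (@le_integrable _ _ _ _ _ mo _ (EFin \o (fun x => (Num.sqrt (1 - dotv x x))^-1))).
- apply/measurable_EFinP; apply: measurable_funTS.
  apply: (measurableT_comp (measurable_powR _)); apply: measurable_funB => //.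
  exact: measurable_sqnorm.
- move=> x Bx /=; rewrite lee_fin !ger0_norm ?powR_ge0 ?invr_ge0 ?sqrtr_ge0//.
  exact: radial_weight_le.
- apply/integrableP; split; first exact/measurable_EFinP.
  under eq_integral do rewrite /= ger0_norm ?invr_ge0 ?sqrtr_ge0//.
  exact: integrable_inv_sqrt.
Qed.

Lemma finite_ball_weight : finite_weight lam Bo W.
Proof.
have mo : measurable Bo by exact: measurable_open_ball.
split=> //; first exact: measurable_ball_weight.
  by move=> x _; exact: ball_weight_ge0.
have [C C0 CP] := ball_weight_bound.
have := @integrableZl _ _ _ lam Bo mo C _ integrable_radial_weight.
apply: le_integrable => //; first by apply/measurable_EFinP; exact: measurable_ball_weight.
move=> x Bx /=; rewrite lee_fin ball_weightE !ger0_norm ?mulr_ge0 ?powR_ge0//.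
  by case: (CP x) => // h; rewrite ler_wpM2r// powR_ge0.
by apply: prodr_ge0 => v _; exact: powR_ge0.
Qed.

Lemma wint_refl v (F : 'rV[R]_d -> R) : v \in Rp -> measurable_fun Bo F ->
  wint lam Bo W (fun x => F (x *m refl_mx v)) = wint lam Bo W F.
Proof.
move=> vR mF; rewrite /wint /Rintegral.
under eq_integral => x _ do rewrite -(ball_weight_refl x vR).
rewrite (@integral_refl _ _ _ (fun x => (F x * W x)%:E)) ?(rw_norm H vR)//.
by apply/measurable_EFinP; apply: measurable_funM => //; exact: measurable_ball_weight.
Qed.

Lemma measurable_refl v (F : 'rV[R]_d -> R) : v \in Rp -> measurable_fun Bo F ->
  measurable_fun Bo (fun x => F (x *m refl_mx v)).
Proof.
move=> vR mF; apply: (@measurable_comp _ _ _ _ _ _ Bo) => //.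
- exact: measurable_open_ball.
- by move=> _ [x Bx <-]; apply: open_ball_refl => //; exact: (rw_norm H).
- by apply: measurable_funTS; exact: measurable_mulmxr.
Qed.

(** The sphere is negligible. *)
Lemma integral_unit_ball (G : 'rV[R]_d -> \bar R) : measurable_fun (unit_ball d) G ->
  (\int[lam]_(x in unit_ball d) G x = \int[lam]_(x in Bo) G x)%E.
Proof.
move=> mG; have mo : measurable Bo by exact: measurable_open_ball.
pose S := [set x : 'rV[R]_d | enorm x = 1].
have US : unit_ball d = Bo `|` S.
  apply/seteqP; split => x; rewrite /unit_ball /open_ball /S/=.
    by rewrite le_eqVlt => /predU1P[]; [right|left].
  by move=> [/ltW //|->].
have mS : measurable S.
  rewrite (_ : S = unit_ball d `\` Bo).
    by apply: measurableD => //; exact: measurable_unit_ball.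
  rewrite US; apply/seteqP; split => x; rewrite /open_ball /S/=.
    by move=> x1; split; [right|rewrite x1 ltxx].
  by move=> [[]].
rewrite US integral_setU//; last 2 first.
- by rewrite -US.
- apply/disj_setPS => x; rewrite /open_ball /S/= => -[+ x1].
  by rewrite x1 ltxx.
rewrite [X in (_ + X)%E](null_set_integral mS) ?adde0//; last exact: lebesgue_sphere.
apply: measurable_funS mG; first exact: measurable_unit_ball.
by rewrite US; right.
Qed.

Lemma ball_intE (F : 'rV[R]_d -> R) : measurable_fun (unit_ball d) F ->
  ball_int Rp kappa mu F = wint lam Bo W F.
Proof.
move=> mF; rewrite /ball_int /wint /Rintegral integral_unit_ball//.
by apply/measurable_EFinP; apply: measurable_funM => //; exact: measurable_ball_weight.
Qed.

Lemma measurable_unit_open (F : 'rV[R]_d -> R) :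
  measurable_fun (unit_ball d) F -> measurable_fun Bo F.
Proof.
by apply: measurable_funS; [exact: measurable_unit_ball|exact: open_ball_unit_ball].
Qed.

Lemma ball_L2P (F : 'rV[R]_d -> R) : ball_L2 Rp kappa mu F <->
  measurable_fun (unit_ball d) F /\ wL2 lam Bo W F.
Proof.
have E : (\int[lam]_(x in Bo) `|(F x ^+ 2 * W x)%:E| =
    \int[lam]_(x in Bo) (F x ^+ 2 * W x)%:E)%E.
  apply: eq_integral => x _ /=; rewrite ger0_norm// mulr_ge0 ?sqr_ge0//.
  exact: ball_weight_ge0.
split=> [[mF Foo]|[mF [_ /integrableP[_ Foo]]]]; split=> //.
  have mF2 : measurable_fun (unit_ball d) (fun x => (F x ^+ 2 * W x)%:E).
    apply/measurable_EFinP; apply: measurable_funM; last exact: measurable_ball_weight.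
    exact: measurable_funX.
  split; first exact: measurable_unit_open.
  apply/integrableP; split.
    by apply: measurable_funS mF2; [exact: measurable_unit_ball|exact: open_ball_unit_ball].
  by rewrite [ltLHS]E -integral_unit_ball.
rewrite integral_unit_ball.
  by rewrite -E.
apply/measurable_EFinP; apply: measurable_funM; last exact: measurable_ball_weight.
exact: measurable_funX.
Qed.

End weight.

(** * Functions of class C^1 in the ball *)

Section C1_ball.
Context {R : realType} {d : nat}.
Notation Bo := (open_ball d : set 'rV[R]_d).
Implicit Types (f h : 'rV[R]_d -> R) (x y z : 'rV[R]_d).

Lemma enorm_ge0 x : 0 <= enorm x.
Proof. exact: sqrtr_ge0. Qed.

Lemma ler_enormD x y : enorm (x + y) <= enorm x + enorm y.
Proof.
rewrite -ler_sqr ?nnegrE ?addr_ge0 ?enorm_ge0// sqr_enorm sqrrD !sqr_enorm.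
rewrite dotvDl !dotvDr (dotvC y x).
have : dotv x y <= enorm x * enorm y.
  apply: le_trans (ler_norm _) _.
  rewrite -ler_sqr ?nnegrE ?mulr_ge0 ?enorm_ge0// real_normK ?num_real//.
  by rewrite exprMn !sqr_enorm dotv_CS.
lra.
Qed.

Lemma enormZ c x : 0 <= c -> enorm (c *: x) = c * enorm x.
Proof.
by move=> c0; rewrite /enorm dotvZl dotvZr mulrA -expr2 sqrtrM ?sqr_ge0// sqrtr_sqr ger0_norm.
Qed.

Lemma enorm_box x r : 0 <= r -> (forall i, `|x 0 i| <= r) -> enorm x <= d%:R * r.
Proof.
move=> r0 xr; rewrite -ler_sqr ?nnegrE ?mulr_ge0 ?enorm_ge0// sqr_enorm.
apply: (@le_trans _ _ (d%:R * r ^+ 2)).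
  rewrite /dotv -[d in d%:R]card_ord mulr_natl -sumr_const; apply: ler_sum => i _.
  by rewrite -expr2 -(real_normK (num_real (x 0 i))) ler_pXn2r ?nnegrE.
rewrite exprMn ler_wpM2r ?sqr_ge0// expr2.
case: {x xr} d => [|m]; first by rewrite mulr0.
by rewrite ler_peMl ?ler0n// ler1n.
Qed.

(** The functions to be integrated by parts: continuity of the gradient [g] is
    replaced by the boundedness and the measurability that integration requires. *)
Record C1_ball f (g : 'I_d -> 'rV[R]_d -> R) : Prop := MkC1Ball {
  c1_bounded : exists M, forall x, Bo x -> `|f x| <= M /\ forall i, `|g i x| <= M;
  c1_derive : forall x i, Bo x ->
    is_derive x (delta_mx 0 i) (f : 'rV[R]_d -> R^o) (g i x);
  c1_measurable : measurable_fun Bo f;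
  c1_dmeasurable : forall i, measurable_fun Bo (g i) }.

Lemma compact_unit_ball : compact (unit_ball d : set 'rV[R]_d).
Proof.
apply: bounded_closed_compact.
  exists 1; split; first exact: num_real.
  move=> M M1 x; rewrite /unit_ball/= enorm_le1 => x1.
  change (mx_norm x <= M); rewrite mx_normrE; apply/bigmax_leP; split=> [|[i j] _ /=]; first by lra.
  rewrite (ord1 i) ler_norml; have := coord_le_dotv x j; nra.
rewrite -[unit_ball d]setCK; apply: open_closedC.
rewrite (_ : ~` _ = (fun x => dotv x x) @^-1` [set r | 1 < r]).
  apply: open_comp; last exact: open_gt.
  by move=> x _; exact: continuous_sqnorm.
by apply/seteqP; split => x /=; rewrite /unit_ball/= enorm_le1 ltNge => /negP.
Qed.

Lemma bounded_unit_ball f : {within unit_ball d, continuous f} ->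
  exists M, forall x, unit_ball d x -> `|f x| <= M.
Proof.
move=> cf; have := continuous_compact cf compact_unit_ball.
move=> /(@compact_bounded R R^o) [M [_ h]]; exists (M + 1) => x x1.
by apply: (h (M + 1)); [rewrite ltrDl|exists x].
Qed.

Lemma C1_unit_ball_C1_ball f : C1_unit_ball f -> exists g, C1_ball f g.
Proof.
move=> [cf [g gP]]; exists g.
have mU := @measurable_unit_ball R d; have BU := @open_ball_unit_ball R d.
split.
- have [M fM] := bounded_unit_ball cf.
  have /choice[N gN] i := bounded_unit_ball (gP i).1.
  have N0 i : 0 <= `|N i| by [].
  exists (`|M| + \sum_i `|N i|) => x /BU x1; split.
    apply: le_trans (fM _ x1) _; apply: le_trans (ler_norm _) _.
    by rewrite lerDl sumr_ge0.
  move=> i; apply: le_trans (gN i _ x1) _; apply: le_trans (ler_norm _) _.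
  by rewrite (bigD1 i)//= addrCA lerDl addr_ge0// sumr_ge0.
- by move=> x i x1; apply: (gP i).2.
- by apply: (measurable_funS mU BU); exact: continuous_measurable_rV.
- move=> i; apply: (measurable_funS mU BU); apply: continuous_measurable_rV => //.
  exact: (gP i).1.
Qed.

Lemma continuous_measurable_ball f : continuous f -> measurable_fun Bo f.
Proof.
move=> cf; apply: measurable_funTS; apply: continuous_measurable_rV => //.
exact: continuous_subspaceT.
Qed.

Lemma C1_ball_poly p :
  C1_ball (poly_fun p) (fun i => poly_fun (mpoly.mderiv i p)).
Proof.
have BU := @open_ball_unit_ball R d.
have bp q : exists M, forall x, Bo x -> `|poly_fun q x| <= M.
  have [|M h] := @bounded_unit_ball (poly_fun q); last by exists M => x /BU; exact: h.
  by apply: continuous_subspaceT; exact: continuous_poly_fun.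
split.
- have [M pM] := bp p; have /choice[N gN] i := bp (mpoly.mderiv i p).
  exists (`|M| + \sum_i `|N i|) => x x1; split.
    apply: le_trans (pM _ x1) _; apply: le_trans (ler_norm _) _.
    by rewrite lerDl sumr_ge0.
  move=> i; apply: le_trans (gN i _ x1) _; apply: le_trans (ler_norm _) _.
  by rewrite (bigD1 i)//= addrCA lerDl addr_ge0// sumr_ge0.
- by move=> x i _; exact: is_derive_poly_fun.
- by apply: continuous_measurable_ball; exact: continuous_poly_fun.
- by move=> i; apply: continuous_measurable_ball; exact: continuous_poly_fun.
Qed.

Lemma C1_ballM f g h k : C1_ball f g -> C1_ball h k ->
  C1_ball (fun x => f x * h x) (fun i x => f x * k i x + h x * g i x).
Proof.
move=> [[M fM] df mf mg] [[N hN] dh mh mk]; split.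
- exists (M * N + N * M) => x x1.
  have [f1 g1] := fM x x1; have [h1 k1] := hN x x1.
  have M0 : 0 <= M by exact: le_trans f1.
  have N0 : 0 <= N by exact: le_trans h1.
  split; first by rewrite normrM (le_trans (ler_pM _ _ f1 h1))// lerDl mulr_ge0.
  by move=> i; rewrite (le_trans (ler_normD _ _))// !normrM lerD// ler_pM.
- move=> x i x1; exact: (is_deriveM (df x i x1) (dh x i x1)).
- exact: measurable_funM.
- by move=> i; apply: measurable_funD; exact: measurable_funM.
Qed.

Section lipschitz.
Variables (f : 'rV[R]_d -> R) (g : 'I_d -> 'rV[R]_d -> R) (M : R).
Hypothesis fg : forall x i, Bo x ->
    is_derive x (delta_mx 0 i) (f : 'rV[R]_d -> R^o) (g i x).
Hypothesis gM : forall x i, Bo x -> `|g i x| <= M.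

Let lipschitz_coord x k b :
  (forall t, 0 <= t <= 1 -> Bo ((t * b) *: delta_mx 0 k + x)) ->
  `|f (b *: delta_mx 0 k + x) - f x| <= M * `|b|.
Proof.
have pos z c : 0 <= c -> (forall t, 0 <= t <= c -> Bo (t *: delta_mx 0 k + z)) ->
    `|f (c *: delta_mx 0 k + z) - f z| <= M * c.
  move=> c0 hB; apply: (lipschitz_line (df := fun t => g k (t *: delta_mx 0 k + z))) => //.
    by move=> t tc; apply: fg; exact: hB.
  by move=> t tc; apply: gM; exact: hB.
move=> hB; have [b0|b0] := leP 0 b.
  rewrite (ger0_norm b0); apply: pos => // t /andP[t0 tb]; have [b00|b00] := eqVneq b 0.
    by have := hB 1; rewrite b00 mulr0 (_ : t = 0); [apply; lra|lra].
  have := hB (t / b); rewrite divfK//; apply.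
  by rewrite divr_ge0//= ler_pdivrMr ?mul1r// lt_def b00.
have hx : (- b) *: delta_mx 0 k + (b *: delta_mx 0 k + x) = x.
  by rewrite addrA scaleNr addNr add0r.
rewrite (ltr0_norm b0) distrC -{1}hx; apply: pos; first by lra.
move=> t tb; rewrite addrA -scalerDl.
have := hB ((t + b) / b); rewrite divfK ?lt_eqF//; apply.
by rewrite ler_ndivlMr// mul0r ler_ndivrMr// mul1r; lra.
Qed.

Let lipschitz_box r x y : 0 <= r ->
  (forall z, (forall i, `|z 0 i - x 0 i| <= r) -> Bo z) ->
  (forall i, `|y 0 i - x 0 i| <= r) ->
  `|f y - f x| <= M * \sum_i `|y 0 i - x 0 i|.
Proof.
move=> r0 hB yr.
pose z (k : nat) : 'rV[R]_d := \row_i (if (i < k)%N then y 0 i else x 0 i).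
have zd : z d = y by apply/rowP => i; rewrite mxE ltn_ord.
have z0 : z 0%N = x by apply/rowP => i; rewrite mxE.
suff h k : (k <= d)%N -> `|f (z k) - f x| <= M * \sum_(i < d | (i < k)%N) `|y 0 i - x 0 i|.
  have := h d (leqnn _); rewrite zd; congr (_ <= _ * _).
  by apply: eq_bigl => i; rewrite ltn_ord.
elim: k => [_|k IH kd]; first by rewrite z0 subrr normr0 big_pred0_eq mulr0.
pose K := Ordinal kd.
have zS : z k.+1 = (y 0 K - x 0 K) *: delta_mx 0 K + z k.
  apply/rowP => i; rewrite !mxE ltnS leq_eqVlt.
  have [->|iK] := eqVneq i K; first by rewrite /= eqxx ltnn/= mulr1 subrK.
  rewrite andbF mulr0 add0r (_ : (i == k :> nat) = false)//.
  by apply: contra_neqF iK => /eqP ik; exact: val_inj.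
rewrite (bigD1 K)//= mulrDr.
rewrite (_ : f (z k.+1) - f x = (f (z k.+1) - f (z k)) + (f (z k) - f x)); last by ring.
apply: le_trans (ler_normD _ _) _; apply: lerD.
  rewrite zS; apply: lipschitz_coord => t t01; apply: hB => i; rewrite !mxE.
  have [->|iK] := eqVneq i K.
    rewrite ltnn/= mulr1 addrK normrM (ger0_norm (x := t)); last by lra.
    by apply: le_trans (yr K); rewrite ler_piMl//; lra.
  by rewrite andbF mulr0 add0r; case: ifP => // _; rewrite subrr normr0.
rewrite (eq_bigl (fun i : 'I_d => (i < k)%N)); first exact: IH (ltnW kd).
move=> i /=; rewrite ltnS leq_eqVlt; have [->|iK] := eqVneq i K.
  by rewrite /= andbF ltnn.
by rewrite andbT (_ : (i == k :> nat) = false)//; apply: contra_neqF iK => /eqP ik; exact: val_inj.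
Qed.

(** Inside a box, the coordinates are moved one at a time.  The segment from [x] to
    [y] is cut into [N] pieces, short enough for boxes around them to stay in the
    ball. *)
Lemma C1_ball_lipschitz_aux x y : Bo x -> Bo y ->
  `|f y - f x| <= M * \sum_i `|y 0 i - x 0 i|.
Proof.
rewrite /open_ball/= => x1 y1.
pose m := Num.max (enorm x) (enorm y).
have m1 : m < 1 by rewrite gt_max x1.
have mx : enorm x <= m by rewrite le_max lexx.
have my : enorm y <= m by rewrite le_max lexx orbT.
pose r := (1 - m) / (d.+1%:R).
have r0 : 0 < r by rewrite divr_gt0// subr_gt0.
have dr : m + d%:R * r < 1.
  rewrite /r mulrA -ltrBrDl ltr_pdivrMr// mulrC ltr_pM2l ?subr_gt0//.
  by rewrite ltr_nat.
(* A box of radius [r] around a point of the ball of radius [m], which contains [x] and [y],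
   is in [Bo]. *)
pose S := \sum_i `|y 0 i - x 0 i|.
have S0 : 0 <= S by exact: sumr_ge0.
pose N := (Num.truncn (S / r)).+1.
have NS : S / N%:R <= r.
  rewrite ler_pdivrMr ?ltr0n// mulrC -ler_pdivrMr//.
  by apply: ltW; apply: truncnS_gt.
pose p (j : nat) := x + (j%:R / N%:R) *: (y - x).
have pN : p N = y by rewrite /p divff ?pnatr_eq0// scale1r addrC subrK.
have p0 : p 0%N = x by rewrite /p mul0r scale0r addr0.
have pm j : (j <= N)%N -> enorm (p j) <= m.
  move=> jN; set t : R := j%:R / N%:R.
  have t0 : 0 <= t by rewrite divr_ge0.
  have t1 : t <= 1 by rewrite ler_pdivrMr ?ltr0n// mul1r ler_nat.
  rewrite /p -/t (_ : x + t *: (y - x) = (1 - t) *: x + t *: y); last first.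
    by rewrite scalerBr scalerBl scale1r addrA addrAC.
  apply: le_trans (ler_enormD _ _) _; rewrite !enormZ//; last by lra.
  nra.
suff h j : (j <= N)%N -> `|f (p j) - f x| <= j%:R * (M * (S / N%:R)).
  have := h N (leqnn _); rewrite pN -/S => /le_trans; apply.
  by rewrite mulrCA (mulrC N%:R) divfK ?pnatr_eq0.
elim: j => [_|j IH jN]; first by rewrite p0 subrr normr0 mul0r.
have pS i : p j.+1 0 i - p j 0 i = (y 0 i - x 0 i) / N%:R.
  by rewrite /p !mxE -natr1; field; rewrite pnatr_eq0.
rewrite (_ : f (p j.+1) - f x = (f (p j.+1) - f (p j)) + (f (p j) - f x)); last by ring.
apply: le_trans (ler_normD _ _) _; rewrite -natr1 mulrDl mul1r addrC.
apply: lerD; first exact: IH (ltnW jN).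
have -> : S / N%:R = \sum_i `|p j.+1 0 i - p j 0 i|.
  rewrite /S mulr_suml; apply: eq_bigr => i _.
  by rewrite pS normrM (ger0_norm (x := _^-1))// invr_ge0.
apply: (lipschitz_box (ltW r0)).
  move=> z zr; rewrite /open_ball/=; apply: le_lt_trans dr.
  rewrite -(subrK (p j) z) addrC; apply: le_trans (ler_enormD _ _) _.
  apply: lerD; first exact: pm (ltnW jN).
  by apply: enorm_box => [|i]; [exact: ltW|rewrite !mxE; have := zr i; rewrite !mxE].
move=> i; rewrite pS normrM (ger0_norm (x := _^-1)) ?invr_ge0//.
apply: le_trans NS; rewrite ler_wpM2r ?invr_ge0// /S (bigD1 i)//= lerDl.
exact: sumr_ge0.
Qed.

End lipschitz.

Lemma C1_ball_lipschitz f g : C1_ball f g -> exists2 L, 0 <= L &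
  forall x y, Bo x -> Bo y -> `|f y - f x| <= L * \sum_i `|y 0 i - x 0 i|.
Proof.
move=> [[M fM] df _ _]; exists M => [|x y].
  have B0 : Bo 0.
    by rewrite /open_ball/= enorm_lt1 (_ : dotv _ _ = 0) ?ltr01//; apply/eqP; rewrite dotv_eq0.
  by have [h _] := fM _ B0; exact: le_trans h.
by apply: C1_ball_lipschitz_aux => // z i /fM[].
Qed.

(** A function of class C^1 is Lipschitz in the ball, which bounds its difference
    quotients across a mirror. *)
Lemma C1_ball_refl_quotient f g v : dotv v v = 2 -> C1_ball f g -> exists M,
  forall x, Bo x -> `|f x - f (x *m refl_mx v)| <= M * `|dotv x v|.
Proof.
move=> v2 /C1_ball_lipschitz[L L0 h]; exists (L * \sum_i `|v 0 i|) => x x1.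
apply: le_trans (h _ _ (open_ball_refl v2 x1) x1) _.
rewrite -mulrA ler_wpM2l// mulr_suml; apply: ler_sum => i _.
by rewrite mulmx_refl// !mxE opprB addrC subrK normrM mulrC.
Qed.

End C1_ball.

(** * Integrals of partial derivatives *)

Section bounded_measurable.
Context d (T : measurableType d) (R : realType) (D : set T).
Implicit Types (f g : T -> R) (c : R).

Definition bounded_mfun f := measurable_fun D f /\ exists M, forall x, D x -> `|f x| <= M.

Lemma bounded_mfun_cst c : bounded_mfun (fun=> c).
Proof. by split; [exact: measurable_cst|exists `|c|]. Qed.

Lemma bounded_mfunD f g : bounded_mfun f -> bounded_mfun g -> bounded_mfun (fun x => f x + g x).
Proof.
move=> [mf [M fM]] [mg [N gN]]; split; first exact: measurable_funD.
exists (M + N) => x Dx; apply: le_trans (ler_normD _ _) _.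
by rewrite lerD ?fM ?gN.
Qed.

Lemma bounded_mfunM f g : bounded_mfun f -> bounded_mfun g -> bounded_mfun (fun x => f x * g x).
Proof.
move=> [mf [M fM]] [mg [N gN]]; split; first exact: measurable_funM.
by exists (M * N) => x Dx; rewrite normrM ler_pM ?fM ?gN.
Qed.

Lemma bounded_mfunZ c f : bounded_mfun f -> bounded_mfun (fun x => c * f x).
Proof. exact/bounded_mfunM/bounded_mfun_cst. Qed.

Lemma bounded_mfunN f : bounded_mfun f -> bounded_mfun (fun x => - f x).
Proof. by move/(bounded_mfunZ (-1)); under eq_fun do rewrite mulN1r. Qed.

Lemma bounded_mfunB f g : bounded_mfun f -> bounded_mfun g -> bounded_mfun (fun x => f x - g x).
Proof. by move=> bf bg; apply: bounded_mfunD => //; exact: bounded_mfunN. Qed.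

Lemma bounded_mfunX n f : bounded_mfun f -> bounded_mfun (fun x => f x ^+ n).
Proof.
move=> bf; elim: n => [|n IH]; first exact: bounded_mfun_cst.
by under eq_fun do rewrite exprS; exact: bounded_mfunM.
Qed.

Lemma bounded_mfun_norm f : bounded_mfun f -> bounded_mfun (fun x => `|f x|).
Proof.
move=> [mf [M fM]]; split; first exact: measurableT_comp.
by exists M => x Dx; rewrite normr_id fM.
Qed.

Lemma bounded_mfun_sum (I : eqType) (r : seq I) (F : I -> T -> R) :
  (forall i, i \in r -> bounded_mfun (F i)) -> bounded_mfun (fun x => \sum_(i <- r) F i x).
Proof.
elim: r => [_|i r IH Fi]; first by under eq_fun do rewrite big_nil; exact: bounded_mfun_cst.
under eq_fun do rewrite big_cons; apply: bounded_mfunD.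
  by apply: Fi; rewrite mem_head.
by apply: IH => j jr; apply: Fi; rewrite inE jr orbT.
Qed.

End bounded_measurable.

Lemma bounded_mfun_wintegrable d (T : measurableType d) (R : realType)
    (m : {measure set T -> \bar R}) (D : set T) (W f : T -> R) :
  finite_weight m D W -> bounded_mfun D f -> wintegrable m D W f.
Proof. by move=> HW [mf [M fM]]; exact: (wintegrable_bounded HW mf fM). Qed.

Section partial_integral.
Context {R : realType} {n : nat}.
Notation d := n.+1.
Notation Bo := (open_ball d : set 'rV[R]_d).
Notation lam := (@lebesgue_rV R d).
Implicit Types (x v : 'rV[R]_d).

(** The constant weight, for integrands that contain an approximation of the weight. *)
Lemma finite_weight1 : finite_weight lam Bo (fun=> 1).
Proof.
have mo : measurable Bo by exact: measurable_open_ball.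
split=> //.
apply/integrableP; split; first exact/measurable_EFinP.
under eq_integral do rewrite /= normr1.
rewrite integral_cst//= mul1e; exact: lebesgue_open_ball_fin.
Qed.

Lemma integral_translate (c : 'rV[R]_d) (G : 'rV[R]_d -> \bar R) : measurable_fun setT G ->
  (\int[lam]_x G (x + c)%R = \int[lam]_x G x)%E.
Proof.
pose s x := x + c; have ms : measurable_fun setT s by exact: measurable_translate.
have ge0 (F : 'rV[R]_d -> \bar R) : measurable_fun setT F -> (forall x, 0 <= F x)%E ->
    (\int[lam]_x F (s x) = \int[lam]_x F x)%E.
  move=> mF F0; transitivity (\int[pushforward lam s]_x F x)%E.
    by rewrite (@ge0_integral_pushforward _ _ _ _ _ s).
  by apply: eq_measure_integral => A mA _; exact: lebesgue_translate.
move=> mG; rewrite integralE [RHS]integralE; congr (_ - _)%E.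
  rewrite -(ge0 _ (measurable_funepos mG)) => [|x]; last exact: funepos_ge0.
  by apply: eq_integral => x _; rewrite !funeposE.
rewrite -(ge0 _ (measurable_funeneg mG)) => [|x]; last exact: funeneg_ge0.
by apply: eq_integral => x _; rewrite !funenegE.
Qed.

(** By dominated convergence, this is the limit of the integrals of the difference
    quotients of [F], which vanish by translation invariance. *)
Lemma integral_partial_eq0 (F dF : 'rV[R]_d -> R) i (M : R) :
  (forall x, is_derive x (delta_mx 0 i) (F : 'rV[R]_d -> R^o) (dF x)) ->
  (forall x, `|dF x| <= M) -> (forall x, `|F x| <= M) ->
  (forall x, ~ Bo x -> F x = 0 /\ dF x = 0) -> measurable_fun setT F ->
  wint lam Bo (fun=> 1) dF = 0.
Proof.
move=> FdF dFM FM F0 mF.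
pose e : 'rV[R]_d := delta_mx 0 i.
pose q (k : nat) x := k.+1%:R * (F (k.+1%:R^-1 *: e + x) - F x).
pose Bx := [set x : 'rV[R]_d | forall j, `|x 0 j - (0 : 'rV[R]_d) 0 j| < 3].
have mBx : measurable Bx by exact: measurable_box.
have lB : (lam Bx < +oo)%E by rewrite lebesgue_box// ltry.
have M0 : 0 <= M by exact: le_trans (FM 0).
have small x : Bo x -> forall j, `|x 0 j| < 1.
  rewrite /open_ball/= enorm_lt1 => x1 j; have := coord_le_dotv x j.
  by rewrite ltr_norml; nra.
have Bxo x : Bo x -> Bx x by move=> /small h j; rewrite mxE subr0; have := h j; lra.
pose g x := M * \1_Bx x.
have ig : lam.-integrable setT (EFin \o g).
  have : lam.-integrable setT (EFin \o (\1_Bx : 'rV[R]_d -> R)).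
    apply/integrableP; split; first exact/measurable_EFinP/measurable_indic.
    under eq_integral do rewrite /= ger0_norm//.
    rewrite integral_indic// setIT; exact: lB.
  by move=> /(@integrableZl _ _ _ lam setT measurableT M); apply: eq_integrable.
have tr c : measurable_fun setT (fun x => F (c + x)).
  rewrite (_ : (fun x => _) = F \o (fun x => x + c)).
    exact: measurableT_comp mF (measurable_translate c).
  by apply/funext => x /=; rewrite addrC.
have mq k : measurable_fun setT (q k).
  by apply: measurable_funM => //; apply: measurable_funB.
have cq x : q k x @[k --> \oo] --> dF x.
  have /is_deriveP h := FdF x.
  have inv0 : (fun k => k.+1%:R^-1 : R) @ \oo --> (0 : R)^'.
    move=> P /= hP; have [N _ NP] := cvg_harmonic hP; exists N => // k Nk.
    by apply: (NP k Nk); rewrite /harmonic/= invr_eq0 pnatr_eq0.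
  have := cvg_comp _ _ inv0 h; rewrite /comp.
  by under eq_fun do rewrite invrK.
have bq k x : `|q k x| <= g x.
  have k0 : 0 < k.+1%:R^-1 :> R by rewrite invr_gt0.
  rewrite /q /g indicE; case: (boolP (x \in Bx)) => [_|/negP xB].
    rewrite mulr1 normrM ger0_norm// -ler_pdivlMl// mulrC.
    apply: (lipschitz_line (df := fun t => dF (t *: e + x))); first exact: ltW.
    by move=> t _; exact: dFM.
  have nB : ~ Bo x by move=> /Bxo xB'; apply: xB; rewrite inE.
  rewrite (F0 _ nB).1 (F0 (_ + x) _).1 ?subrr ?mulr0 ?normr0//.
  move=> /small h; apply: xB; rewrite inE => j; rewrite mxE subr0.
  have := h j; rewrite !mxE eqxx/=.
  have k1 : k.+1%:R^-1 <= 1 :> R by rewrite invf_le1// ler1n.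
  by case: (j == i) => /=; rewrite ?mulr1n ?mulr0n ?mulr1 ?mulr0 !ltr_norml; move: (_^-1) k0 k1 => c k0 k1; lra.
have [idF] := dominated_Rintegral measurableT mq ig (fun x _ => cq x) (fun k x _ => bq k x).
have iF : lam.-integrable setT (EFin \o F).
  apply: le_integrable ig => //; first exact/measurable_EFinP.
  move=> x _; rewrite lee_fin /g indicE; case: (boolP (x \in Bx)) => [_|/negP xB].
    by rewrite mulr1 (ger0_norm M0).
  have nB : ~ Bo x by move=> /Bxo xB'; apply: xB; rewrite inE.
  by rewrite (F0 _ nB).1 mulr0.
have iT c : lam.-integrable setT (EFin \o (fun x => F (c + x))).
  apply/integrableP; split; first exact/measurable_EFinP.
  have := integrableP _ _ _ iF => -[_].
  rewrite -(@integral_translate c (fun x => `|(F x)%:E|%E)); last first.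
    by apply: measurableT_comp => //; exact/measurable_EFinP.
  by under [X in (_ -> X < _)%E]eq_integral do rewrite /= addrC.
have q0 k : \int[lam]_x q k x = 0.
  rewrite /q RintegralZl//; last first.
    have := integrableB measurableT (iT (k.+1%:R^-1 *: e)) iF.
    by apply: eq_integrable.
  rewrite RintegralB// (_ : \int[lam]_x F (_ + x) = \int[lam]_x F x) ?subrr ?mulr0//.
  rewrite /Rintegral; congr fine.
  rewrite -[RHS](integral_translate (k.+1%:R^-1 *: e)); last exact/measurable_EFinP.
  by apply: eq_integral => x _; rewrite addrC.
under eq_fun do rewrite q0.
move=> /(cvg_lim (@Rhausdorff R)); rewrite lim_cst// => dF0.
rewrite /wint Rintegral_mkcond [RHS]dF0; apply: eq_Rintegral => x _.
rewrite patchE mulr1; case: ifPn => //; rewrite notin_setE => nB.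
by rewrite (F0 _ nB).2.
Qed.

End partial_integral.

(** * Cutting off near the sphere *)

Section cutoff.
Context {R : realType}.
Implicit Types (s e b : R).

(** [s `^ b] is singular at 0 when [b < 0].  The factor makes its approximation of
    class C^1 and null near 0, and keeps it below [s `^ b]. *)
Definition cutoff e b s : R := Num.max (s - e) 0 ^+ 2 * s `^ (b - 2).

Definition dcutoff e b s : R :=
  2 * Num.max (s - e) 0 * s `^ (b - 2) +
  Num.max (s - e) 0 ^+ 2 * ((b - 2) * s `^ (b - 3)).

Lemma is_derive_sqr_pos s :
  is_derive s (1 : R) (fun t => Num.max t 0 ^+ 2 : R^o) (2 * Num.max s 0).
Proof.
apply/(@is_deriveP R R^o); apply/cvgrPdist_le => e e0; near=> h.
have h0 : h != 0 by near: h; exact: nbhs_dnbhs_neq.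
have he : `|h| <= e.
  near: h; apply: nbhs_dnbhs; apply/nbhs_ballP; exists e => //= h.
  by rewrite /ball/= sub0r normrN => /ltW.
rewrite [h *: _]mulr1; apply: le_trans he.
set A := Num.max (h + s) 0; set B := Num.max s 0.
have -> : 2 * B - h^-1 * (A ^+ 2 - B ^+ 2) = h^-1 * (h * (2 * B) - (A ^+ 2 - B ^+ 2)).
  by field.
rewrite normrM normfV ler_pdivrMl ?normr_gt0// -normrM (ger0_norm (x := h * h)); last first.
  by rewrite -expr2 sqr_ge0.
rewrite ler_norml /A /B.
by case: (leP s 0) => s0; case: (leP (h + s) 0) => hs; nra.
Unshelve. all: by end_near. Qed.

Lemma is_derive_cutoff e b s : 0 < s ->
  is_derive s (1 : R) (cutoff e b : R -> R^o) (dcutoff e b s).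
Proof.
move=> s0.
have d1 : is_derive s (1 : R) (fun t => t - e : R^o) (1 : R).
  by have := is_deriveB (is_derive_id s (1 : R^o)) (@is_derive_cst R _ R^o e s 1); rewrite subr0.
have d2 := is_derive_comp_R d1 (is_derive_sqr_pos (s - e)).
have d3 := is_derive1_powR (b - 2) s0.
have := is_deriveM d2 d3; congr is_derive.
rewrite /dcutoff /GRing.scale/= mulr1 addrC; congr (_ + _); first by rewrite mulrC.
by congr (_ * (_ * _ `^ _)); ring.
Qed.

Lemma cutoff0 e b s : s <= e -> cutoff e b s = 0 /\ dcutoff e b s = 0.
Proof.
move=> se; rewrite /cutoff /dcutoff (_ : Num.max (s - e) 0 = 0).
  by split; ring.
by apply: max_r; lra.
Qed.

Lemma cutoff_bounded e b : 0 < e -> exists M, forall s, s <= 1 ->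
  `|cutoff e b s| <= M /\ `|dcutoff e b s| <= M.
Proof.
move=> e0; have pb c s : e <= s -> s <= 1 -> s `^ c <= e `^ c + 1.
  move=> es s1; have s0 : 0 < s by exact: lt_le_trans es.
  have [c0|c0] := leP 0 c.
    by rewrite -[leLHS]add0r lerD ?powR_ge0// (le_trans (ge0_ler_powR c0 _ _ s1)) ?powR1// nnegrE ltW.
  rewrite -[leLHS]addr0 lerD// -(opprK c) !(powRN _ (- c)).
  rewrite lef_pV2 ?posrE ?powR_gt0//; apply: ge0_ler_powR; rewrite ?nnegrE; lra.
pose K := (e `^ (b - 2) + 1) + (e `^ (b - 3) + 1).
have K0 c : 0 <= e `^ c + 1 by rewrite addr_ge0 ?powR_ge0.
have KK : 0 <= K by rewrite addr_ge0.
have M0 : 0 <= 2 * K + `|b - 2| * K by rewrite addr_ge0 ?mulr_ge0.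
exists (2 * K + `|b - 2| * K) => s s1; have [se|se] := leP s e.
  by have [-> ->] := cutoff0 b se; rewrite normr0.
have s0 : 0 < s by exact: lt_trans se.
rewrite /cutoff /dcutoff (_ : Num.max (s - e) 0 = s - e); last by apply: max_l; lra.
have m0 : 0 <= s - e by lra.
have m1 : s - e <= 1 by lra.
have h1 : 0 <= s `^ (b - 2) <= K.
  by rewrite powR_ge0/= (le_trans (pb _ _ (ltW se) s1))// lerDl.
have h2 : 0 <= s `^ (b - 3) <= K.
  by rewrite powR_ge0/= (le_trans (pb _ _ (ltW se) s1))// lerDr.
have hb : 0 <= `|b - 2| by [].
move: (s `^ (b - 2)) (s `^ (b - 3)) h1 h2 => u w /andP[u0 uK] /andP[w0 wK].
have sq1 : 0 <= (s - e) ^+ 2 <= 1 by rewrite sqr_ge0/= expr_le1.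
split.
  rewrite ger0_norm ?mulr_ge0 ?sqr_ge0//.
  have : (s - e) ^+ 2 * u <= 1 * K by apply: ler_pM => //; case/andP: sq1.
  have : 0 <= `|b - 2| * K by rewrite mulr_ge0.
  lra.
apply: le_trans (ler_normD _ _) _; apply: lerD.
  rewrite !normrM !ger0_norm// -mulrA ler_wpM2l// -[leRHS]mul1r.
  by apply: ler_pM.
rewrite normrM (ger0_norm (sqr_ge0 _)) normrM (ger0_norm w0) -[leRHS]mul1r.
apply: ler_pM => //; first by rewrite sqr_ge0.
- by rewrite mulr_ge0.
- by case/andP: sq1.
by rewrite ler_wpM2l.
Qed.

Lemma measurable_cutoff e b : measurable_fun setT (cutoff e b).
Proof.
apply: measurable_funM; last exact: measurable_powR.
by apply: measurable_funX; apply: measurable_maxr => //; apply: measurable_funB.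
Qed.

Lemma cutoff_le e b s : 0 <= e -> 0 < s -> 0 <= cutoff e b s <= s `^ b.
Proof.
move=> e0 s0; rewrite /cutoff; apply/andP; split.
  by rewrite mulr_ge0 ?sqr_ge0 ?powR_ge0.
have -> : s `^ b = s ^+ 2 * s `^ (b - 2).
  rewrite -powR_mulrn ?ltW// -powRD; first by congr (_ `^ _); ring.
  by rewrite (gt_eqF s0) implybT.
rewrite ler_wpM2r ?powR_ge0//; apply: lerXn2r.
- by rewrite nnegrE le_max lexx orbT.
- by rewrite nnegrE ltW.
- by rewrite ge_max; apply/andP; split; lra.
Qed.

(** The derivative of [s `^ b] need not be integrable near 0, but its product with
    [s] is of the order of [s `^ b]. *)
Lemma dcutoff_le e b s : 0 <= e -> 0 < s ->
  `|s * dcutoff e b s| <= (2 + `|b - 2|) * s `^ b.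
Proof.
move=> e0 s0.
have E2 : s `^ b = s ^+ 2 * s `^ (b - 2).
  rewrite -powR_mulrn ?ltW// -powRD; first by congr (_ `^ _); ring.
  by rewrite (gt_eqF s0) implybT.
have E3 : s * s `^ (b - 3) = s `^ (b - 2).
  rewrite -{1}(powRr1 (ltW s0)) -powRD; first by congr (_ `^ _); ring.
  by rewrite (gt_eqF s0) implybT.
set m := Num.max (s - e) 0.
have m0 : 0 <= m by rewrite le_max lexx orbT.
have ms : m <= s by rewrite ge_max; apply/andP; split; lra.
rewrite (_ : s * dcutoff e b s = (2 * (s * m) + (b - 2) * m ^+ 2) * s `^ (b - 2)); last first.
  by rewrite /dcutoff -/m -E3; ring.
rewrite E2 normrM (ger0_norm (powR_ge0 _ _)) [leRHS]mulrA ler_wpM2r ?powR_ge0//.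
apply: le_trans (ler_normD _ _) _; rewrite [leRHS]mulrDl; apply: lerD.
  rewrite ger0_norm; last by rewrite !mulr_ge0// ltW.
  by rewrite ler_wpM2l// expr2 ler_wpM2l// ltW.
rewrite normrM ler_wpM2l// ger0_norm ?sqr_ge0//.
by apply: lerXn2r; rewrite ?nnegrE// ltW.
Qed.

Lemma cvg_max_shift s : 0 < s -> Num.max (s - k.+1%:R^-1) 0 @[k --> \oo] --> s.
Proof.
move=> s0; have h : s - k.+1%:R^-1 @[k --> \oo] --> s.
  by rewrite -[X in _ --> X]subr0; apply: cvgB; [exact: cvg_cst|exact: cvg_harmonic].
apply: cvg_trans h; apply: near_eq_cvg.
have : (k.+1%:R^-1 : R) @[k --> \oo] --> (0 : R) by exact: cvg_harmonic.
move=> /cvgr0_norm_lt /(_ _ s0); apply: filterS => k /=.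
by rewrite ger0_norm ?invr_ge0// => ks; rewrite max_l// subr_ge0 ltW.
Qed.

Lemma cvg_cutoff b s : 0 < s -> cutoff k.+1%:R^-1 b s @[k --> \oo] --> s `^ b.
Proof.
move=> s0.
have -> : s `^ b = s ^+ 2 * s `^ (b - 2).
  rewrite -powR_mulrn ?ltW// -powRD; first by congr (_ `^ _); ring.
  by rewrite (gt_eqF s0) implybT.
apply: cvgM; last exact: cvg_cst.
by apply: cvgM; exact: cvg_max_shift.
Qed.

Lemma cvg_dcutoff b s : 0 < s ->
  s * dcutoff k.+1%:R^-1 b s @[k --> \oo] --> b * s `^ b.
Proof.
move=> s0.
have -> : b * s `^ b = s * (2 * s * s `^ (b - 2) + s ^+ 2 * ((b - 2) * s `^ (b - 3))).
  have E2 : s `^ b = s ^+ 2 * s `^ (b - 2).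
    rewrite -powR_mulrn ?ltW// -powRD; first by congr (_ `^ _); ring.
    by rewrite (gt_eqF s0) implybT.
  have E3 : s * s `^ (b - 3) = s `^ (b - 2).
    rewrite -{1}(powRr1 (ltW s0)) -powRD; first by congr (_ `^ _); ring.
    by rewrite (gt_eqF s0) implybT.
  transitivity (2 * s ^+ 2 * s `^ (b - 2) + (b - 2) * s ^+ 2 * (s * s `^ (b - 3))).
    by rewrite E2 E3; ring.
  by ring.
have h := cvg_max_shift s0.
apply: cvgM; first exact: cvg_cst; apply: cvgD.
  by apply: cvgM; [apply: cvgM => //; exact: cvg_cst|exact: cvg_cst].
by apply: cvgM; [apply: cvgM|exact: cvg_cst].
Qed.

End cutoff.

Section cutoff_ibp.
Context {R : realType} {n : nat}.
Notation d := n.+1.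
Notation Bo := (open_ball d : set 'rV[R]_d).
Notation lam := (@lebesgue_rV R d).
Implicit Types (x v : 'rV[R]_d).

Lemma is_derive_sqnorm x i :
  is_derive x (delta_mx 0 i) (fun y : 'rV[R]_d => dotv y y : R^o) (2 * x 0 i).
Proof.
have h j := is_deriveM (is_derive_coord x i j) (is_derive_coord x i j).
have := is_derive_sum h.
rewrite (_ : \sum_(j < d) _ = (fun y : 'rV[R]_d => dotv y y : R^o)); last first.
  by apply/funext => y; rewrite fct_sumE.
congr is_derive; rewrite (bigD1 i)//= eqxx big1 ?addr0 => [|j ji].
  by rewrite /GRing.scale/= !mulr1; ring.
by rewrite eq_sym (negbTE ji) scaler0 addr0.
Qed.

(** Extended by 0, the product of [h] and of the cut-off function has bounded partial
    derivatives in the whole space. *)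
Lemma cutoff_ibp (h : 'rV[R]_d -> R) g i e b : C1_ball h g -> 0 < e ->
  wint lam Bo (fun=> 1) (fun x => g i x * cutoff e b (1 - dotv x x)
    - 2 * x 0 i * h x * dcutoff e b (1 - dotv x x)) = 0.
Proof.
move=> hg e0; have [[N hN] dh mh mg] := hg.
have [M cM] := cutoff_bounded b e0.
pose F : 'rV[R]_d -> R := (fun x => h x * cutoff e b (1 - dotv x x)) \_ Bo.
pose dF : 'rV[R]_d -> R := (fun x => g i x * cutoff e b (1 - dotv x x)
    - 2 * x 0 i * h x * dcutoff e b (1 - dotv x x)) \_ Bo.
have s1 x : 1 - dotv x x <= 1 by rewrite gerBl dotv_ge0.
have M0 : 0 <= M by have [h0 _] := cM 1 (lexx _); exact: le_trans h0.
have N0 : 0 <= N.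
  have B0 : Bo 0.
    by rewrite /open_ball/= enorm_lt1 (_ : dotv _ _ = 0) ?ltr01//; apply/eqP; rewrite dotv_eq0.
  by have [h0 _] := hN 0 B0; exact: le_trans h0.
have NM0 : 0 <= N * M by rewrite mulr_ge0.
rewrite -[RHS](@integral_partial_eq0 _ _ F dF i (N * M + 2 * N * M)).
- by apply: eq_wint => x Bx; rewrite /dF patchE mem_set.
- move=> x; have [Bx|nBx] := pselect (Bo x).
    have nz : \forall y \near x, (fun y => h y * cutoff e b (1 - dotv y y)) y = F y.
      have : nbhs x Bo by apply: open_nbhs_nbhs; split => //; exact: open_open_ball.
      by apply: filterS => y By; rewrite /F patchE mem_set.
    have s0 : 0 < 1 - dotv x x by move: Bx; rewrite /open_ball/= enorm_lt1 subr_gt0.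
    apply: (near_eq_is_derive nz).
    have d1 := is_deriveB (@is_derive_cst R _ R^o 1 x (delta_mx 0 i)) (is_derive_sqnorm x i).
    have d2 := is_derive_comp_R d1 (is_derive_cutoff e b s0).
    have := is_deriveM (dh x i Bx) d2; congr is_derive.
    by rewrite /dF patchE mem_set// /GRing.scale/=; ring.
  have nz : \forall y \near x, (cst 0 : 'rV[R]_d -> R^o) y = F y.
    have : nbhs x [set y : 'rV[R]_d | 1 - e < dotv y y].
      apply: open_nbhs_nbhs; split; last first.
        by move/negP: nBx; rewrite /open_ball/= enorm_lt1 -leNgt /=; lra.
      rewrite (_ : [set y | _] = (fun y : 'rV[R]_d => dotv y y) @^-1` [set r | 1 - e < r])//.
      apply: open_comp; last exact: open_gt.
      by move=> y _; exact: continuous_sqnorm.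
    apply: filterS => y /= ye; rewrite /F patchE; case: ifP => // _.
    by rewrite (cutoff0 b _).1 ?mulr0//; lra.
  apply: (near_eq_is_derive nz); rewrite /dF patchE memNset//.
  exact: (@is_derive_cst R _ R^o 0).
- move=> x; rewrite /dF patchE; case: ifPn => [/set_mem Bx|_]; last first.
    by rewrite normr0 addr_ge0// -mulrA mulr_ge0.
  have [c1 c2] := cM _ (s1 x); have [h1 g1] := hN x Bx.
  apply: le_trans (ler_normB _ _) _; apply: lerD; first by rewrite normrM ler_pM.
  rewrite !normrM; apply: ler_pM => //.
  apply: ler_pM => //; rewrite (ger0_norm (x := 2))// -[leRHS]mulr1 ler_wpM2l//.
  have := coord_le_dotv x i; have := s1 x.
  by move: Bx; rewrite /open_ball/= enorm_lt1 ler_norml => *; nra.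
- move=> x; rewrite /F patchE; case: ifPn => [/set_mem Bx|_]; last first.
    by rewrite normr0 addr_ge0// -mulrA mulr_ge0.
  have [c1 c2] := cM _ (s1 x); have [h1 g1] := hN x Bx.
  rewrite normrM; apply: (@le_trans _ _ (N * M)); first exact: ler_pM.
  by rewrite lerDl -mulrA mulr_ge0.
- by move=> x nBx; rewrite /F /dF !patchE memNset.
apply/(measurable_restrictT _ (@measurable_open_ball R d)).
have m1 : measurable_fun setT (fun x : 'rV[R]_d => 1 - dotv x x).
  by apply: measurable_funB => //; exact: measurable_sqnorm.
have mc := measurableT_comp (measurable_cutoff e b) m1.
exact: (measurable_funM mh (measurable_funTS mc)).
Qed.

End cutoff_ibp.

(** * Smoothing the weight at the mirrors *)

Section regularised_weight.
Context {R : realType} {n : nat}.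
Notation d := n.+1.
Context {Rp : {fset 'rV[R]_d}} {kappa : 'rV[R]_d -> R} {mu : R}.
Hypothesis H : root_weight Rp kappa mu.
Notation Bo := (open_ball d : set 'rV[R]_d).
Implicit Types (x v w : 'rV[R]_d) (e : R).

Lemma is_derive_sum_seq (V : normedModType R) (I : Type) (r : seq I) (F : I -> V -> R)
    (dF : I -> R) (x v : V) :
  (forall i, is_derive x v (F i : V -> R^o) (dF i)) ->
  is_derive x v (fun y => \sum_(i <- r) F i y : R^o) (\sum_(i <- r) dF i).
Proof.
move=> h; elim: r => [|i r IH].
  rewrite big_nil (_ : (fun _ => _) = cst 0); first exact: (@is_derive_cst R _ R^o).
  by apply/funext => y; rewrite big_nil.
rewrite big_cons (_ : (fun _ => _) = (F i : V -> R^o) + (fun y => \sum_(i <- r) F i y : R^o)).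
  exact: is_deriveD.
by apply/funext => y; rewrite big_cons.
Qed.

Lemma is_derive_dotv x v i :
  is_derive x (delta_mx 0 i) (fun y : 'rV[R]_d => dotv y v : R^o) (v 0 i).
Proof.
have h j := is_deriveZ (v 0 j) (is_derive_coord x i j).
have := is_derive_sum h.
rewrite (_ : \sum_(j < d) _ = (fun y : 'rV[R]_d => dotv y v : R^o)); last first.
  by apply/funext => y; rewrite fct_sumE; apply: eq_bigr => j _; rewrite [LHS]mulrC.
congr is_derive; rewrite (bigD1 i)//= eqxx big1 ?addr0 => [|j ji].
  by rewrite [LHS]mulr1.
by rewrite eq_sym (negbTE ji) scaler0.
Qed.

(** A regularization of [\prod_(v <- Rp) `|dotv x v| `^ (2 * kappa v)] at the mirrors. *)
Definition smooth_weight e x : R :=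
  expR (\sum_(v <- Rp) kappa v * ln (dotv x v ^+ 2 + e)).

Definition dsmooth_weight e i x : R := smooth_weight e x *
  \sum_(v <- Rp) kappa v * (2 * dotv x v * v 0 i / (dotv x v ^+ 2 + e)).

Let te_gt0 e x v : 0 < e -> 0 < dotv x v ^+ 2 + e.
Proof. by move=> e0; rewrite ltr_wpDl// sqr_ge0. Qed.

Lemma is_derive_smooth_weight e x i : 0 < e ->
  is_derive x (delta_mx 0 i) (smooth_weight e : 'rV[R]_d -> R^o) (dsmooth_weight e i x).
Proof.
move=> e0.
have dS : is_derive x (delta_mx 0 i)
    (fun y => \sum_(v <- Rp) kappa v * ln (dotv y v ^+ 2 + e) : R^o)
    (\sum_(v <- Rp) kappa v * (2 * dotv x v * v 0 i / (dotv x v ^+ 2 + e))).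
  apply: is_derive_sum_seq => v; apply: is_deriveZ.
  have d1 := is_derive_dotv x v i.
  have d2 := is_deriveD (is_deriveM d1 d1) (@is_derive_cst R _ R^o e x (delta_mx 0 i)).
  have := is_derive_comp_R d2 (is_derive1_ln (te_gt0 x v e0)).
  by congr is_derive; rewrite /GRing.scale/= mulrC; congr (_ / _); ring.
exact: is_derive_comp_R dS (is_derive_expR _).
Qed.

Definition smooth_weight_bound : R := expR (\sum_(v <- Rp) kappa v * ln 3).

Lemma smooth_weight_le e x : 0 < e <= 1 -> Bo x ->
  0 <= smooth_weight e x <= smooth_weight_bound.
Proof.
move=> /andP[e0 e1] Bx; rewrite expR_ge0 ler_expR big_seq [leRHS]big_seq.
apply: ler_sum => v vR; apply: ler_wpM2l; first exact: (rw_kappa H).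
rewrite ler_ln ?posrE//; last exact: te_gt0.
have := dotv_root_le H vR Bx; lra.
Qed.

Lemma measurable_smooth_weight e : measurable_fun setT (smooth_weight e).
Proof.
apply: (measurableT_comp (@measurable_expR R)); apply: measurable_sum => v.
apply: measurable_funM => //; apply: (measurableT_comp (@measurable_ln R)).
by apply: measurable_funD => //; apply: measurable_funX; exact: measurable_dotv.
Qed.

Lemma bounded_mfun_dotv v : bounded_mfun Bo (fun x => dotv x v).
Proof.
split; first by apply: measurable_funTS; exact: measurable_dotv.
exists (1 + dotv v v) => x; rewrite /open_ball/= enorm_lt1 => x1.
have h := dotv_CS x v; have v0 := dotv_ge0 v; have x0 := dotv_ge0 x.
have : dotv x v ^+ 2 <= dotv v v.
  by apply: le_trans h _; rewrite ler_piMl// ltW.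
by rewrite ler_norml; nra.
Qed.

Lemma bounded_mfun_quot e v : 0 < e -> bounded_mfun Bo (fun x => (dotv x v ^+ 2 + e)^-1).
Proof.
move=> e0; split.
  apply: measurable_funTS; apply: measurable_fun_inv; apply: measurable_funD => //.
  by apply: measurable_funX; exact: measurable_dotv.
exists e^-1 => x _; rewrite ger0_norm; last by rewrite invr_ge0 ltW// te_gt0.
by rewrite lef_pV2 ?posrE ?te_gt0// lerDr sqr_ge0.
Qed.

Lemma bounded_mfun_smooth_weight e : 0 < e <= 1 -> bounded_mfun Bo (smooth_weight e).
Proof.
move=> e01; split; first by apply: measurable_funTS; exact: measurable_smooth_weight.
exists smooth_weight_bound => x Bx; have /andP[h1 h2] := smooth_weight_le e01 Bx.
by rewrite ger0_norm.
Qed.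

Lemma C1_ball_smooth_weight e : 0 < e <= 1 ->
  C1_ball (smooth_weight e) (dsmooth_weight e).
Proof.
move=> e01; have /andP[e0 _] := e01; have bK := bounded_mfun_smooth_weight e01.
have bd i : bounded_mfun Bo (dsmooth_weight e i).
  apply: bounded_mfunM => //; apply: bounded_mfun_sum => v _.
  apply: bounded_mfunZ; apply: bounded_mfunM; last exact: bounded_mfun_quot.
  apply: bounded_mfunM; last exact: bounded_mfun_cst.
  by apply: bounded_mfunZ; exact: bounded_mfun_dotv.
split.
- have [_ [M KM]] := bK; have /choice[N dN] i := (bd i).2.
  exists (`|M| + \sum_i `|N i|) => x x1; split.
    apply: le_trans (KM _ x1) _; apply: le_trans (ler_norm _) _.
    by rewrite lerDl sumr_ge0.
  move=> i; apply: le_trans (dN i _ x1) _; apply: le_trans (ler_norm _) _.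
  by rewrite (bigD1 i)//= addrCA lerDl addr_ge0// sumr_ge0.
- by move=> x i _; exact: is_derive_smooth_weight.
- by case: bK.
- by move=> i; case: (bd i).
Qed.

Lemma smooth_weight_refl e v x : v \in Rp -> smooth_weight e (x *m refl_mx v) = smooth_weight e x.
Proof.
move=> vR; rewrite /smooth_weight.
by rewrite (sum_root_refl H x (fun t => ln (t + e)) vR).
Qed.

Lemma cvg_prod_seq (I : eqType) (r : seq I) (F : nat -> I -> R) (l : I -> R) :
  (forall i, i \in r -> F k i @[k --> \oo] --> l i) ->
  \prod_(i <- r) F k i @[k --> \oo] --> \prod_(i <- r) l i.
Proof.
elim: r => [_|i r IH Fl].
  by rewrite big_nil; under eq_fun do rewrite big_nil; exact: cvg_cst.
rewrite big_cons; under eq_fun do rewrite big_cons; apply: cvgM.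
  by apply: Fl; rewrite mem_head.
by apply: IH => j jr; apply: Fl; rewrite inE jr orbT.
Qed.

Lemma cvg_smooth_factor (t c : R) : 0 <= t -> 0 <= c ->
  expR (c * ln (t + k.+1%:R^-1)) @[k --> \oo] --> t `^ c.
Proof.
rewrite le_eqVlt => /predU1P[<-|t0] c0.
  have [->|c00] := eqVneq c 0.
    by rewrite powRr0; under eq_fun do rewrite mul0r expR0; exact: cvg_cst.
  rewrite powR0//.
  have cgt0 : 0 < c by rewrite lt_def c00.
  have inv0 : (fun k => k.+1%:R^-1 : R) @ \oo --> (0 : R)^'+.
    move=> P /= hP; have [N _ NP] := cvg_harmonic hP; exists N => // k Nk.
    by apply: (NP k Nk); rewrite /harmonic/= invr_gt0.
  have := cvg_comp _ _ inv0 (powR_cvg0 cgt0); rewrite /comp.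
  apply: cvg_trans; apply: near_eq_cvg; near=> k.
  by rewrite add0r /powR invr_eq0 pnatr_eq0.
rewrite /powR gt_eqF//.
apply: continuous_cvg; first exact: continuous_expR.
apply: cvgM; first exact: cvg_cst.
apply: continuous_cvg; first exact: continuous_ln.
rewrite -[X in _ --> X]addr0; apply: cvgD; first exact: cvg_cst.
exact: cvg_harmonic.
Unshelve. all: by end_near. Qed.

Lemma cvg_smooth_weight x : smooth_weight k.+1%:R^-1 x @[k --> \oo] -->
  \prod_(v <- Rp) (dotv x v ^+ 2) `^ kappa v.
Proof.
rewrite /smooth_weight; under eq_fun do rewrite expR_sum.
apply: cvg_prod_seq => v vR; apply: cvg_smooth_factor; first exact: sqr_ge0.
exact: (rw_kappa H).
Qed.

End regularised_weight.

(** * Integration by parts *)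

Section ibp.
Context {R : realType} {n : nat}.
Notation d := n.+1.
Context {Rp : {fset 'rV[R]_d}} {kappa : 'rV[R]_d -> R} {mu : R}.
Hypothesis H : root_weight Rp kappa mu.
Notation W := (ball_weight Rp kappa mu).
Notation lam := (@lebesgue_rV R d).
Notation Bo := (open_ball d : set 'rV[R]_d).
Notation mp := (mpoly.mpoly d R).
Notation msize p := (mpoly.msize p).
Notation mderiv := mpoly.mderiv.
Notation X_ i := (mpoly.mpolyX R (mpoly.mnm1 i)).
Implicit Types (x v w : 'rV[R]_d) (e : R) (p q : mp).

Lemma bounded_mfun_poly p : bounded_mfun Bo (poly_fun p).
Proof.
have [[M h] _ m _] := C1_ball_poly p; split=> //.
by exists M => x /h[].
Qed.

Lemma bounded_mfun_C1 f g : C1_ball f g -> bounded_mfun Bo f.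
Proof. by move=> [[M h] _ m _]; split=> //; exists M => x /h[]. Qed.

Lemma bounded_mfun_C1d f g i : C1_ball f g -> bounded_mfun Bo (g i).
Proof. by move=> [[M h] _ _ m]; split=> //; exists M => x /h[]. Qed.

Lemma bounded_mfun_refl v (F : 'rV[R]_d -> R) : v \in Rp -> bounded_mfun Bo F ->
  bounded_mfun Bo (fun x => F (x *m refl_mx v)).
Proof.
move=> vR [mF [M FM]]; split; first exact: (measurable_refl H).
by exists M => x Bx; apply: FM; apply: open_ball_refl => //; exact: (rw_norm H).
Qed.

Lemma euler_poly_fun p x : poly_fun (euler p) x = \sum_i x 0 i * poly_fun (mderiv i p) x.
Proof.
by rewrite poly_fun_sum; apply: eq_bigr => i _; rewrite poly_funM poly_funX.
Qed.

Lemma deriv_dir_poly_fun v p x :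
  poly_fun (deriv_dir v p) x = \sum_i v 0 i * poly_fun (mderiv i p) x.
Proof. by rewrite poly_fun_sum; apply: eq_bigr => i _; rewrite poly_funZ. Qed.

(** The component along [e_i] of the spherical gradient of [p], that is of
    [(1 - x^T x) grad p] in matrix notation. *)
Definition sgrad i p : mp := mderiv i p - X_ i * euler p.

Lemma sgradE i p x : poly_fun (sgrad i p) x =
  poly_fun (mderiv i p) x - x 0 i * poly_fun (euler p) x.
Proof. by rewrite poly_funB poly_funM poly_funX. Qed.

Lemma dotv_sgrad p x :
  \sum_i x 0 i * poly_fun (sgrad i p) x = (1 - dotv x x) * poly_fun (euler p) x.
Proof.
under eq_bigr do rewrite sgradE mulrBr.
rewrite sumrB -euler_poly_fun mulrBl mul1r; congr (_ - _).
by rewrite /dotv mulr_suml; apply: eq_bigr => i _; rewrite mulrA.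
Qed.

Lemma root_sgrad v p x : \sum_i v 0 i * poly_fun (sgrad i p) x =
  poly_fun (deriv_dir v p) x - dotv x v * poly_fun (euler p) x.
Proof.
under eq_bigr do rewrite sgradE mulrBr.
rewrite sumrB -deriv_dir_poly_fun; congr (_ - _).
by rewrite /dotv mulr_suml; apply: eq_bigr => i _; rewrite mulrA [v _ _ * _]mulrC.
Qed.

(** Makes mirrors harmless in weighted integrals of quotients by [dotv x v], which
    all have the factor [kappa v]. *)
Lemma ball_weight_mirror v x : v \in Rp -> dotv x v = 0 -> W x * kappa v = 0.
Proof.
move=> vR t0; have [->|k0] := eqVneq (kappa v) 0; first by rewrite mulr0.
rewrite ball_weightE (bigD1_seq v)//= ?fset_uniq// t0 expr0n/= powR0//.
by rewrite !mul0r.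
Qed.

Definition sdiv p : mp := \sum_i mderiv i (sgrad i p).

Section identity.
Variables (f : 'rV[R]_d -> R) (g : 'I_d -> 'rV[R]_d -> R) (p : mp).
Hypothesis fg : C1_ball f g.

Let E x := poly_fun (euler p) x.
Let a v x := f x * poly_fun (deriv_dir v p) x.
Let q v x := (a v x - a v (x *m refl_mx v)) / dotv x v.
Let G x := \sum_i g i x * poly_fun (sgrad i p) x + f x * poly_fun (sdiv p) x.
Let b := mu - 1 / 2.
Let s x := 1 - dotv x x.

Let C1a v : exists h, C1_ball (a v) h.
Proof. by eexists; exact: C1_ballM fg (C1_ball_poly _). Qed.

Let bf : bounded_mfun Bo f. Proof. exact: bounded_mfun_C1 fg. Qed.

Let bq v : v \in Rp -> bounded_mfun Bo (q v).
Proof.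
move=> vR; have [h C1h] := C1a v; have ba := bounded_mfun_C1 C1h; split.
  apply: measurable_funM.
    by apply: measurable_funB; [case: ba|case: (bounded_mfun_refl vR ba)].
  by apply: measurable_fun_inv; apply: measurable_funTS; exact: measurable_dotv.
have [M MP] := C1_ball_refl_quotient (rw_norm H vR) C1h.
exists `|M| => x Bx; rewrite /q normrM normfV.
have [->|t0] := eqVneq (dotv x v) 0; first by rewrite normr0 invr0 mulr0.
rewrite ler_pdivrMr ?normr_gt0//; apply: le_trans (MP _ Bx) _.
by rewrite ler_wpM2r// ler_norm.
Qed.

Let bG : bounded_mfun Bo G.
Proof.
apply: bounded_mfunD; last by apply: bounded_mfunM => //; exact: bounded_mfun_poly.
apply: bounded_mfun_sum => i _; apply: bounded_mfunM; last exact: bounded_mfun_poly.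
exact: bounded_mfun_C1d fg.
Qed.

Let ratio e x v := dotv x v ^+ 2 / (dotv x v ^+ 2 + e).

(* The divergence for the regularized weight, after the averaging. *)
Let Phi e x := smooth_weight (Rp := Rp) (kappa := kappa) e x * (cutoff e b (s x) *
    (G x - f x * E x * (2 * \sum_(v <- Rp) kappa v * ratio e x v)
     + \sum_(v <- Rp) kappa v * (ratio e x v * q v x))
    - 2 * (f x * E x) * (s x * dcutoff e b (s x))).

Let te_gt0 e x v : 0 < e -> 0 < dotv x v ^+ 2 + e.
Proof. by move=> e0; rewrite ltr_wpDl// sqr_ge0. Qed.

Let s_gt0 x : Bo x -> 0 < s x.
Proof. by rewrite /open_ball/= enorm_lt1 subr_gt0. Qed.

Let bs : bounded_mfun Bo s.
Proof.
split; first by apply: measurable_funTS; apply: measurable_funB => //; exact: measurable_sqnorm.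
exists 1 => x Bx; rewrite gtr0_norm ?s_gt0// /s gerBl; exact: dotv_ge0.
Qed.

Let bcut e : 0 < e -> bounded_mfun Bo (fun x => cutoff e b (s x)).
Proof.
move=> e0; split; first exact: (measurableT_comp (measurable_cutoff e b) bs.1).
have [M MP] := cutoff_bounded b e0; exists M => x _.
by have [] := MP (s x) _; rewrite // /s gerBl; exact: dotv_ge0.
Qed.

Let measurable_dcutoff e : measurable_fun setT (dcutoff e b).
Proof.
have mm : measurable_fun setT (fun t : R => Num.max (t - e) 0).
  by apply: measurable_maxr => //; apply: measurable_funB.
apply: measurable_funD.
  by apply: measurable_funM; [exact: measurable_funM|exact: measurable_powR].
apply: measurable_funM; first exact: measurable_funX.
by apply: measurable_funM => //; exact: measurable_powR.
Qed.

Let bdcut e : 0 < e -> bounded_mfun Bo (fun x => dcutoff e b (s x)).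
Proof.
move=> e0; split; first exact: (measurableT_comp (measurable_dcutoff e) bs.1).
have [M MP] := cutoff_bounded b e0; exists M => x _.
by have [] := MP (s x) _; rewrite // /s gerBl; exact: dotv_ge0.
Qed.

(* Odd under the reflection in [v]; its subtraction averages the term of [v] in the
   divergence with its image under this reflection. *)
Let antisym e v x := kappa v * (smooth_weight (Rp := Rp) (kappa := kappa) e x * cutoff e b (s x) *
  (dotv x v * (dotv x v ^+ 2 + e)^-1) * (a v x + a v (x *m refl_mx v))).

Let antisym_bounded e v : 0 < e <= 1 -> v \in Rp -> bounded_mfun Bo (antisym e v).
Proof.
move=> e01 vR; have /andP[e0 _] := e01; have [h C1h] := C1a v.
have ba := bounded_mfun_C1 C1h.
apply: bounded_mfunZ; apply: bounded_mfunM; last first.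
  by apply: bounded_mfunD => //; exact: bounded_mfun_refl.
apply: bounded_mfunM; last first.
  by apply: bounded_mfunM; [exact: bounded_mfun_dotv|exact: bounded_mfun_quot].
by apply: bounded_mfunM; [exact: (bounded_mfun_smooth_weight H)|exact: bcut].
Qed.

Let antisym0 e v : 0 < e <= 1 -> v \in Rp -> wint lam Bo (fun=> 1) (antisym e v) = 0.
Proof.
move=> e01 vR; have v2 := rw_norm H vR; have ba := antisym_bounded e01 vR.
have ia := bounded_mfun_wintegrable (finite_weight1 (R := R) (n := n)) ba.
have h : wint lam Bo (fun=> 1) (antisym e v) = - wint lam Bo (fun=> 1) (antisym e v).
  rewrite -wintN//; last exact: finite_weight1.
  transitivity (wint lam Bo (fun=> 1) (fun x => antisym e v (x *m refl_mx v))).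
    rewrite /wint /Rintegral; congr fine.
    rewrite -[LHS](integral_refl v2)//.
    by apply/measurable_EFinP; apply: measurable_funM => //; case: ba.
  apply: eq_wint => x Bx; rewrite /antisym (smooth_weight_refl H e x vR) /s dotv_refl//.
  by rewrite dotv_refl_root// mulmx_reflK// sqrrN; ring.
lra.
Qed.

Let Phi0 e : 0 < e <= 1 -> wint lam Bo (fun=> 1) (Phi e) = 0.
Proof.
move=> e01; have /andP[e0 _] := e01.
have Hw := finite_weight1 (R := R) (n := n).
pose K := smooth_weight (Rp := Rp) (kappa := kappa) e.
pose h i x := (f x * poly_fun (sgrad i p) x) * K x.
have Ch i := C1_ballM (C1_ballM fg (C1_ball_poly (sgrad i p))) (C1_ball_smooth_weight H e01).
pose dh i x := (f x * poly_fun (sgrad i p) x) * dsmooth_weight (Rp := Rp) (kappa := kappa) e i x +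
   K x * (f x * poly_fun (mderiv i (sgrad i p)) x + poly_fun (sgrad i p) x * g i x).
pose T i x := dh i x * cutoff e b (s x) - 2 * x 0 i * h i x * dcutoff e b (s x).
have T0 i : wint lam Bo (fun=> 1) (T i) = 0.
  by rewrite -[RHS](cutoff_ibp i b (Ch i) e0); apply: eq_wint => x _.
have bT i : bounded_mfun Bo (T i).
  apply: bounded_mfunB; apply: bounded_mfunM; rewrite ?bcut ?bdcut//.
  - exact: bounded_mfun_C1d (Ch i).
  - exact: bcut.
  - apply: bounded_mfunM; last exact: bounded_mfun_C1 (Ch i).
    apply: bounded_mfunZ; have := bounded_mfun_poly (X_ i).
    by congr bounded_mfun; apply/funext => x; exact: poly_funX.
  - exact: bdcut.
have iT i := bounded_mfun_wintegrable Hw (bT i).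
have ST0 : wint lam Bo (fun=> 1) (fun x => \sum_i T i x) = 0.
  by rewrite wint_sum// big1.
have bA : bounded_mfun Bo (fun x => \sum_(v <- Rp) antisym e v x).
  by apply: bounded_mfun_sum => v vR; exact: antisym_bounded.
have SA0 : wint lam Bo (fun=> 1) (fun x => \sum_(v <- Rp) antisym e v x) = 0.
  rewrite (wint_sum Hw) => [|v vR]; last exact/(bounded_mfun_wintegrable Hw)/antisym_bounded.
  by rewrite big_seq big1// => v vR; exact: antisym0.
have bST : bounded_mfun Bo (fun x => \sum_i T i x) by apply: bounded_mfun_sum.
have iST := bounded_mfun_wintegrable Hw bST.
have iSA := bounded_mfun_wintegrable Hw bA.
have E0 := wintB Hw iST iSA; rewrite ST0 SA0 subrr in E0.
rewrite -[RHS]E0.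
apply: eq_wint => x Bx.
have ST : \sum_i T i x = K x * cutoff e b (s x) *
    (G x + f x * \sum_(v <- Rp) kappa v * (2 * dotv x v / (dotv x v ^+ 2 + e) *
        (poly_fun (deriv_dir v p) x - dotv x v * E x)))
    - 2 * f x * K x * (s x * E x) * dcutoff e b (s x).
  rewrite /T sumrB; congr (_ - _); last first.
    rewrite -mulr_suml; congr (_ * _); rewrite /s -dotv_sgrad mulr_sumr.
    by apply: eq_bigr => i _; rewrite /h; ring.
  rewrite -mulr_suml mulrAC; congr (_ * _).
  rewrite /dh big_split/= -mulr_sumr.
  have -> : \sum_(i < d) f x * poly_fun (sgrad i p) x * dsmooth_weight (Rp := Rp) (kappa := kappa) e i x =
    K x * (f x * \sum_(v <- Rp) kappa v * (2 * dotv x v / (dotv x v ^+ 2 + e) *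
        (poly_fun (deriv_dir v p) x - dotv x v * E x))).
    rewrite mulrA mulr_sumr.
    transitivity (\sum_(i < d) \sum_(v <- Rp) K x * f x * (kappa v *
       (2 * dotv x v / (dotv x v ^+ 2 + e) * (v 0 i * poly_fun (sgrad i p) x)))).
      apply: eq_bigr => i _; rewrite /dsmooth_weight -/(K x) mulr_sumr mulr_sumr.
      by apply: eq_bigr => v _; ring.
    rewrite exchange_big/=; apply: eq_bigr => v _.
    by rewrite -root_sgrad !mulr_sumr.
  rewrite -mulrDr addrC; congr (_ * (_ + _)).
  rewrite /G /sdiv poly_fun_sum mulr_sumr -big_split/=; apply: eq_bigr => i _.
  by ring.
rewrite /Phi -/K ST.
have -> : \sum_(v <- Rp) antisym e v x = K x * cutoff e b (s x) *
   \sum_(v <- Rp) kappa v * ((dotv x v * (dotv x v ^+ 2 + e)^-1) * (a v x + a v (x *m refl_mx v))).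
  by rewrite mulr_sumr; apply: eq_bigr => v _; rewrite /antisym -/K; ring.
suff : f x * \sum_(v <- Rp) kappa v * (2 * dotv x v / (dotv x v ^+ 2 + e) *
        (poly_fun (deriv_dir v p) x - dotv x v * E x)) -
   \sum_(v <- Rp) kappa v * ((dotv x v * (dotv x v ^+ 2 + e)^-1) * (a v x + a v (x *m refl_mx v)))
  = - (f x * E x * (2 * \sum_(v <- Rp) kappa v * ratio e x v))
     + \sum_(v <- Rp) kappa v * (ratio e x v * q v x).
  set U := f x * \sum_(v <- Rp) _; set V := \sum_(v <- Rp) _ => UV.
  transitivity (K x * (cutoff e b (s x) * (G x + (U - V)) -
    2 * (f x * E x) * (s x * dcutoff e b (s x)))); last by ring.
  by rewrite UV; ring.
move: (E x) => Ex; rewrite mulr_sumr -sumrB !mulr_sumr -sumrN -big_split/=; apply: eq_bigr => v _.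
rewrite /ratio /q /a; set t := dotv x v.
have te0 : t ^+ 2 + e != 0 by rewrite gt_eqF// te_gt0.
have [t0|t0] := eqVneq t 0.
  by rewrite t0 !(mul0r, mulr0, expr0n, subr0, addr0, oppr0)/=; ring.
by field; rewrite t0.
Qed.

Let kap := \sum_(v <- Rp) kappa v.

Let ratio_le e x v : 0 < e -> 0 <= ratio e x v <= 1.
Proof.
move=> e0; rewrite /ratio divr_ge0 ?sqr_ge0 ?(ltW (te_gt0 x v e0))//=.
by rewrite ler_pdivrMr ?te_gt0// mul1r lerDl ltW.
Qed.

Let cvg_ratio x v : ratio k.+1%:R^-1 x v @[k --> \oo] --> ((dotv x v != 0)%:R : R).
Proof.
have [t0|t0] /= := eqVneq (dotv x v) 0.
  rewrite /ratio t0 expr0n/=; under eq_fun do rewrite mul0r; exact: cvg_cst.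
have t20 : dotv x v ^+ 2 != 0 by rewrite sqrf_eq0.
rewrite -[X in _ --> X](divff t20); apply: cvgM; first exact: cvg_cst.
apply: cvgV => //; rewrite -[X in _ --> X]addr0.
by apply: cvgD; [exact: cvg_cst|exact: cvg_harmonic].
Qed.

Let weight_mirror v x : v \in Rp -> W x * (kappa v * (dotv x v != 0)%:R) = W x * kappa v.
Proof.
move=> vR; have [t0|_] := eqVneq (dotv x v) 0; last by rewrite mulr1.
by rewrite mulr0 mulr0 ball_weight_mirror.
Qed.

(** The integral of the divergence of [f * sgrad p * W].  There is no boundary term
    since [sgrad p] has radial component [(1 - |x|^2) euler p], which compensates the
    singularity of the gradient of the radial weight.  The root [v] contributes
    [2 kappa v * a v x / dotv x v], whose singularity is removed by averaging it with
    its image under the reflection in [v]: this gives [kappa v * q v x]. *)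
Lemma ibp_identity : wint lam Bo W (fun x =>
  G x - (2 * kap + 2 * b) * (f x * E x) + \sum_(v <- Rp) kappa v * q v x) = 0.
Proof.
have mo : measurable Bo by exact: measurable_open_ball.
have e01 k : 0 < (k.+1%:R^-1 : R) <= 1 by rewrite invr_gt0/= ltr0n/= invf_le1// ler1n.
have e0 k : 0 < (k.+1%:R^-1 : R) by case/andP: (e01 k).
have [mG [MG GM]] := bG.
have [mfE [ME fEM]] : bounded_mfun Bo (fun x => f x * E x).
  by apply: bounded_mfunM => //; exact: bounded_mfun_poly.
have /choice[Mq qM] v : exists M, v \in Rp -> forall x, Bo x -> `|q v x| <= M.
  case: (boolP (v \in Rp)) => vR; last by exists 0.
  by have [_ [M h]] := bq vR; exists M.
pose SK := @smooth_weight_bound R n Rp kappa.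
pose C := SK * (MG + ME * (2 * kap) + \sum_(v <- Rp) kappa v * Mq v + 2 * ME * (2 + `|b - 2|)).
have mPhi k : measurable_fun Bo (Phi k.+1%:R^-1).
  have mr v : measurable_fun Bo (fun x => ratio k.+1%:R^-1 x v).
    have := bounded_mfunM (bounded_mfunM (bounded_mfun_dotv v) (bounded_mfun_dotv v))
      (bounded_mfun_quot v (e0 k)).
    by case.
  have bs1 : bounded_mfun Bo (fun x => \sum_(v <- Rp) kappa v * ratio k.+1%:R^-1 x v).
    apply: bounded_mfun_sum => v _; apply: bounded_mfunZ; split => //.
    by exists 1 => x _; have /andP[r0 r1] := ratio_le x v (e0 k); rewrite ger0_norm.
  have bs2 : bounded_mfun Bo (fun x => \sum_(v <- Rp) kappa v * (ratio k.+1%:R^-1 x v * q v x)).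
    apply: bounded_mfun_sum => v vR; apply: bounded_mfunZ; apply: bounded_mfunM; last exact: bq.
    split => //; exists 1 => x _; have /andP[r0 r1] := ratio_le x v (e0 k).
    by rewrite ger0_norm.
  have bfE : bounded_mfun Bo (fun x => f x * E x) by split=> //; exists ME.
  suff : bounded_mfun Bo (Phi k.+1%:R^-1) by case.
  apply: bounded_mfunM; first exact: (bounded_mfun_smooth_weight H).
  apply: bounded_mfunB.
    apply: bounded_mfunM; first exact: bcut.
    apply: bounded_mfunD => //; apply: bounded_mfunB => //.
    by apply: bounded_mfunM => //; exact: bounded_mfunZ.
  apply: bounded_mfunM; first exact: bounded_mfunZ.
  by apply: bounded_mfunM => //; exact: bdcut.
have ig : lam.-integrable Bo (EFin \o (fun x => C * s x `^ b)).
  have := @integrableZl _ _ _ lam Bo mo C _ (integrable_radial_weight H).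
  by apply: eq_integrable => // x _ /=; rewrite EFinM.
have lePhi k x : Bo x -> `|Phi k.+1%:R^-1 x * 1| <= C * s x `^ b.
  move=> Bx; have s0 := s_gt0 Bx; rewrite mulr1 /Phi normrM.
  have /andP[K0 KS] := smooth_weight_le H (e01 k) Bx.
  rewrite (ger0_norm K0) /C -[leRHS]mulrA; apply: ler_pM => //.
  have sb0 := powR_ge0 (s x) b.
  have /andP[c0 cs] := cutoff_le b (ltW (e0 k)) s0.
  have ds := dcutoff_le b (ltW (e0 k)) s0.
  have ME0 : 0 <= ME by exact: le_trans (fEM _ Bx).
  apply: le_trans (ler_normB _ _) _; rewrite [leRHS]mulrDl; apply: lerD.
    rewrite normrM (ger0_norm c0) mulrC; apply: ler_pM => //.
    apply: le_trans (ler_normD _ _) _; apply: lerD.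
      apply: le_trans (ler_normB _ _) _; apply: lerD; first exact: GM.
      rewrite normrM; apply: ler_pM => //; first exact: fEM.
      rewrite normrM (ger0_norm (x := 2))// ler_wpM2l//.
      apply: le_trans (ler_norm_sum _ _ _) _; rewrite /kap big_seq [leRHS]big_seq.
      apply: ler_sum => v vR; have /andP[r0 r1] := ratio_le x v (e0 k).
      rewrite normrM (ger0_norm r0) (ger0_norm (rw_kappa H vR)) ler_piMr//.
      exact: (rw_kappa H).
    apply: le_trans (ler_norm_sum _ _ _) _; rewrite big_seq [leRHS]big_seq.
    apply: ler_sum => v vR; have /andP[r0 r1] := ratio_le x v (e0 k).
    rewrite normrM (ger0_norm (rw_kappa H vR)) ler_wpM2l ?(rw_kappa H vR)//.
    rewrite normrM (ger0_norm r0); apply: (le_trans _ (qM _ vR _ Bx)).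
    exact: ler_piMl.
  rewrite normrM -[leRHS]mulrA; apply: ler_pM => //.
  by rewrite normrM (ger0_norm (x := 2))// ler_wpM2l// fEM.
have cPhi x : Bo x -> Phi k.+1%:R^-1 x * 1 @[k --> \oo] -->
    (G x - (2 * kap + 2 * b) * (f x * E x) + \sum_(v <- Rp) kappa v * q v x) * W x.
  move=> Bx; have s0 := s_gt0 Bx.
  pose P := \prod_(v <- Rp) (dotv x v ^+ 2) `^ kappa v.
  pose z v := ((dotv x v != 0)%:R : R).
  have lim : P * (s x `^ b * (G x - f x * E x * (2 * \sum_(v <- Rp) kappa v * z v)
      + \sum_(v <- Rp) kappa v * (z v * q v x)) - 2 * (f x * E x) * (b * s x `^ b)) =
    (G x - (2 * kap + 2 * b) * (f x * E x) + \sum_(v <- Rp) kappa v * q v x) * W x.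
    have WP : W x = P * s x `^ b by exact: ball_weightE.
    have h1 : W x * (\sum_(v <- Rp) kappa v * z v) = W x * kap.
      by rewrite !mulr_sumr; apply: eq_big_seq => v vR; exact: weight_mirror.
    have h2 : W x * (\sum_(v <- Rp) kappa v * (z v * q v x)) =
        W x * \sum_(v <- Rp) kappa v * q v x.
      rewrite !mulr_sumr; apply: eq_big_seq => v vR.
      by rewrite mulrA -[_ * kappa v * _]mulrA; rewrite [kappa v * _]mulrA mulrA weight_mirror// -mulrA.
    move: h1 h2; set S1 := \sum_(v <- Rp) _; set S2 := \sum_(v <- Rp) _; set S3 := \sum_(v <- Rp) _.
    move=> h1 h2; transitivity (W x * G x - 2 * (f x * E x) * (W x * S1) + W x * S2
      - 2 * (f x * E x) * b * W x); first by rewrite WP; ring.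
    by rewrite h1 h2; ring.
  rewrite -lim; under eq_fun do rewrite mulr1.
  have cs (F : nat -> 'rV[R]_d -> R) l : (forall v, F k v @[k --> \oo] --> l v) ->
      \sum_(v <- Rp) F k v @[k --> \oo] --> \sum_(v <- Rp) l v.
    by move=> h; apply: cvg_sumr.
  have cc (c : R) : (fun=> c) @ \oo --> c by exact: cvg_cst.
  apply: cvgM; first exact: (cvg_smooth_weight H).
  apply: cvgB; last by apply: cvgM => //; exact: cvg_dcutoff.
  apply: cvgM; first exact: cvg_cutoff.
  apply: cvgD.
    apply: cvgB => //; apply: cvgM => //; apply: cvgM => //.
    by apply: cs => v; apply: cvgM => //; exact: cvg_ratio.
  by apply: cs => v; do 2 (apply: cvgM => //); exact: cvg_ratio.
have m1 k : measurable_fun Bo (fun x => Phi k.+1%:R^-1 x * 1).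
  exact: measurable_funM.
have [_] := dominated_Rintegral mo m1 ig cPhi lePhi.
rewrite (_ : (fun k => _) = (fun=> 0)); last by apply/funext => k; exact: Phi0.
by move=> /(cvg_lim (@Rhausdorff R)); rewrite lim_cst.
Qed.

End identity.
End ibp.

(** * The operator on polynomials and its energy *)

Section energy.
Context {R : realType} {n : nat}.
Notation d := n.+1.
Context {Rp : {fset 'rV[R]_d}} {kappa : 'rV[R]_d -> R} {mu : R}.
Hypothesis H : root_weight Rp kappa mu.
Notation W := (ball_weight Rp kappa mu).
Notation lam := (@lebesgue_rV R d).
Notation Bo := (open_ball d : set 'rV[R]_d).
Notation mp := (mpoly.mpoly d R).
Notation msize p := (mpoly.msize p).
Notation mderiv := mpoly.mderiv.
Notation X_ i := (mpoly.mpolyX R (mpoly.mnm1 i)).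
Notation wI := (wint lam Bo W).
Notation lambda := (ball_lambda Rp kappa mu).
Implicit Types (x v w : 'rV[R]_d) (p q : mp) (f h : 'rV[R]_d -> R)
  (g k : 'I_d -> 'rV[R]_d -> R).

Let HW := finite_ball_weight H.

Definition dunkl_quotient v p : mp := xget 0 [set q : mp | (msize q <= (msize p).-1)%N /\
    forall x, dotv x v ^+ 2 * poly_fun q x =
      2 * dotv x v * poly_fun (deriv_dir v p) x -
      2 * (poly_fun p x - poly_fun p (x *m refl_mx v))].

Lemma dunkl_quotientP v p : v \in Rp -> (msize (dunkl_quotient v p) <= (msize p).-1)%N /\
    forall x, dotv x v ^+ 2 * poly_fun (dunkl_quotient v p) x =
      2 * dotv x v * poly_fun (deriv_dir v p) x -
      2 * (poly_fun p x - poly_fun p (x *m refl_mx v)).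
Proof.
move=> vR; rewrite /dunkl_quotient; case: xgetP => [q _ //|h].
by have [q qP] := dunkl_quotients (rw_norm H vR) (leqnn (msize p)); case: (h q).
Qed.

(** The operator with eigenspaces [ball_orthopoly]: the Laplacian minus
    [(x . grad)^2 + 2 lambda (x . grad)], plus the difference part of the Dunkl
    Laplacian. *)
Definition ball_lap p : mp :=
  \sum_i mderiv i (mderiv i p) - euler (euler p) - (2 * lambda) *: euler p
  + \sum_(v <- Rp) kappa v *: dunkl_quotient v p.

(** On the leading part of [p], of degree [m], the operator acts as
    [- euler (euler p) - 2 lambda euler p = - m (m + 2 lambda) p]. *)
Lemma msize_ball_lap m p : (msize p <= m.+1)%N ->
  (msize (ball_lap p + (m%:R * (m%:R + 2 * lambda)) *: p) <= m)%N.
Proof.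
move=> pm.
rewrite (_ : ball_lap p + _ = \sum_i mderiv i (mderiv i p)
   - (euler (euler p) - m%:R *: euler p) - (m%:R + 2 * lambda) *: (euler p - m%:R *: p)
   + \sum_(v <- Rp) kappa v *: dunkl_quotient v p); last first.
  rewrite /ball_lap; set D := \sum_i _; set S := \sum_(v <- Rp) _.
  apply/mpoly.mpolyP => l.
  by rewrite !(mpoly.mcoeffD, mpoly.mcoeffN, mpoly.mcoeffZ); ring.
apply: msizeD.
  apply: msizeB; first apply: msizeB.
  - apply: msize_sum => i _; have := msize_mderiv i pm.
    case: m pm => [|m] pm; last by move=> h; apply: leqW; exact: msize_mderiv.
    by rewrite leqn0 mpoly.msize_poly_eq0 => /eqP ->; rewrite mpoly.mderiv0 mpoly.msize0.
  - exact/msize_euler_sub/msize_euler.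
  - exact/msizeZ/msize_euler_sub.
rewrite big_seq; apply: msize_sum => v vR; apply: msizeZ.
have [h _] := dunkl_quotientP p vR; apply: leq_trans h _.
by rewrite -subn1 leq_subLR.
Qed.

Lemma poly_fun_sdiv p x : poly_fun (sdiv p) x =
  poly_fun (\sum_i mderiv i (mderiv i p)) x - d%:R * poly_fun (euler p) x
  - poly_fun (euler (euler p)) x.
Proof.
rewrite /sdiv poly_fun_sum (poly_fun_sum _ _ (fun i => mderiv i (mderiv i p))).
rewrite (euler_poly_fun (euler p)) -[d in d%:R]card_ord mulr_natl -sumr_const -!sumrB.
apply: eq_bigr => i _; rewrite /sgrad mpoly.mderivB mpoly.mderivM mderivXi eqxx mulr1n.
rewrite poly_funB poly_funD !poly_funM poly_funC poly_funX.
by ring.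
Qed.

(** The carre du champ of [ball_lap]. *)
Definition energy_density f g h k x : R :=
  \sum_i g i x * k i x - (\sum_i x 0 i * g i x) * (\sum_i x 0 i * k i x)
  + \sum_(v <- Rp) kappa v *
      ((f x - f (x *m refl_mx v)) * (h x - h (x *m refl_mx v)) / dotv x v ^+ 2).

Lemma energy_densityC f g h k x : energy_density f g h k x = energy_density h k f g x.
Proof.
rewrite /energy_density; congr (_ - _ + _).
- by apply: eq_bigr => i _; rewrite mulrC.
- by rewrite mulrC.
- by apply: eq_bigr => v _; rewrite [(f x - _) * _]mulrC.
Qed.

Lemma bounded_mfun_refl_quotient f g v : C1_ball f g -> v \in Rp ->
  bounded_mfun Bo (fun x => (f x - f (x *m refl_mx v)) / dotv x v).
Proof.
move=> fg vR; have bf := bounded_mfun_C1 fg; split.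
  apply: measurable_funM.
    by apply: measurable_funB; [case: bf|case: (bounded_mfun_refl H vR bf)].
  by apply: measurable_fun_inv; apply: measurable_funTS; exact: measurable_dotv.
have [M MP] := C1_ball_refl_quotient (rw_norm H vR) fg.
exists `|M| => x Bx; rewrite normrM normfV.
have [->|t0] := eqVneq (dotv x v) 0; first by rewrite normr0 invr0 mulr0.
rewrite ler_pdivrMr ?normr_gt0//; apply: le_trans (MP _ Bx) _.
by rewrite ler_wpM2r// ler_norm.
Qed.

Lemma bounded_mfun_dot_grad f g : C1_ball f g -> bounded_mfun Bo (fun x => \sum_i x 0 i * g i x).
Proof.
move=> fg; apply: bounded_mfun_sum => i _; apply: bounded_mfunM; last exact: bounded_mfun_C1d fg.
have := bounded_mfun_poly (X_ i).
by congr bounded_mfun; apply/funext => x; exact: poly_funX.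
Qed.

Lemma bounded_mfun_energy f g h k : C1_ball f g -> C1_ball h k ->
  bounded_mfun Bo (energy_density f g h k).
Proof.
move=> fg hk; apply: bounded_mfunD.
  apply: bounded_mfunB.
    by apply: bounded_mfun_sum => i _; apply: bounded_mfunM;
      [exact: bounded_mfun_C1d fg|exact: bounded_mfun_C1d hk].
  by apply: bounded_mfunM; [exact: (bounded_mfun_dot_grad fg)|exact: (bounded_mfun_dot_grad hk)].
apply: bounded_mfun_sum => v vR; apply: bounded_mfunZ.
have := bounded_mfunM (bounded_mfun_refl_quotient fg vR) (bounded_mfun_refl_quotient hk vR).
by congr bounded_mfun; apply/funext => x; rewrite mulrACA -invfM -expr2.
Qed.

Definition grad_poly p (i : 'I_d) : 'rV[R]_d -> R := poly_fun (mderiv i p).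

(** This is [ibp_identity] once its difference terms, which are not symmetric in
    [f] and [p], are averaged with their images under the reflections. *)
Lemma energy_poly f g p : C1_ball f g ->
  wI (energy_density f g (poly_fun p) (grad_poly p)) =
  - wI (fun x => f x * poly_fun (ball_lap p) x).
Proof.
move=> fg; have idt := ibp_identity H p fg.
have bf := bounded_mfun_C1 fg.
have bI F (bF : bounded_mfun Bo F) := bounded_mfun_wintegrable HW bF.
pose a v x := f x * poly_fun (deriv_dir v p) x.
pose q v x := (a v x - a v (x *m refl_mx v)) / dotv x v.
pose P v x := f x * poly_fun (dunkl_quotient v p) x.
pose D v x := (f x - f (x *m refl_mx v)) * (poly_fun p x - poly_fun p (x *m refl_mx v)) / dotv x v ^+ 2.
have bP v : bounded_mfun Bo (P v) by apply: bounded_mfunM => //; exact: bounded_mfun_poly.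
have bD v : v \in Rp -> bounded_mfun Bo (D v).
  move=> vR; have := bounded_mfunM (bounded_mfun_refl_quotient fg vR)
    (bounded_mfun_refl_quotient (C1_ball_poly p) vR).
  by congr bounded_mfun; apply/funext => x; rewrite mulrACA -invfM -expr2.
have bq v : v \in Rp -> bounded_mfun Bo (q v).
  by move=> vR; exact: bounded_mfun_refl_quotient (C1_ballM fg (C1_ball_poly _)) vR.
have sym v : v \in Rp -> wI (fun x => kappa v * (q v x - D v x - P v x)) = 0.
  move=> vR; have v2 := rw_norm H vR.
  have bPs := bounded_mfun_refl H vR (bP v).
  transitivity (wI (fun x => kappa v * (2^-1 * (P v (x *m refl_mx v) - P v x)))).
    apply: eq_Rintegral => x _; rewrite [LHS]mulrC [RHS]mulrC.
    have [t0|t0] := eqVneq (dotv x v) 0.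
      by rewrite !mulrA (ball_weight_mirror vR t0) !mul0r.
    congr (_ * (_ * _)).
    have [_ h] := dunkl_quotientP p vR.
    have t20 : dotv x v ^+ 2 != 0 by rewrite sqrf_eq0.
    have h1 := h x; have h2 := h (x *m refl_mx v).
    rewrite mulmx_reflK// dotv_refl_root// sqrrN in h2.
    have e1 : poly_fun (dunkl_quotient v p) x = (2 * dotv x v * poly_fun (deriv_dir v p) x -
      2 * (poly_fun p x - poly_fun p (x *m refl_mx v))) / dotv x v ^+ 2 by rewrite -h1 mulrC mulKf.
    have e2 : poly_fun (dunkl_quotient v p) (x *m refl_mx v) =
      (2 * - dotv x v * poly_fun (deriv_dir v p) (x *m refl_mx v) -
      2 * (poly_fun p (x *m refl_mx v) - poly_fun p x)) / dotv x v ^+ 2 by rewrite -h2 mulrC mulKf.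
    rewrite /P e1 e2 /q /D /a; field.
    by rewrite t0.
  rewrite wintZ//; last by apply: bI; apply: bounded_mfunZ; exact: bounded_mfunB.
  rewrite wintZ//; last by apply: bI; exact: bounded_mfunB.
  rewrite wintB ?(wint_refl H vR) ?subrr ?mulr0//; try exact: bI.
  by case: (bP v).
have bq0 v : v \in Rp -> bounded_mfun Bo (fun x => kappa v * (q v x - D v x - P v x)).
  move=> vR; apply: bounded_mfunZ; apply: bounded_mfunB => //.
  by apply: bounded_mfunB; [exact: bq|exact: bD].
have bS : bounded_mfun Bo (fun x => \sum_(v <- Rp) kappa v * (q v x - D v x - P v x)).
  by apply: bounded_mfun_sum.
have S0 : wI (fun x => \sum_(v <- Rp) kappa v * (q v x - D v x - P v x)) = 0.
  rewrite (wint_sum HW) => [|v vR]; last exact/bI/bq0.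
  by rewrite big_seq big1// => v vR; exact: sym.
have bE := bounded_mfun_energy fg (C1_ball_poly p).
have bL : bounded_mfun Bo (fun x => f x * poly_fun (ball_lap p) x).
  by apply: bounded_mfunM => //; exact: bounded_mfun_poly.
apply/eqP; rewrite -addr_eq0 -wintD//; try exact: bI.
rewrite -[X in _ == X]idt -[X in X == _]addr0 -{1}S0 -wintD//; [|exact/bI/bounded_mfunD|exact: bI].
apply/eqP; apply: eq_wint => x Bx.
have -> : \sum_(v <- Rp) kappa v * (q v x - D v x - P v x) =
  \sum_(v <- Rp) kappa v * q v x - \sum_(v <- Rp) kappa v * D v x - \sum_(v <- Rp) kappa v * P v x.
  by rewrite -!sumrB; apply: eq_bigr => v _; ring.
rewrite /energy_density -/(D _ x) poly_fun_sdiv /ball_lap poly_funD !poly_funB poly_funZ.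
have -> : \sum_i g i x * poly_fun (sgrad i p) x =
   \sum_i g i x * grad_poly p i x - (\sum_i x 0 i * g i x) * (\sum_i x 0 i * grad_poly p i x).
  rewrite -euler_poly_fun mulr_suml -sumrB; apply: eq_bigr => i _.
  by rewrite sgradE; rewrite /grad_poly; ring.
have -> : poly_fun (\sum_(v <- Rp) kappa v *: dunkl_quotient v p) x =
   \sum_(v <- Rp) kappa v * poly_fun (dunkl_quotient v p) x.
  by rewrite poly_fun_sum; apply: eq_bigr => v _; rewrite poly_funZ.
have -> : \sum_(v <- Rp) kappa v * P v x = f x * \sum_(v <- Rp) kappa v * poly_fun (dunkl_quotient v p) x.
  by rewrite mulr_sumr; apply: eq_bigr => v _; rewrite /P mulrCA.
rewrite /ball_lambda; set k := \sum_(v <- Rp) kappa v.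
rewrite -natr1.
rewrite -/(q _ x).
by field.
Qed.

End energy.

(** * The inner product of polynomials *)

Section projections.
Context {R : realType} {n : nat}.
Notation d := n.+1.
Context {Rp : {fset 'rV[R]_d}} {kappa : 'rV[R]_d -> R} {mu : R}.
Hypothesis H : root_weight Rp kappa mu.
Notation W := (ball_weight Rp kappa mu).
Notation lam := (@lebesgue_rV R d).
Notation Bo := (open_ball d : set 'rV[R]_d).
Notation mp := (mpoly.mpoly d R).
Notation msize p := (mpoly.msize p).
Notation mderiv := mpoly.mderiv.
Notation X_ i := (mpoly.mpolyX R (mpoly.mnm1 i)).
Notation wI := (wint lam Bo W).
Notation wL2 := (wL2 lam Bo W).
Notation orthopoly := (ball_orthopoly Rp kappa mu).
Notation proj := (ball_proj Rp kappa mu).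
Implicit Types (x v w : 'rV[R]_d) (p q : mp) (f h : 'rV[R]_d -> R).

Let HW := finite_ball_weight H.

Definition ip p q : R := wI (fun x => poly_fun p x * poly_fun q x).

Lemma wL2_bounded_mfun f : bounded_mfun Bo f -> wL2 f.
Proof. by move=> [mf [M fM]]; exact: (wL2_bounded HW mf fM). Qed.

Lemma wL2_poly p : wL2 (poly_fun p).
Proof. exact/wL2_bounded_mfun/bounded_mfun_poly. Qed.

Lemma wI_polyD f p q : wL2 f ->
  wI (fun x => f x * poly_fun (p + q) x) =
  wI (fun x => f x * poly_fun p x) + wI (fun x => f x * poly_fun q x).
Proof.
move=> f2; rewrite -wintD//; last 2 first.
- exact: (wL2_mul HW f2 (wL2_poly p)).
- exact: (wL2_mul HW f2 (wL2_poly q)).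
by apply: eq_wint => x _; rewrite poly_funD mulrDr.
Qed.

Lemma wI_polyZ f c p : wL2 f ->
  wI (fun x => f x * poly_fun (c *: p) x) = c * wI (fun x => f x * poly_fun p x).
Proof.
move=> f2; rewrite -wintZ//; last exact: (wL2_mul HW f2 (wL2_poly p)).
by apply: eq_wint => x _; rewrite poly_funZ mulrCA.
Qed.

Lemma ipC p q : ip p q = ip q p.
Proof. by apply: eq_wint => x _; rewrite mulrC. Qed.

Lemma ipDr p q r : ip p (q + r) = ip p q + ip p r.
Proof. exact: wI_polyD (wL2_poly p). Qed.

Lemma ipZr c p q : ip p (c *: q) = c * ip p q.
Proof. exact: wI_polyZ (wL2_poly p). Qed.

Lemma ipDl p q r : ip (p + q) r = ip p r + ip q r.
Proof. by rewrite ipC ipDr !(ipC r). Qed.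

Lemma ipZl c p q : ip (c *: p) q = c * ip p q.
Proof. by rewrite ipC ipZr ipC. Qed.

Lemma ip0r p : ip p 0 = 0.
Proof. by rewrite -(scale0r (0 : mp)) ipZr mul0r. Qed.

Lemma ipNr p q : ip p (- q) = - ip p q.
Proof. by rewrite -scaleN1r ipZr mulN1r. Qed.

Lemma ipBl p q r : ip (p - q) r = ip p r - ip q r.
Proof. by rewrite ipDl; congr (_ + _); rewrite ipC ipNr ipC. Qed.

Lemma ip_sumr (I : Type) (r : seq I) (F : I -> mp) p :
  ip p (\sum_(i <- r) F i) = \sum_(i <- r) ip p (F i).
Proof.
elim: r => [|i r IH]; first by rewrite !big_nil ip0r.
by rewrite !big_cons ipDr IH.
Qed.

Lemma ip_ge0 p : 0 <= ip p p.
Proof. by apply: (wint_ge0 HW) => x _; rewrite -expr2 sqr_ge0. Qed.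

(** If [p] is nonzero, so is its product with the linear forms of the mirrors; this
    product does not vanish on some open subset of the ball, where the weight is
    positive. *)
Lemma ip_eq0 p : ip p p = 0 -> p = 0.
Proof.
move=> pp0; apply: contrapT => p0.
pose t v : mp := \sum_(j < d) v 0 j *: X_ j.
have tE v x : poly_fun (t v) x = dotv x v.
  by rewrite poly_fun_sum; apply: eq_bigr => j _; rewrite poly_funZ poly_funX mulrC.
pose r : mp := p * \prod_(v <- Rp) t v.
have r0 : r != 0.
  rewrite mulf_neq0//; first exact/eqP.
  rewrite prodf_seq_neq0; apply/allP => v vR /=; apply/eqP => tv.
  by have := rw_norm H vR; rewrite -tE tv poly_fun0 => /eqP; rewrite eq_sym pnatr_eq0.
pose U := Bo `&` [set x | poly_fun r x != 0].
have oU : open U.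
  apply: openI; first exact: open_open_ball.
  rewrite (_ : [set x | _] = poly_fun r @^-1` [set z | z != 0])//.
  apply: open_comp; last exact: open_neq.
  by move=> x _; exact: continuous_poly_fun.
have [x0 Ux0] : U !=set0.
  apply: contrapT => U0; move/eqP: r0; apply.
  apply: (poly_fun_open_eq0 (open_open_ball (n := d))).
    exists 0; rewrite /open_ball/= enorm_lt1 (_ : dotv _ _ = 0) ?ltr01//.
    by apply/eqP; rewrite dotv_eq0.
  move=> x Bx; apply: contrapT => rx; apply: U0; exists x; split => //=.
  exact/eqP.
have Upos x : U x -> 0 < poly_fun p x ^+ 2 * W x.
  move=> [Bx /=]; rewrite poly_funM mulf_eq0 negb_or => /andP[px tx].
  have tvx v : v \in Rp -> dotv x v != 0.
    move=> vR; apply: contra_neq tx => tv0.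
    by rewrite (bigD1_seq v)//= ?fset_uniq// poly_funM tE tv0 mul0r.
  rewrite mulr_gt0// ?exprn_even_gt0// ball_weightE mulr_gt0//.
    rewrite big_seq prodr_gt0// => v vR; apply: powR_gt0.
    by rewrite exprn_even_gt0//= tvx.
  by apply: powR_gt0; move: Bx; rewrite /open_ball/= enorm_lt1 subr_gt0.
have mo : measurable Bo by exact: measurable_open_ball.
have i2 := (wL2_poly p).2.
have I0 : (\int[lam]_(x in Bo) `|(poly_fun p x ^+ 2 * W x)%:E| = 0)%E.
  have := integrable_fin_num mo i2 => /fineK h.
  transitivity (\int[lam]_(x in Bo) (poly_fun p x ^+ 2 * W x)%:E)%E.
    by apply: eq_integral => x _ /=; rewrite ger0_norm// mulr_ge0 ?sqr_ge0 ?ball_weight_ge0.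
  rewrite -[LHS]h -/(Rintegral _ _ _); congr EFin; rewrite -[RHS]pp0.
  by apply: eq_wint => x _; rewrite expr2.
have mf : measurable_fun Bo (fun x => (poly_fun p x ^+ 2 * W x)%:E).
  exact: measurable_int i2.
have : ae_eq lam Bo (fun x => (poly_fun p x ^+ 2 * W x)%:E) (cst 0%E).
  by apply/ae_eq_integral_abs.
move=> [N [mN N0 UN]].
have : (lam U <= lam N)%E.
  apply: le_measure; rewrite ?inE//; first exact: open_measurable_rV.
  move=> x Ux; apply: UN => /= h; have := Upos x Ux.
  by have [] := h Ux.1 => ->; rewrite ltxx.
rewrite N0 leNgt => /negP; apply.
exact: lebesgue_open_gt0 oU Ux0.
Qed.

Fixpoint in_span (s : seq mp) p : Prop :=
  if s is b :: s' then exists c, in_span s' (p - c *: b) else p = 0.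

Lemma in_spanD s p q : in_span s p -> in_span s q -> in_span s (p + q).
Proof.
elim: s p q => [p q -> ->|b s IH p q /= [c pc] [c' qc]]; first exact: addr0.
by exists (c + c'); rewrite scalerDl opprD addrACA; exact: IH.
Qed.

Lemma in_spanZ s a p : in_span s p -> in_span s (a *: p).
Proof.
elim: s p => [p ->|b s IH p /= [c pc]]; first exact: scaler0.
by exists (a * c); rewrite -scalerA -scalerBr; exact: IH.
Qed.

(** Riesz representation on the span of [s], by Gram-Schmidt. *)
Lemma span_riesz (s : seq mp) (phi : mp -> R) :
  (forall p q, phi (p + q) = phi p + phi q) -> (forall c p, phi (c *: p) = c * phi p) ->
  exists p, in_span s p /\ forall q, in_span s q -> ip p q = phi q.
Proof.
elim: s phi => [|b s IH] phi phiD phiZ.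
  exists 0; split=> // q /= ->.
  by rewrite ip0r -(scale0r (0 : mp)) phiZ mul0r.
have [p0 [p0s p0E]] := IH phi phiD phiZ.
have [b0 [b0s b0E]] := IH (ip b) (ipDr b) (fun c => ipZr c b).
(* The component of [b] orthogonal to the span of [s]. *)
pose b' := b - b0.
have b'E q : in_span s q -> ip b' q = 0 by move=> qs; rewrite ipBl b0E// subrr.
have dec q : in_span (b :: s) q -> exists q2 c, in_span s q2 /\ q = q2 + c *: b'.
  move=> [c qc]; exists (q - c *: b + c *: b0), c; split.
    by apply: in_spanD => //; exact: in_spanZ.
  by rewrite /b' scalerBr addrACA subrK subrr addr0.
have [b'0|b'0] := eqVneq b' 0.
  exists p0; split; first by exists 0; rewrite scale0r subr0.
  move=> q /dec[q2 [c [q2s ->]]]; rewrite b'0 scaler0 addr0; exact: p0E.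
have bb : ip b' b' != 0 by apply: contra_neq b'0; exact: ip_eq0.
pose t := (phi b' - ip p0 b') / ip b' b'.
exists (p0 + t *: b'); split.
  exists t; rewrite /b' scalerBr addrA addrAC addrK.
  by apply: in_spanD => //; rewrite -scaleNr; exact: in_spanZ.
move=> q /dec[q2 [c [q2s ->]]].
rewrite ipDl !ipDr !ipZl !ipZr (b'E _ q2s) phiD phiZ (p0E _ q2s) /t.
by field.
Qed.

Lemma poly_riesz m (phi : mp -> R) :
  (forall p q, phi (p + q) = phi p + phi q) -> (forall c p, phi (c *: p) = c * phi p) ->
  exists p, (msize p <= m)%N /\ forall q, (msize q <= m)%N -> ip p q = phi q.
Proof.
move=> phiD phiZ.
pose s (l : seq (mpoly.bmultinom d m)) := [seq mpoly.mpolyX R (mpoly.bmnm k) | k <- l].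
have [p [ps pE]] := span_riesz (s (index_enum _)) phiD phiZ.
have size_s l q : in_span (s l) q -> (msize q <= m)%N.
  elim: l q => [q /= ->|k l IH q /= [c qc]]; first by rewrite mpoly.msize0.
  rewrite -(subrK (c *: mpoly.mpolyX R (mpoly.bmnm k)) q); apply: msizeD; first exact: IH.
  by apply: msizeZ; rewrite mpoly.msizeX; case: k {qc}.
exists p; split; first exact: size_s ps.
move=> q qm; apply: pE; rewrite (mpoly.mpolywE qm).
elim: (index_enum _) => [|k l IH]; first by rewrite big_nil.
exists (mpoly.mcoeff (mpoly.bmnm k) q).
by rewrite big_cons [_ + \sum_(_ <- _) _]addrC addrK.
Qed.

End projections.

(** * Spectral decomposition *)

Section spectrum.
Context {R : realType} {n : nat}.
Notation d := n.+1.
Context {Rp : {fset 'rV[R]_d}} {kappa : 'rV[R]_d -> R} {mu : R}.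
Hypothesis H : root_weight Rp kappa mu.
Notation W := (ball_weight Rp kappa mu).
Notation lam := (@lebesgue_rV R d).
Notation Bo := (open_ball d : set 'rV[R]_d).
Notation mp := (mpoly.mpoly d R).
Notation msize p := (mpoly.msize p).
Notation mderiv := mpoly.mderiv.
Notation X_ i := (mpoly.mpolyX R (mpoly.mnm1 i)).
Notation wI := (wint lam Bo W).
Notation wL2 := (wL2 lam Bo W).
Notation lambda := (ball_lambda Rp kappa mu).
Notation orthopoly := (ball_orthopoly Rp kappa mu).
Notation proj := (ball_proj Rp kappa mu).
Notation ip := (@ip R n Rp kappa mu).
Notation ball_lap := (@ball_lap R n Rp kappa mu).
Notation energy := (@energy_density R n Rp kappa).
Implicit Types (x v w : 'rV[R]_d) (p q r : mp) (f h : 'rV[R]_d -> R)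
  (g : 'I_d -> 'rV[R]_d -> R) (k : nat).

Let HW := finite_ball_weight H.

Lemma wL2_intM f p : wL2 f -> wintegrable lam Bo W (fun x => f x * poly_fun p x).
Proof. by move=> f2; exact: (wL2_mul HW f2 (wL2_poly H p)). Qed.

(** The bound on the degree is strict, so that [deg_comp] is a difference of
    consecutive projections from degree 0 on. *)
Definition proj_lt N f : mp := xget 0 [set p : mp | (msize p <= N)%N /\
  forall q, (msize q <= N)%N -> ip p q = wI (fun x => f x * poly_fun q x)].

Lemma proj_ltP N f : wL2 f -> (msize (proj_lt N f) <= N)%N /\
  forall q, (msize q <= N)%N -> ip (proj_lt N f) q = wI (fun x => f x * poly_fun q x).
Proof.
move=> f2; rewrite /proj_lt; case: xgetP => [p _ //|h].
have [p pP] := poly_riesz H N (phi := fun q => wI (fun x => f x * poly_fun q x))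
  (fun p q => wI_polyD H p q f2) (fun c p => wI_polyZ H c p f2).
by case: (h p).
Qed.

Lemma ip_inj N p q : (msize p <= N)%N -> (msize q <= N)%N ->
  (forall r, (msize r <= N)%N -> ip p r = ip q r) -> p = q.
Proof.
move=> pN qN pq; apply/eqP; rewrite -subr_eq0; apply/eqP/(ip_eq0 H).
by rewrite (ipBl H) pq ?subrr//; exact: msizeB.
Qed.

Lemma proj_lt_unique N f p : wL2 f -> (msize p <= N)%N ->
  (forall q, (msize q <= N)%N -> ip p q = wI (fun x => f x * poly_fun q x)) ->
  proj_lt N f = p.
Proof.
move=> f2 pN pP; have [PN PP] := proj_ltP N f2.
by apply: (ip_inj PN pN) => q qN; rewrite PP// pP.
Qed.

Lemma proj_lt0 f : wL2 f -> proj_lt 0 f = 0.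
Proof. by move=> /(proj_ltP 0)[+ _]; rewrite leqn0 mpoly.msize_poly_eq0 => /eqP. Qed.

(** Agrees with [ball_proj k f], by [ball_projE]; in this form, the sum over the
    degrees telescopes. *)
Definition deg_comp k f : mp := proj_lt k.+1 f - proj_lt k f.

Lemma sum_deg_comp N f : wL2 f -> \sum_(k < N) deg_comp k f = proj_lt N f.
Proof.
move=> f2; rewrite -(big_mkord xpredT (fun k => deg_comp k f)) telescope_sumr//.
by rewrite proj_lt0// subr0.
Qed.

Lemma measurable_poly_unit p : measurable_fun (unit_ball d) (poly_fun p).
Proof.
apply: measurable_funTS; apply: continuous_measurable_rV => //.
by apply: continuous_subspaceT; exact: continuous_poly_fun.
Qed.

Lemma orthopolyP k p : orthopoly k p <->
  (msize p <= k.+1)%N /\ forall q, (msize q <= k)%N -> ip p q = 0.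
Proof.
have E q : ball_int Rp kappa mu (fun x => poly_fun p x * poly_fun q x) = ip p q.
  by rewrite ball_intE//; apply: measurable_funM; exact: measurable_poly_unit.
by split=> -[pk pP]; split=> // q qk; [rewrite -E pP|rewrite E pP].
Qed.

Lemma orthopolyZ k c p : orthopoly k p -> orthopoly k (c *: p).
Proof.
move=> /orthopolyP[pk pP]; apply/orthopolyP; split; first exact: msizeZ.
by move=> q qk; rewrite (ipZl H) pP// mulr0.
Qed.

Lemma orthopoly_deg_comp k f : wL2 f -> orthopoly k (deg_comp k f).
Proof.
move=> f2; have [Sk SP] := proj_ltP k.+1 f2; have [Pk PP] := proj_ltP k f2.
apply/orthopolyP; split; first by apply: msizeB => //; exact: leqW.
by move=> q qk; rewrite (ipBl H) SP ?PP ?subrr//; exact: leqW.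
Qed.

Lemma ip_proj_deg_comp k f p : wL2 f -> orthopoly k p -> ip (deg_comp k f) p = wI (fun x => f x * poly_fun p x).
Proof.
move=> f2 /orthopolyP[pk pP]; have [Sk SP] := proj_ltP k.+1 f2; have [Pk PP] := proj_ltP k f2.
by rewrite (ipBl H) SP// [X in _ - X]ipC pP// subr0.
Qed.

Lemma ball_projE k f : measurable_fun (unit_ball d) f -> wL2 f -> proj k f = deg_comp k f.
Proof.
move=> mf f2.
have E p q : ball_int Rp kappa mu (fun x => (f x - poly_fun p x) * poly_fun q x) =
    wI (fun x => f x * poly_fun q x) - ip p q.
  rewrite ball_intE; last first.
    apply: measurable_funM; last exact: measurable_poly_unit.
    by apply: measurable_funB => //; exact: measurable_poly_unit.
  rewrite -(wintB HW); [|exact: wL2_intM|exact: (wL2_intM _ (wL2_poly H p))].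
  by apply: eq_wint => x _; rewrite mulrBl.
have oc := orthopoly_deg_comp k f2.
apply: xget_unique => /=.
  by split=> // q oq; rewrite E ip_proj_deg_comp// subrr.
move=> p [op pP]; apply/eqP; rewrite -subr_eq0; apply/eqP/(ip_eq0 H).
have [pk _] := op; have [ck _] := oc.
have op' : orthopoly k (p - deg_comp k f).
  apply/orthopolyP; split; first exact: msizeB.
  by move/orthopolyP: op => [_ op]; move/orthopolyP: oc => [_ oc] q qk; rewrite (ipBl H) op// oc// subrr.
rewrite (ipBl H) ip_proj_deg_comp//; apply/eqP; rewrite subr_eq0; apply/eqP.
by have := pP _ op'; rewrite E => /eqP; rewrite subr_eq0 => /eqP.
Qed.

Lemma ip_orthopoly j k p q : orthopoly j p -> orthopoly k q -> j != k -> ip p q = 0.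
Proof.
move=> /orthopolyP[pj pP] /orthopolyP[qk qP]; rewrite neq_ltn => /orP[jk|kj].
  by rewrite ipC qP//; exact: leq_trans jk.
by rewrite pP//; exact: leq_trans kj.
Qed.

Lemma ip_sum (e : nat -> mp) N j : (forall k, orthopoly k (e k)) ->
  ip (\sum_(k < N) e k) (e j) = if (j < N)%N then ip (e j) (e j) else 0.
Proof.
move=> eo; rewrite ipC (ip_sumr H).
case: ltnP => [jN|Nj].
  rewrite (bigD1 (Ordinal jN))//= big1 ?addr0// => k kj.
  by apply: ip_orthopoly (eo _) (eo _) _; rewrite eq_sym.
rewrite big1// => k _; apply: ip_orthopoly (eo _) (eo _) _.
by rewrite gtn_eqF// (leq_trans (ltn_ord k)).
Qed.

Lemma ip_sum_sqr (e : nat -> mp) N : (forall k, orthopoly k (e k)) ->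
  ip (\sum_(k < N) e k) (\sum_(k < N) e k) = \sum_(k < N) ip (e k) (e k).
Proof.
by move=> eo; rewrite (ip_sumr H); apply: eq_bigr => k _; rewrite ip_sum// ltn_ord.
Qed.

Lemma dist_poly f p : wL2 f -> wI (fun x => (f x - poly_fun p x) ^+ 2) =
  wI (fun x => f x ^+ 2) - 2 * wI (fun x => f x * poly_fun p x) + ip p p.
Proof.
move=> f2; have p2 := wL2_poly H p.
have ifp := wL2_intM p f2; have ipp := wL2_intM p p2.
rewrite -(wintZ HW)// -(wintB HW) ?f2.2//; last exact: (wintegrableZ HW).
rewrite -(wintD HW)//; last by apply: (wintegrableB HW) => //; [case: f2|exact: (wintegrableZ HW)].
by apply: eq_wint => x _; ring.
Qed.

Lemma wI_proj N f : wL2 f -> wI (fun x => f x * poly_fun (proj_lt N f) x) = ip (proj_lt N f) (proj_lt N f).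
Proof. by move=> f2; have [h1 h2] := proj_ltP N f2; rewrite h2. Qed.

Lemma dist_proj N f : wL2 f -> wI (fun x => (f x - poly_fun (proj_lt N f) x) ^+ 2) =
  wI (fun x => f x ^+ 2) - ip (proj_lt N f) (proj_lt N f).
Proof. by move=> f2; rewrite dist_poly// wI_proj//; ring. Qed.

Lemma bessel N f : wL2 f -> ip (proj_lt N f) (proj_lt N f) <= wI (fun x => f x ^+ 2).
Proof.
by move=> f2; rewrite -subr_ge0 -dist_proj//; apply: (wint_ge0 HW) => x _; exact: sqr_ge0.
Qed.

Lemma dist_proj_le N f p : wL2 f -> (msize p <= N)%N ->
  wI (fun x => (f x - poly_fun (proj_lt N f) x) ^+ 2) <= wI (fun x => (f x - poly_fun p x) ^+ 2).
Proof.
move=> f2 pN; have [PN PP] := proj_ltP N f2; set P := proj_lt N f in PN PP *.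
rewrite dist_poly// [in leRHS]dist_poly// -!PP//.
have := ip_ge0 H (P - p); rewrite (ipBl H) !(ipDr H) !(ipNr H) (ipC p P); lra.
Qed.

Lemma wI_CS f h : wL2 f -> wL2 h -> wI (fun x => f x * h x) ^+ 2 <=
  wI (fun x => f x ^+ 2) * wI (fun x => h x ^+ 2).
Proof.
move=> f2 h2; have ifh := wL2_mul HW f2 h2.
set A := wI (fun x => f x ^+ 2); set B := wI _; set C := wI (fun x => h x ^+ 2).
(* The integral of [(f + t h)^2]; its discriminant is nonpositive. *)
have AC t : 0 <= A + 2 * t * B + t ^+ 2 * C.
  have i1 := wintegrableZ HW (2 * t) ifh; have i2 := wintegrableZ HW (t ^+ 2) h2.2.
  rewrite /A /B /C -(wintZ HW _ ifh) -(wintZ HW _ h2.2) -(wintD HW f2.2 i1).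
  rewrite -(wintD HW (wintegrableD HW f2.2 i1) i2); apply: (wint_ge0 HW) => x _.
  by rewrite (_ : _ + _ = (f x + t * h x) ^+ 2) ?sqr_ge0//; ring.
have C0 : 0 <= C by apply: (wint_ge0 HW) => x _; exact: sqr_ge0.
have [C00|Cn0] := eqVneq C 0.
  rewrite C00 mulr0; have := AC (- (A + 1) / B); rewrite C00.
  have [->|B0] := eqVneq B 0; first by rewrite expr0n.
  rewrite (_ : A + _ + _ = - A - 2); last by field.
  have : 0 <= A by apply: (wint_ge0 HW) => x _; exact: sqr_ge0.
  lra.
have Cp : 0 < C by rewrite lt_def Cn0.
have := AC (- B / C); rewrite (_ : A + _ + _ = (A * C - B ^+ 2) / C); last by field.
by rewrite pmulr_lge0 ?invr_gt0// subr_ge0.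
Qed.

Definition eigen k : R := k%:R * (k%:R + 2 * lambda).

Lemma lambda_ge0 : 0 <= lambda.
Proof.
rewrite /ball_lambda -natr1 addrK !addr_ge0 ?(rw_mu H) ?divr_ge0// big_seq.
by apply: sumr_ge0 => v; exact: (rw_kappa H).
Qed.

Lemma eigen_ge0 k : 0 <= eigen k.
Proof. by rewrite mulr_ge0 ?addr_ge0 ?mulr_ge0 ?lambda_ge0. Qed.

Lemma eigen_ge k : (0 < k)%N -> 1 + 2 * lambda <= eigen k.
Proof.
rewrite -(ler_nat R) => k1; have l0 := lambda_ge0.
by rewrite /eigen; nra.
Qed.

Lemma C1_grad_poly p : C1_ball (poly_fun p) (grad_poly p).
Proof. exact: C1_ball_poly. Qed.

(** [ball_lap p + eigen k p] has degree less than [k], and it is orthogonal to the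
    polynomials of degree less than [k] since the operator is symmetric and does
    not increase degrees. *)
Lemma ball_lap_eigen k p : orthopoly k p -> ball_lap p = - eigen k *: p.
Proof.
move=> /orthopolyP[pk pP]; apply/eqP; rewrite scaleNr -subr_eq0 opprK; apply/eqP.
have := msize_ball_lap H pk; rewrite -/(eigen k).
move E : (ball_lap p + eigen k *: p) => r rk; apply: (ip_eq0 H).
have [->|r0] := eqVneq r 0; first by rewrite ip0r.
have E1 : _ = - ip r (ball_lap p) := energy_poly H p (C1_grad_poly r).
have E2 : _ = - ip p (ball_lap r) := energy_poly H r (C1_grad_poly p).
have Er : ip r (ball_lap p) = ip p (ball_lap r).
  apply: oppr_inj; apply: (etrans (esym E1)); apply: (etrans _ E2).
  by apply: eq_wint => x _; exact: energy_densityC.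
rewrite -[X in ip _ X]E (ipDr H r) Er (ipZr H _ r) (ipC r p) (pP _ rk) mulr0 addr0.
apply: pP; clear Er E E1 E2; case: k pk rk => [|k] pk rk.
  by move: rk; rewrite leqn0 mpoly.msize_poly_eq0 (negbTE r0).
rewrite -(addrK (eigen k *: r) (ball_lap r)); apply: msizeB; last exact: msizeZ.
by apply: leqW; exact: msize_ball_lap.
Qed.

Lemma energy_orthopoly f g k p : C1_ball f g -> orthopoly k p ->
  wI (energy f g (poly_fun p) (grad_poly p)) = eigen k * wI (fun x => f x * poly_fun p x).
Proof.
move=> fg op; rewrite (energy_poly H p fg) (ball_lap_eigen op).
rewrite wI_polyZ//; first by rewrite mulNr opprK.
exact/(wL2_bounded_mfun H)/(bounded_mfun_C1 fg).
Qed.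

Lemma energy_polyD f g p q x : energy f g (poly_fun (p + q)) (grad_poly (p + q)) x =
  energy f g (poly_fun p) (grad_poly p) x + energy f g (poly_fun q) (grad_poly q) x.
Proof.
rewrite /energy_density.
have -> : \sum_i g i x * grad_poly (p + q) i x =
    \sum_i g i x * grad_poly p i x + \sum_i g i x * grad_poly q i x.
  by rewrite -big_split/=; apply: eq_bigr => i _; rewrite /grad_poly mpoly.mderivD poly_funD mulrDr.
have -> : \sum_i x 0 i * grad_poly (p + q) i x =
    \sum_i x 0 i * grad_poly p i x + \sum_i x 0 i * grad_poly q i x.
  by rewrite -big_split/=; apply: eq_bigr => i _; rewrite /grad_poly mpoly.mderivD poly_funD mulrDr.
rewrite (eq_bigr (fun v => kappa v *
      ((f x - f (x *m refl_mx v)) * (poly_fun p x - poly_fun p (x *m refl_mx v)) / dotv x v ^+ 2) +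
   kappa v * ((f x - f (x *m refl_mx v)) * (poly_fun q x - poly_fun q (x *m refl_mx v)) / dotv x v ^+ 2))).
  by rewrite big_split/=; ring.
by move=> v _; rewrite !poly_funD; ring.
Qed.

Lemma energy_poly_sum f g (e : nat -> mp) N : C1_ball f g ->
  wI (energy f g (poly_fun (\sum_(k < N) e k)) (grad_poly (\sum_(k < N) e k))) =
  \sum_(k < N) wI (energy f g (poly_fun (e k)) (grad_poly (e k))).
Proof.
move=> fg; have iE p := bounded_mfun_wintegrable HW (bounded_mfun_energy H fg (C1_ball_poly p)).
elim: N => [|N IH].
  rewrite !big_ord0 -[RHS](wint0 lam Bo W); apply: eq_wint => x _.
  have h y : poly_fun (0 : mp) y = 0 by exact: poly_fun0.
  rewrite /energy_density big1 => [|i _]; last by rewrite /grad_poly mpoly.mderiv0 h mulr0.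
  rewrite sub0r [X in _ * X]big1 => [|i _]; last by rewrite /grad_poly mpoly.mderiv0 h mulr0.
  by rewrite mulr0 oppr0 add0r big1// => v _; rewrite !h subrr mulr0 mul0r mulr0.
rewrite !big_ord_recr/= -IH -(wintD HW); [|exact: iE|exact: iE].
by apply: eq_wint => x _; exact: energy_polyD.
Qed.

(** By Cauchy-Schwarz, [<x, g>^2 <= |x|^2 |g|^2 <= |g|^2] in the ball. *)
Lemma energy_psd f g x : Bo x -> 0 <= energy f g f g x.
Proof.
rewrite /open_ball/= enorm_lt1 => x1; rewrite addr_ge0//.
  have := dotv_CS x (\row_i g i x); rewrite /dotv.
  under [X in X ^+ 2]eq_bigr do rewrite mxE.
  under [X in _ * X]eq_bigr do rewrite !mxE.
  have : 0 <= \sum_i g i x * g i x by apply: sumr_ge0 => i _; rewrite -expr2 sqr_ge0.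
  rewrite -/(dotv x x); set A := \sum_i _; set B := \sum_i _; nra.
rewrite big_seq; apply: sumr_ge0 => v vR.
by rewrite mulr_ge0 ?(rw_kappa H)// divr_ge0 ?sqr_ge0// -expr2 sqr_ge0.
Qed.

(** The energy of [f - h] is nonnegative. *)
Lemma energy_young f g h l x : Bo x -> 2 * energy f g h l x <= energy f g f g x + energy h l h l x.
Proof.
move=> Bx; have := energy_psd (fun y => f y - h y) (fun i y => g i y - l i y) Bx.
suff -> : energy (fun y => f y - h y) (fun i y => g i y - l i y) (fun y => f y - h y)
    (fun i y => g i y - l i y) x = energy f g f g x + energy h l h l x - 2 * energy f g h l x by lra.
rewrite /energy_density.
have -> : \sum_i (g i x - l i x) * (g i x - l i x) = \sum_i g i x * g i x +
    \sum_i l i x * l i x - 2 * \sum_i g i x * l i x.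
  by rewrite mulr_sumr -big_split/= -sumrB; apply: eq_bigr => i _; ring.
have -> : \sum_i x 0 i * (g i x - l i x) = \sum_i x 0 i * g i x - \sum_i x 0 i * l i x.
  by rewrite -sumrB; apply: eq_bigr => i _; ring.
set D := \sum_(v <- Rp) _; set A := \sum_(v <- Rp) _; set B := \sum_(v <- Rp) _; set C := \sum_(v <- Rp) _.
suff -> : D = A + B - 2 * C by ring.
rewrite /D /A /B /C mulr_sumr -big_split/= -sumrB; apply: eq_bigr => v _.
by ring.
Qed.

Lemma energy_proj N f g : C1_ball f g ->
  let P := proj_lt N f in
  wI (energy (poly_fun P) (grad_poly P) (poly_fun P) (grad_poly P)) =
  \sum_(k < N) eigen k * ip (deg_comp k f) (deg_comp k f).
Proof.
move=> fg P; have f2 := wL2_bounded_mfun H (bounded_mfun_C1 fg).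
have := sum_deg_comp N f2; rewrite -/P; set S := \sum_(k < N) _ => SP.
transitivity (wI (energy (poly_fun P) (grad_poly P) (poly_fun S) (grad_poly S))); first by rewrite SP.
rewrite (energy_poly_sum (fun k => deg_comp k f) N (C1_grad_poly P)).
apply: eq_bigr => k _; have ok := orthopoly_deg_comp k f2.
rewrite (energy_orthopoly (C1_grad_poly P) ok); congr (_ * _).
rewrite -[LHS]/(ip P (deg_comp k f)) -SP /S (ip_sum (e := fun k => deg_comp k f)) ?ltn_ord// => j.
exact: orthopoly_deg_comp.
Qed.

(** Bessel's inequality for the energy: the energy of [f] paired with its projection
    is that of the projection. *)
Lemma energy_proj_le N f g : C1_ball f g ->
  \sum_(k < N) eigen k * ip (deg_comp k f) (deg_comp k f) <= wI (energy f g f g).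
Proof.
move=> fg; have f2 := wL2_bounded_mfun H (bounded_mfun_C1 fg).
pose P := proj_lt N f; set S := \sum_(k < N) _.
have PP : wI (energy (poly_fun P) (grad_poly P) (poly_fun P) (grad_poly P)) = S by exact: energy_proj fg.
have fP : wI (energy f g (poly_fun P) (grad_poly P)) = S.
  have := sum_deg_comp N f2; rewrite -/P; set T := \sum_(k < N) _ => TP.
  rewrite -TP (energy_poly_sum (fun k => deg_comp k f) N fg).
  apply: eq_bigr => k _; have ok := orthopoly_deg_comp k f2.
  by rewrite (energy_orthopoly fg ok) (ip_proj_deg_comp f2 ok).
have iE h l h' l' (hl : C1_ball h l) (hl' : C1_ball h' l') :=
  bounded_mfun_wintegrable HW (bounded_mfun_energy H hl hl').
have CP := C1_grad_poly P.
have : wI (fun x => 2 * energy f g (poly_fun P) (grad_poly P) x) <=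
    wI (fun x => energy f g f g x + energy (poly_fun P) (grad_poly P) (poly_fun P) (grad_poly P) x).
  apply: (wint_le HW); last by move=> x Bx; exact: energy_young.
    by apply: (wintegrableZ HW); exact: (iE _ _ _ _ fg CP).
  by apply: (wintegrableD HW); [exact: (iE _ _ _ _ fg fg)|exact: (iE _ _ _ _ CP CP)].
rewrite (wintZ HW _ (iE _ _ _ _ fg CP)) (wintD HW (iE _ _ _ _ fg fg) (iE _ _ _ _ CP CP)).
by rewrite fP PP; lra.
Qed.

End spectrum.

(** * The square root of the operator *)

Section sqrt_laplacian.
Context {R : realType} {n : nat}.
Notation d := n.+1.
Context {Rp : {fset 'rV[R]_d}} {kappa : 'rV[R]_d -> R} {mu : R}.
Hypothesis H : root_weight Rp kappa mu.
Notation W := (ball_weight Rp kappa mu).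
Notation lam := (@lebesgue_rV R d).
Notation Bo := (open_ball d : set 'rV[R]_d).
Notation mp := (mpoly.mpoly d R).
Notation msize p := (mpoly.msize p).
Notation wI := (wint lam Bo W).
Notation wL2 := (wL2 lam Bo W).
Notation lambda := (ball_lambda Rp kappa mu).
Notation orthopoly := (ball_orthopoly Rp kappa mu).
Notation ip := (@ip R n Rp kappa mu).
Notation energy := (@energy_density R n Rp kappa).
Notation deg_comp := (@deg_comp R n Rp kappa mu).
Notation proj_lt := (@proj_lt R n Rp kappa mu).
Notation eigen := (@eigen R n Rp kappa mu).
Implicit Types (x v w : 'rV[R]_d) (p q r : mp) (f g h : 'rV[R]_d -> R) (k : nat).

Let HW := finite_ball_weight H.

Lemma wI_ereal f : wL2 f ->
  (\int[lam]_(x in Bo) (f x ^+ 2 * W x)%:E)%E = (wI (fun x => f x ^+ 2))%:E.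
Proof.
move=> [_ i]; rewrite /wint /Rintegral fineK//.
exact: (integrable_fin_num (fw_measurable HW) i).
Qed.

(** [L2_complete] is applied to the partial sums times [Num.sqrt W]; the limit
    divided by [Num.sqrt W] is at least as close to them, also where [W] vanishes. *)
Lemma riesz_fischer (e : nat -> mp) (M : R) : (forall k, orthopoly k (e k)) ->
  (forall N, \sum_(k < N) ip (e k) (e k) <= M) ->
  exists g, ball_L2 Rp kappa mu g /\
    forall N, proj_lt N g = \sum_(k < N) e k.
Proof.
move=> eo eM; pose S N := \sum_(k < N) ip (e k) (e k); pose u N := \sum_(k < N) e k.
have mo : measurable Bo by exact: measurable_open_ball.
have SS N M' : (N <= M')%N -> S N <= S M'.
  move=> /subnK <-; elim: (M' - N)%N => // j IH; rewrite addSn /S big_ord_recr/=.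
  by rewrite ler_wpDr// (ip_ge0 H).
have uu N M' : (N <= M')%N -> ip (u M' - u N) (u M' - u N) = S M' - S N.
  move=> /subnK <-; elim: (M' - N)%N => [|j IH]; first by rewrite !subrr ip0r.
  have E : u (j.+1 + N)%N - u N = (u (j + N)%N - u N) + e (j + N)%N.
    by rewrite /u addSn big_ord_recr/= addrAC.
  have De : ip (u (j + N)%N - u N) (e (j + N)%N) = 0.
    by rewrite (ipBl H) !(ip_sum H)// ltnn ltnNge leq_addl subrr.
  rewrite E; move: (u (j + N)%N - u N) IH De => D IH De.
  rewrite (ipDl H) !(ipDr H) IH [ip (e _) D]ipC De.
  by rewrite /S addSn big_ord_recr/=; ring.
have cS : exists l, S N @[N --> \oo] --> l /\ forall N, S N <= l.
  have nS : nondecreasing_seq S by move=> a b; exact: SS.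
  have cS : cvgn S by apply: nondecreasing_is_cvgn => //; exists M => _ [N _ <-]; exact: eM.
  by exists (limn S); split => // N; exact: nondecreasing_cvgn_le.
have [l [Sl lS]] := cS.
have small (eps : R) : 0 < eps -> exists N, forall m, (N <= m)%N -> l - S m <= eps.
  move=> e0; move/cvgrPdist_le: Sl => /(_ _ e0)[N _ h]; exists N => m Nm.
  exact: le_trans (ler_norm _) (h _ Nm).
pose s x := Num.sqrt (W x).
have ss x : s x ^+ 2 = W x by rewrite sqr_sqrtr// ball_weight_ge0.
have ms : measurable_fun Bo s by apply: measurable_fun_sqrt; exact: measurable_ball_weight.
pose v N x := poly_fun (u N) x * s x.
have mv N : measurable_fun Bo (v N).
  by apply: measurable_funM => //; case: (bounded_mfun_poly (u N)).
have [eps e0|g0 [mg0 g0P]] := L2_complete mo (lebesgue_open_ball_fin d) mv.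
  have [N NP] := small _ e0; exists N => a b Na Nb.
  have -> : (\int[lam]_(x in Bo) ((v a x - v b x) ^+ 2)%:E)%E = (ip (u a - u b) (u a - u b))%:E.
    rewrite (_ : ip _ _ = wI (fun x => poly_fun (u a - u b) x ^+ 2)); last first.
      by apply: eq_wint => x _; rewrite expr2.
    rewrite -(wI_ereal (wL2_poly H _)); apply: eq_integral => x _.
    by rewrite /v -mulrBl exprMn ss poly_funB.
  rewrite lee_fin; have [ab|/ltnW ba] := leqP b a.
    by rewrite uu//; have := NP _ Nb; have := lS a; lra.
  rewrite (_ : ip _ _ = ip (u b - u a) (u b - u a)); last first.
    by rewrite -[u a - u b]opprB (ipNr H) ipC (ipNr H) opprK.
  by rewrite uu//; have := NP _ Na; have := lS b; lra.
(* Extended by 0 to the sphere, on which measurability is also required. *)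
pose g := (fun x => g0 x / s x) \_ Bo.
have mg : measurable_fun setT g.
  by apply/(measurable_restrictT _ mo); apply: measurable_funM => //; exact: measurable_fun_inv.
have mgB : measurable_fun Bo g by exact: measurable_funTS.
have g_u N x : Bo x -> (g x - poly_fun (u N) x) ^+ 2 * W x <= (g0 x - v N x) ^+ 2.
  move=> Bx; rewrite /g patchE mem_set// -ss.
  have [s0|s0] := eqVneq (s x) 0; first by rewrite s0 expr0n/= mulr0 sqr_ge0.
  by rewrite -exprMn mulrBl divfK.
have mgu N : measurable_fun Bo (fun x => ((g x - poly_fun (u N) x) ^+ 2 * W x)%:E).
  apply/measurable_EFinP; apply: measurable_funM; last exact: measurable_ball_weight.
  by apply: measurable_funX; apply: measurable_funB => //; case: (bounded_mfun_poly (u N)).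
have gu_le N (eps : R) : (\int[lam]_(x in Bo) ((g0 x - v N x) ^+ 2)%:E <= eps%:E)%E ->
    wL2 (fun x => g x - poly_fun (u N) x) /\ wI (fun x => (g x - poly_fun (u N) x) ^+ 2) <= eps.
  move=> he.
  have h : (\int[lam]_(x in Bo) ((g x - poly_fun (u N) x) ^+ 2 * W x)%:E <= eps%:E)%E.
    apply: le_trans he; apply: ge0_le_integral => //.
    - by move=> x _; rewrite lee_fin mulr_ge0 ?sqr_ge0 ?ball_weight_ge0.
    - by apply/measurable_EFinP; apply: measurable_funX; exact: measurable_funB.
    - by move=> x Bx; rewrite lee_fin; exact: g_u.
  have L : wL2 (fun x => g x - poly_fun (u N) x).
    split; first by apply: measurable_funB => //; case: (bounded_mfun_poly (u N)).
    apply/integrableP; split; first exact: mgu.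
    rewrite (eq_integral (fun x => ((g x - poly_fun (u N) x) ^+ 2 * W x)%:E)); last first.
      by move=> x _ /=; rewrite ger0_norm// mulr_ge0 ?sqr_ge0 ?ball_weight_ge0.
    by apply: le_lt_trans h _; rewrite ltry.
  by split=> //; move: h; rewrite wI_ereal// lee_fin.
have g2 : wL2 g.
  have [N NP] := g0P 1 ltr01; have [L _] := gu_le _ _ (NP _ (leqnn _)).
  have := wL2D HW L (wL2_poly H (u N)).
  by under eq_fun do rewrite subrK.
exists g; split; first by apply/ball_L2P; split => //; exact: measurable_funTS.
move=> N; apply: (proj_lt_unique H g2).
  apply: msize_sum => k _; have /orthopolyP[ek _] := eo k.
  exact: leq_trans ek _.
move=> q qN; apply/eqP; rewrite -subr_eq0 -sqrf_eq0 eq_le sqr_ge0 andbT.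
have q0 := ip_ge0 H q.
apply/ler_addgt0Pr => eps e0; rewrite add0r.
have [M' MP] := g0P (eps / (ip q q + 1)) (divr_gt0 e0 (ltr_wpDl q0 ltr01)).
have [L Le] := gu_le _ _ (MP _ (leq_maxr N M')).
have E : ip (u N) q - wI (fun x => g x * poly_fun q x) =
    - wI (fun x => (g x - poly_fun (u (maxn N M')) x) * poly_fun q x).
  (* The terms of degree at least [N] are orthogonal to [q]. *)
  have -> : ip (u N) q = ip (u (maxn N M')) q.
    have := leq_maxl N M'; move: (maxn N M') => m /subnK <-.
    elim: (m - N)%N => // j IH; rewrite IH /u addSn big_ord_recr/= (ipDl H).
    have /orthopolyP[_ ->] := eo (j + N)%N; rewrite ?addr0//.
    by apply: leq_trans qN _; exact: leq_addl.
  rewrite -opprB -(wintB HW); [|exact: wL2_intM|exact: (wL2_intM H _ (wL2_poly H _))].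
  by congr (- _); apply: eq_wint => x _; rewrite mulrBl.
rewrite E sqrrN; apply: le_trans (wI_CS H L (wL2_poly H q)) _.
have -> : wI (fun x => poly_fun q x ^+ 2) = ip q q.
  by apply: eq_wint => x _; rewrite expr2.
apply: (@le_trans _ _ (eps / (ip q q + 1) * ip q q)); first exact: ler_wpM2r.
have q1 : 0 < ip q q + 1 by lra.
by rewrite mulrAC ler_pdivrMr//; nra.
Qed.

(** The series of the [eigen k `^ (1 / 2) *: deg_comp k f] converges since the energy
    of [f] is finite. *)
Lemma laplace_sqrt_exists f dfs : measurable_fun (unit_ball d) f -> C1_ball f dfs ->
  exists g, is_ball_laplace_pow Rp kappa mu (1 / 2) f g.
Proof.
move=> mf fg; have f2 := wL2_bounded_mfun H (bounded_mfun_C1 fg).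
have eig k : (eigen k `^ (1 / 2)) ^+ 2 = eigen k.
  by rewrite div1r powR12_sqrt ?sqr_sqrtr// eigen_ge0.
pose e k := eigen k `^ (1 / 2) *: deg_comp k f.
have eo k : orthopoly k (e k) by apply: (orthopolyZ H); exact: (orthopoly_deg_comp H).
have [|g [g2 gP]] := riesz_fischer (M := wI (energy f dfs f dfs)) eo.
  move=> N; apply: le_trans (energy_proj_le H N fg); apply: ler_sum => k _.
  by rewrite /e (ipZl H) (ipZr H) mulrA -expr2 eig.
exists g; split=> // k; have [mg gL] := (ball_L2P _).1 g2.
rewrite (ball_projE H)// (ball_projE H)// -/(eigen k) -/(e k).
by rewrite {1}/deg_comp !gP big_ord_recr/= addrAC subrr add0r.
Qed.

(** This is Bessel's inequality for [g].  By [energy_proj], the sum is the energy of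
    the projection of [f]. *)
Lemma laplace_sqrt_energy f dfs g N : measurable_fun (unit_ball d) f -> C1_ball f dfs ->
  is_ball_laplace_pow Rp kappa mu (1 / 2) f g ->
  \sum_(k < N) eigen k * ip (deg_comp k f) (deg_comp k f) <= wI (fun x => g x ^+ 2).
Proof.
move=> mf fg [g2 gP]; have f2 := wL2_bounded_mfun H (bounded_mfun_C1 fg).
have [mg gL] := (ball_L2P _).1 g2.
apply: le_trans (bessel H N gL); rewrite -(sum_deg_comp H N gL).
rewrite (ip_sum_sqr H (e := fun k => deg_comp k g)); last by move=> k; exact: (orthopoly_deg_comp H).
apply: ler_sum => k _; have := gP k; rewrite (ball_projE H)// (ball_projE H)// -/(eigen k) => ->.
by rewrite (ipZl H) (ipZr H) mulrA -expr2 div1r powR12_sqrt ?sqr_sqrtr// eigen_ge0.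
Qed.

(** Bernstein polynomials of [f], extended by 0, are bounded and converge pointwise. *)
Lemma poly_dense f dfs : C1_ball f dfs -> forall eps : R, 0 < eps ->
  exists p, wI (fun x => (f x - poly_fun p x) ^+ 2) <= eps.
Proof.
move=> fg eps e0; have [mf [M fM]] := bounded_mfun_C1 fg.
have mo : measurable Bo by exact: measurable_open_ball.
pose F := f \_ Bo.
have FE x : Bo x -> F x = f x by move=> Bx; rewrite /F patchE mem_set.
have B0 : Bo 0.
  by rewrite /open_ball/= enorm_lt1 (_ : dotv _ _ = 0) ?ltr01//; apply/eqP; rewrite dotv_eq0.
have M0 : 0 <= M by exact: le_trans (fM 0 B0).
have [L L0 fL] := C1_ball_lipschitz fg.
have cF x : Bo x -> {for x, continuous F}.
  move=> Bx; apply: ((@cvgrPdist_le _ _ _ (nbhs x) _ F (F x)).2 _) => z z0.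
  have r0 : 0 < z / (L * d%:R + 1) by rewrite divr_gt0// ltr_wpDl// mulr_ge0.
  have /nbhs_ballP[r /= r0' rB] : nbhs x Bo.
    by apply: open_nbhs_nbhs; split => //; exact: open_open_ball.
  apply/nbhs_ballP; exists (Num.min r (z / (L * d%:R + 1))); first by rewrite /= lt_min r0'.
  move=> y /= xy.
  have By : Bo y by apply: rB; apply: le_ball xy; rewrite ge_min lexx.
  have {}xy : ball x (z / (L * d%:R + 1)) y by apply: le_ball xy; rewrite ge_min lexx orbT.
  rewrite !FE//; apply: le_trans (fL _ _ By Bx) _.
  move: xy => /ball_boxP[_]; set s := z / _ => xy.
  have h : \sum_i `|x 0 i - y 0 i| <= d%:R * s.
    rewrite -[d in d%:R]card_ord mulr_natl -sumr_const; apply: ler_sum => i _.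
    exact/ltW/xy.
  apply: le_trans (ler_wpM2l L0 h) _; rewrite mulrA /s mulrCA ler_piMr//; first exact: ltW.
  by rewrite ler_pdivrMr ?mul1r ?lerDl// ltr_wpDl// mulr_ge0.
have FM y : `|F y| <= M.
  by rewrite /F patchE; case: ifPn => [/set_mem /fM //|_]; rewrite normr0.
have cube x : Bo x -> forall i, -1 <= x 0 i <= 1.
  by rewrite /open_ball/= enorm_lt1 => x1 i; have := coord_le_dotv x i; nra.
pose q k := bernstein F k.
have qM k x : Bo x -> `|poly_fun (q k) x| <= M.
  by move=> Bx; apply: bernstein_bounded => //; exact: cube.
have qc x : Bo x -> poly_fun (q k) x @[k --> \oo] --> f x.
  move=> Bx; rewrite -FE//; apply: bernstein_cvg (cube _ Bx) FM _.
  exact: cF.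
pose G k x := (f x - poly_fun (q k) x) ^+ 2 * W x.
have [||||_ cG] := @dominated_Rintegral _ _ _ lam Bo mo G (fun=> 0) (fun x => (M + M) ^+ 2 * W x).
- move=> k; apply: measurable_funM; last exact: measurable_ball_weight.
  by apply: measurable_funX; apply: measurable_funB => //; case: (bounded_mfun_poly (q k)).
- exact: (bounded_mfun_wintegrable HW (bounded_mfun_cst _ _)).
- move=> x Bx; have h : f x - poly_fun (q k) x @[k --> \oo] --> (0 : R).
    by rewrite -(subrr (f x)); apply: cvgB; [exact: cvg_cst|exact: qc].
  rewrite -(mul0r (W x)) -[X in X * _](mul0r 0).
  by apply: cvgM; [exact: cvgM|exact: cvg_cst].
- move=> k x Bx; rewrite /G normrM (ger0_norm (ball_weight_ge0 x)) ler_wpM2r ?ball_weight_ge0//.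
  rewrite normrX lerXn2r ?nnegrE ?addr_ge0//.
  by apply: le_trans (ler_normB _ _) _; rewrite lerD ?fM ?qM.
move: cG; have -> : Rintegral lam Bo (fun=> 0 : R) = 0 by rewrite /Rintegral integral0.
move=> /cvgrPdist_le /(_ _ e0)[N _ /(_ N (leqnn _))].
rewrite sub0r normrN => h; exists (q N).
by apply: le_trans h; exact: ler_norm.
Qed.

Lemma proj_dense f dfs : C1_ball f dfs -> forall eps : R, 0 < eps ->
  exists N, wI (fun x => (f x - poly_fun (proj_lt N f) x) ^+ 2) <= eps.
Proof.
move=> fg eps e0; have [p pe] := poly_dense fg e0.
exists (msize p); apply: le_trans pe; apply: (dist_proj_le H) => //.
exact/(wL2_bounded_mfun H)/(bounded_mfun_C1 fg).
Qed.

End sqrt_laplacian.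

(** * The uncertainty inequality for polynomials *)

Section uncertainty.
Context {R : realType} {n : nat}.
Notation d := n.+1.
Context {Rp : {fset 'rV[R]_d}} {kappa : 'rV[R]_d -> R} {mu : R}.
Hypothesis H : root_weight Rp kappa mu.
Notation W := (ball_weight Rp kappa mu).
Notation lam := (@lebesgue_rV R d).
Notation Bo := (open_ball d : set 'rV[R]_d).
Notation mp := (mpoly.mpoly d R).
Notation wI := (wint lam Bo W).
Notation lambda := (ball_lambda Rp kappa mu).
Notation energy := (@energy_density R n Rp kappa).
Notation X_ i := (mpoly.mpolyX R (mpoly.mnm1 i)).
Implicit Types (x v w : 'rV[R]_d) (p q : mp).

Let HW := finite_ball_weight H.

Variable y : 'rV[R]_d.
Hypothesis y1 : dotv y y = 1.

Definition lin_poly : mp := \sum_i y 0 i *: X_ i.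

Lemma lin_polyE x : poly_fun lin_poly x = dotv x y.
Proof.
rewrite poly_fun_sum; apply: eq_bigr => j _.
by rewrite poly_funZ poly_funX mulrC.
Qed.

Lemma mderiv_lin_poly i : mpoly.mderiv i lin_poly = (mpoly.mpolyC d (y 0 i) : mp).
Proof.
rewrite /lin_poly raddf_sum (bigD1 i)//= big1 => [|j ji].
  by rewrite addr0 mpoly.mderivZ mderivXi eqxx mulr1n -mpoly.mul_mpolyC mulr1.
by rewrite mpoly.mderivZ mderivXi eq_sym (negbTE ji) mulr0n scaler0.
Qed.

Lemma euler_lin_poly : euler lin_poly = lin_poly.
Proof.
rewrite /euler; apply: eq_bigr => i _.
by rewrite mderiv_lin_poly mulrC mpoly.mul_mpolyC.
Qed.

(** Linear functions are eigenfunctions: off the mirrors, the difference part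
    vanishes on them.  The factor [W] removes the mirrors. *)
Lemma ball_lap_lin_poly x : W x * poly_fun (ball_lap (Rp := Rp) (kappa := kappa) (mu := mu) lin_poly) x =
  - (1 + 2 * lambda) * dotv x y * W x.
Proof.
rewrite /ball_lap poly_funD !poly_funB poly_funZ !euler_lin_poly lin_polyE.
have -> : poly_fun (\sum_i mpoly.mderiv i (mpoly.mderiv i lin_poly)) x = 0.
  rewrite poly_fun_sum big1// => i _.
  by rewrite mderiv_lin_poly mpoly.mderivC poly_fun0.
suff S0 : W x * poly_fun (\sum_(v <- Rp) kappa v *: dunkl_quotient v lin_poly) x = 0.
  by rewrite mulrDr S0; ring.
rewrite poly_fun_sum mulr_sumr big_seq big1// => v vR.
have [t0|t0] := eqVneq (dotv x v) 0.
  by rewrite poly_funZ mulrA ball_weight_mirror// mul0r.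
have [_ /(_ x)] := dunkl_quotientP H lin_poly vR.
rewrite !lin_polyE deriv_dir_poly_fun.
have -> : \sum_i v 0 i * poly_fun (mpoly.mderiv i lin_poly) x = dotv v y.
  by apply: eq_bigr => i _; rewrite mderiv_lin_poly poly_funC.
rewrite mulmx_refl ?(rw_norm H)// dotvBl dotvZl => h.
have {h} /eqP : dotv x v ^+ 2 * poly_fun (dunkl_quotient v lin_poly) x = 0.
  by rewrite h; ring.
by rewrite mulf_eq0 sqrf_eq0 (negbTE t0)/= poly_funZ => /eqP ->; rewrite !mulr0.
Qed.

Lemma energy_lin_poly f g : C1_ball f g ->
  wI (energy f g (poly_fun lin_poly) (grad_poly lin_poly)) =
  (1 + 2 * lambda) * wI (fun x => dotv x y * f x).
Proof.
move=> fg; have bf := bounded_mfun_C1 fg; rewrite (energy_poly H _ fg).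
have bu : bounded_mfun Bo (fun x => dotv x y * f x).
  by apply: bounded_mfunM => //; exact: bounded_mfun_dotv.
have iu := bounded_mfun_wintegrable HW bu.
rewrite -(wintZ HW _ iu) -(wintN HW); last first.
  by apply: (bounded_mfun_wintegrable HW); apply: bounded_mfunM => //; exact: bounded_mfun_poly.
apply: eq_Rintegral => x _; set L := poly_fun (ball_lap _) x.
transitivity (- f x * (W x * L)); first by ring.
by rewrite ball_lap_lin_poly; ring.
Qed.

(** [dotv a b - dotv x a * dotv x b] is a positive semidefinite form in [a], [b]. *)
Lemma grad_young (x a b : 'rV[R]_d) (c e : R) : Bo x -> 0 < e ->
  2 * c * (dotv a b - dotv x a * dotv x b) <=
  e * (dotv a a - dotv x a ^+ 2) + c ^+ 2 / e * (dotv b b - dotv x b ^+ 2).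
Proof.
rewrite /open_ball/= enorm_lt1 => x1 e0.
have := dotv_CS x (e *: a - c *: b); have := dotv_ge0 (e *: a - c *: b); have := dotv_ge0 x.
set z := e *: a - c *: b => x0 z0 zx.
have : 0 <= (dotv z z - dotv x z ^+ 2) / e by apply: divr_ge0; [nra|exact: ltW].
rewrite /z !dotvBl !dotvBr !dotvZl !dotvZr (dotvC b a).
rewrite (_ : _ / e = e * (dotv a a - dotv x a ^+ 2) + c ^+ 2 / e * (dotv b b - dotv x b ^+ 2)
  - 2 * c * (dotv a b - dotv x a * dotv x b)); first by lra.
by field; rewrite gt_eqF.
Qed.

Variable p : mp.
Notation kap := (\sum_(v <- Rp) kappa v).
Notation P := (poly_fun p).

(* The absolute values yield [dotv x v * D v x * `|P x| <= P x ^+ 2], whatever the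
   signs of [P] at [x] and at its mirror image. *)
Let D v x := (`|P x| - `|P (x *m refl_mx v)|) / dotv x v.

Let bD v : v \in Rp -> bounded_mfun Bo (D v).
Proof.
move=> vR; have bp := bounded_mfun_poly p; have bps := bounded_mfun_refl H vR bp.
have [_ [M MP]] := bounded_mfun_refl_quotient H (C1_grad_poly p) vR.
split.
  apply: measurable_funM.
    by apply: measurable_funB; [case: (bounded_mfun_norm bp)|case: (bounded_mfun_norm bps)].
  by apply: measurable_fun_inv; apply: measurable_funTS; exact: measurable_dotv.
exists M => x Bx; apply: le_trans (MP _ Bx); rewrite !normrM ler_wpM2r//.
exact: ler_dist_dist.
Qed.

(** With [A], [B] the values of [`|P|] at [x] and at its mirror image, the integrand
    is [D (A + B) <v, y>], and [D] is invariant under the reflection, which exchanges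
    [A] and [B]. *)
Lemma root_term_sym v : v \in Rp ->
  wI (fun x => (P x ^+ 2 - P (x *m refl_mx v) ^+ 2) * (dotv x y - dotv (x *m refl_mx v) y) / dotv x v ^+ 2)
  = wI (fun x => 2 * (D v x * `|P x| * dotv v y)).
Proof.
move=> vR; have v2 := rw_norm H vR.
pose M x := D v x * `|P x| * dotv v y.
have bM : bounded_mfun Bo M.
  apply: bounded_mfunM; last exact: bounded_mfun_cst.
  by apply: bounded_mfunM; [exact: bD|apply: bounded_mfun_norm; exact: bounded_mfun_poly].
have iM := bounded_mfun_wintegrable HW bM.
have iMs := bounded_mfun_wintegrable HW (bounded_mfun_refl H vR bM).
rewrite (wintZ HW _ iM) mulr_natl mulr2n -[X in _ = X + _](wint_refl H vR); last by case: bM.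
rewrite -(wintD HW)//; apply: eq_wint => x Bx.
rewrite /M /D mulmx_reflK// dotv_refl_root// -(real_normK (num_real (P x))).
rewrite -(real_normK (num_real (P (x *m _)))) [in dotv (x *m _) y]mulmx_refl// dotvBl dotvZl.
have [->|t0] := eqVneq (dotv x v) 0; first by rewrite oppr0 expr0n/= invr0 !(mulr0, mul0r) addr0.
by field.
Qed.

(** In [<v, y> = <v, y - x> + <v, x>], the first term is small near [y]:
    [<v, y - x>^2 <= 2 |y - x|^2 <= 4 (1 - <x, y>)]; the second one cancels the
    denominator of [D]. *)
Lemma root_term_le v x (e : R) : v \in Rp -> Bo x -> 0 < e ->
  2 * (D v x * `|P x| * dotv v y) <=
  e * ((P x - P (x *m refl_mx v)) * (P x - P (x *m refl_mx v)) / dotv x v ^+ 2)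
  + 4 / e * ((1 - dotv x y) * P x ^+ 2) + 2 * P x ^+ 2.
Proof.
move=> vR Bx e0; have v2 := rw_norm H vR.
have x1 : dotv x x < 1 by move: Bx; rewrite /open_ball/= enorm_lt1.
have xy : dotv (y - x) (y - x) <= 2 * (1 - dotv x y).
  by rewrite dotvBl !dotvBr y1 (dotvC y x); lra.
have u1 : 0 <= 1 - dotv x y by have := dotv_ge0 (y - x); lra.
rewrite -(real_normK (num_real (P x))); set A := `|P x|; have A0 : 0 <= A by exact: normr_ge0.
have [t0|t0] := eqVneq (dotv x v) 0.
  rewrite /D t0 invr0 expr0n/= invr0 !(mulr0, mul0r) add0r.
  have e4 : 0 <= 4 / e by apply: divr_ge0 => //; exact: ltW.
  have := mulr_ge0 e4 (mulr_ge0 u1 (sqr_ge0 A)); have := sqr_ge0 A.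
  by lra.
set Q := _ / dotv x v ^+ 2.
have DQ : D v x ^+ 2 <= Q.
  rewrite /D /Q expr_div_n -expr2 ler_wpM2r ?invr_ge0 ?sqr_ge0//.
  rewrite -[leRHS](real_normK (num_real _)) -[leLHS](real_normK (num_real _)).
  by rewrite lerXn2r ?nnegrE// ler_dist_dist.
have tD : D v x * dotv x v <= A by rewrite /D divfK// gerBl.
have c2 : dotv v (y - x) ^+ 2 <= 4 * (1 - dotv x y).
  by apply: le_trans (dotv_CS _ _) _; rewrite v2; lra.
rewrite (_ : dotv v y = dotv v (y - x) + dotv x v); last by rewrite dotvBr (dotvC v x); ring.
move: c2; set c := dotv v (y - x) => c2.
have Y : 2 * (D v x * A * c) <= e * D v x ^+ 2 + e^-1 * (c ^+ 2 * A ^+ 2).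
  rewrite -subr_ge0 (_ : _ - _ = (e * D v x - c * A) ^+ 2 / e); last by field; rewrite gt_eqF.
  by rewrite divr_ge0 ?sqr_ge0 ?ltW.
have h1 : e * D v x ^+ 2 <= e * Q by rewrite ler_pM2l.
have h2 : e^-1 * (c ^+ 2 * A ^+ 2) <= e^-1 * (4 * (1 - dotv x y) * A ^+ 2).
  by rewrite ler_pM2l ?invr_gt0// ler_wpM2r ?sqr_ge0.
have h3 : D v x * dotv x v * A <= A * A by rewrite ler_wpM2r.
rewrite (_ : 4 / e * _ = e^-1 * (4 * (1 - dotv x y) * A ^+ 2)); last by ring.
by lra.
Qed.

(** The left hand side is the energy of [p * p] paired with [dotv x y], by
    [energy_lin_poly].  Both parts of this energy are estimated by the inequality
    [2 a b <= e a^2 + b^2 / e], and the gradient of [dotv x y] along the sphere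
    satisfies [1 - <x, y>^2 <= 2 (1 - <x, y>)]. *)
Lemma poly_uncertainty (e : R) : 0 < e ->
  (1 + 2 * lambda) * wI (fun x => dotv x y * P x ^+ 2) <=
  e * wI (energy P (grad_poly p) P (grad_poly p)) +
  (2 + 4 * kap) / e * wI (fun x => (1 - dotv x y) * P x ^+ 2) + 2 * kap * wI (fun x => P x ^+ 2).
Proof.
move=> e0; have bp := bounded_mfun_poly p.
have bI F (bF : bounded_mfun Bo F) := bounded_mfun_wintegrable HW bF.
have bp2 : bounded_mfun Bo (fun x => P x ^+ 2) by exact: bounded_mfunX.
have bE := bounded_mfun_energy H (C1_grad_poly p) (C1_grad_poly p).
have bup : bounded_mfun Bo (fun x => (1 - dotv x y) * P x ^+ 2).
  apply: bounded_mfunM => //; apply: bounded_mfunB; first exact: bounded_mfun_cst.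
  exact: bounded_mfun_dotv.
pose N v x := (P x ^+ 2 - P (x *m refl_mx v) ^+ 2) * (dotv x y - dotv (x *m refl_mx v) y) / dotv x v ^+ 2.
pose M v x := 2 * (D v x * `|P x| * dotv v y).
pose a x : 'rV[R]_d := \row_i grad_poly p i x.
pose L x := 2 * P x * (dotv (a x) y - dotv x (a x) * dotv x y).
have bM v : v \in Rp -> bounded_mfun Bo (M v).
  move=> vR; apply: bounded_mfunZ; apply: bounded_mfunM; last exact: bounded_mfun_cst.
  by apply: bounded_mfunM; [exact: bD|exact: bounded_mfun_norm].
have CE := C1_grad_poly (p * p); have Cl := C1_grad_poly lin_poly.
have bT := bounded_mfun_energy H CE Cl.
have bN v : v \in Rp -> bounded_mfun Bo (N v).
  move=> vR; have := bounded_mfunM (bounded_mfun_refl_quotient H CE vR)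
    (bounded_mfun_refl_quotient H Cl vR).
  by congr bounded_mfun; apply/funext => x; rewrite mulrACA -invfM -expr2 !lin_polyE !poly_funM -!expr2.
have bS (F : 'rV[R]_d -> 'rV[R]_d -> R) : (forall v, v \in Rp -> bounded_mfun Bo (F v)) ->
    bounded_mfun Bo (fun x => \sum_(v <- Rp) kappa v * F v x).
  by move=> bF; apply: bounded_mfun_sum => v vR; apply: bounded_mfunZ; exact: bF.
have gp2 i x : grad_poly (p * p) i x = 2 * P x * a x 0 i.
  by rewrite /a mxE /grad_poly mpoly.mderivM poly_funD !poly_funM; ring.
have glin i x : grad_poly lin_poly i x = y 0 i.
  by rewrite /grad_poly mderiv_lin_poly poly_funC.
have TE x : energy (poly_fun (p * p)) (grad_poly (p * p)) (poly_fun lin_poly) (grad_poly lin_poly) x =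
    L x + \sum_(v <- Rp) kappa v * N v x.
  rewrite /energy_density; congr (_ + _); last first.
    by apply: eq_bigr => v _; rewrite /N !lin_polyE !poly_funM -!expr2.
  rewrite /L mulrBr [in RHS]mulrA; congr (_ - _ * _).
  - by rewrite /dotv mulr_sumr; apply: eq_bigr => i _; rewrite gp2 glin -mulrA.
  - by rewrite /dotv mulr_sumr; apply: eq_bigr => i _; rewrite gp2 mulrCA.
  - by apply: eq_bigr => i _; rewrite glin.
have bL : bounded_mfun Bo L.
  have := bounded_mfunB bT (bS N bN).
  by congr bounded_mfun; apply/funext => x; rewrite TE addrK.
have iS (F : 'rV[R]_d -> 'rV[R]_d -> R) : (forall v, v \in Rp -> bounded_mfun Bo (F v)) ->
    wI (fun x => L x + \sum_(v <- Rp) kappa v * F v x) = wI L + \sum_(v <- Rp) kappa v * wI (F v).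
  move=> bF; rewrite (wintD HW (bI _ bL) (bI _ (bS F bF))) (wint_sum HW); last first.
    by move=> v vR; apply/bI/bounded_mfunZ/bF.
  by congr (_ + _); apply: eq_big_seq => v vR; rewrite (wintZ HW)//; exact/bI/bF.
have -> : wI (fun x => dotv x y * P x ^+ 2) = wI (fun x => dotv x y * poly_fun (p * p) x).
  by apply: eq_wint => x _; rewrite poly_funM expr2.
rewrite -(energy_lin_poly CE).
have -> : wI (energy (poly_fun (p * p)) (grad_poly (p * p)) (poly_fun lin_poly) (grad_poly lin_poly)) =
    wI (fun x => L x + \sum_(v <- Rp) kappa v * M v x).
  rewrite (iS M bM) -[RHS](_ : wI L + \sum_(v <- Rp) kappa v * wI (N v) = _); last first.
    by congr (_ + _); apply: eq_big_seq => v vR; rewrite root_term_sym.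
  by rewrite -(iS N bN); apply: eq_wint => x _; exact: TE.
have b1 := bounded_mfunZ e bE.
have b2 := bounded_mfunZ ((2 + 4 * kap) / e) bup.
have b3 := bounded_mfunZ (2 * kap) bp2.
rewrite -!(wintZ HW); try exact: bI.
rewrite -!(wintD HW); try exact: bI; last by apply: bI; exact: bounded_mfunD.
apply: (wint_le HW); [apply: bI; apply: bounded_mfunD => //; exact: bS| |].
  by apply: bI; apply: bounded_mfunD => //; exact: bounded_mfunD.
move=> x Bx.
have := grad_young (a x) y (P x) Bx e0; rewrite -/(L x) => hL.
have u1 : dotv x y ^+ 2 <= 1.
  apply: le_trans (dotv_CS _ _) _; rewrite y1 mulr1.
  by move: Bx; rewrite /open_ball/= enorm_lt1 => /ltW.
have hu : P x ^+ 2 / e * (dotv y y - dotv x y ^+ 2) <= 2 / e * ((1 - dotv x y) * P x ^+ 2).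
  rewrite y1 (_ : 2 / e * _ = P x ^+ 2 / e * (2 * (1 - dotv x y))); last by ring.
  apply: ler_wpM2l; first by apply: divr_ge0; [exact: sqr_ge0|exact: ltW].
  by have := sqr_ge0 (1 - dotv x y); lra.
have hM : \sum_(v <- Rp) kappa v * M v x <=
    e * \sum_(v <- Rp) kappa v * ((P x - P (x *m refl_mx v)) * (P x - P (x *m refl_mx v)) / dotv x v ^+ 2)
    + kap * (4 / e * ((1 - dotv x y) * P x ^+ 2) + 2 * P x ^+ 2).
  rewrite mulr_sumr mulr_suml -big_split/= big_seq [leRHS]big_seq; apply: ler_sum => v vR.
  by rewrite [e * _]mulrCA -mulrDr ler_wpM2l ?(rw_kappa H)// addrA; exact: root_term_le.
rewrite /energy_density -[X in X - _](_ : dotv (a x) (a x) = _); last first.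
  by apply: eq_bigr => i _; rewrite /a mxE.
rewrite (_ : \sum_i x 0 i * grad_poly p i x = dotv x (a x)); last first.
  by apply: eq_bigr => i _; rewrite /a mxE.
move: hM hL; set S := \sum_(v <- Rp) kappa v * _; set T := \sum_(v <- Rp) _.
rewrite -expr2 => hM hL; rewrite mulrDr mulrDl; lra.
Qed.

End uncertainty.

(** * Positive subsystems *)

Section positive_subsystems.
Context {R : realType} {d : nat}.
Variables (G : set 'M[R]_d) (Rts Rp : {fset 'rV[R]_d}) (kappa : 'rV[R]_d -> R) (mu : R).
Hypotheses (hG : finite_reflection_group Rts G)
  (hnorm : forall v, v \in Rts -> dotv v v = 2)
  (hkappa_ge0 : forall v, v \in Rts -> 0 <= kappa v)
  (hkappa_inv : forall g v, G g -> v \in Rts -> kappa (v *m g) = kappa v)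
  (hmu : 0 <= mu) (hRp : positive_subsystem Rts Rp).
Implicit Types (v w : 'rV[R]_d).

Let refl_group v : v \in Rts -> G (refl_mx v).
Proof.
move=> vR; have [_ _ ->] := hG => M [_ sM]; apply: sM; by exists v.
Qed.

Let oppv w : w \in Rts -> - w = w *m refl_mx w.
Proof.
move=> wR; have w2 := hnorm wR.
by rewrite mulmx_refl// w2 [2 *: w]scaler_nat mulr2n opprD addrA subrr add0r.
Qed.

Let Rts_opp w : w \in Rts -> - w \in Rts.
Proof. by move=> wR; rewrite oppv//; have [[_ h _] _ _] := hG; exact: h. Qed.

Lemma positive_subsystem_sub v : v \in Rp -> v \in Rts.
Proof. by have [u [_ ->]] := hRp => /andP[]. Qed.

(** [tau] reflects the root and takes the positive one of the two opposite roots. *)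
Lemma positive_root_weight : root_weight Rp kappa mu.
Proof.
have [u [u0 uP]] := hRp; have sub := positive_subsystem_sub.
split=> //; [by move=> v /sub; exact: hnorm|by move=> v /sub; exact: hkappa_ge0|].
move=> v /sub vR; have v2 := hnorm vR.
have [[_ clos _] _ _] := hG.
pose tau w := if w *m refl_mx v \in Rp then w *m refl_mx v else - (w *m refl_mx v).
have tauR w : w \in Rp -> tau w \in Rp.
  move=> /sub wR; rewrite /tau; case: ifPn => // h.
  have zR := clos _ _ vR wR; move: h; rewrite !uP zR Rts_opp//= -leNgt => h.
  by rewrite dotvNr oppr_gt0 lt_def eq_sym u0.
have tauK w : w \in Rp -> tau (tau w) = w.
  move=> wR; rewrite {2}/tau; case: ifPn => h.
    by rewrite /tau mulmx_reflK// wR.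
  rewrite /tau mulNmx mulmx_reflK// opprK ifN// uP negb_and dotvNr oppr_gt0.
  by move: wR; rewrite uP => /andP[_ /ltW]; rewrite -leNgt => ->; rewrite orbT.
exists tau; split.
  apply: uniq_perm; rewrite ?fset_uniq//.
    rewrite map_inj_in_uniq ?fset_uniq// => w w' wR w'R E.
    by rewrite -(tauK w)// E tauK.
  move=> w; apply/mapP/idP => [[w' w'R ->]|wR]; first exact: tauR.
  by exists (tau w); rewrite ?tauK// tauR.
move=> w /sub wR; split=> [|x].
  rewrite /tau; case: ifPn => _; first by rewrite hkappa_inv//; exact: refl_group.
  have zR := clos _ _ vR wR.
  rewrite oppv// hkappa_inv//; last exact: refl_group.
  by rewrite hkappa_inv//; exact: refl_group.
by rewrite dotv_refll// /tau; case: ifP => // _; rewrite dotvNr sqrrN.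
Qed.

Lemma sum_positive_le : \sum_(v <- Rp) kappa v <= \sum_(v <- Rts) kappa v.
Proof.
have -> : \sum_(v <- Rp) kappa v = \sum_(v <- Rts | v \in Rp) kappa v.
  rewrite -[RHS]big_filter; apply: perm_big; apply: uniq_perm; rewrite ?filter_uniq ?fset_uniq//.
  move=> v; rewrite mem_filter; case: (boolP (v \in Rp)) => //= vR.
  by rewrite positive_subsystem_sub.
rewrite big_mkcond big_seq [leRHS]big_seq; apply: ler_sum => v vR.
by case: ifP => // _; exact: hkappa_ge0.
Qed.

End positive_subsystems.

(** * The uncertainty principle *)

Section uncertainty_principle.
Context {R : realType} {n : nat}.
Notation d := n.+1.
Context {Rp : {fset 'rV[R]_d}} {kappa : 'rV[R]_d -> R} {mu : R}.
Hypothesis H : root_weight Rp kappa mu.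
Notation W := (ball_weight Rp kappa mu).
Notation lam := (@lebesgue_rV R d).
Notation Bo := (open_ball d : set 'rV[R]_d).
Notation wI := (wint lam Bo W).
Notation lambda := (ball_lambda Rp kappa mu).
Notation ip := (@ip R n Rp kappa mu).
Notation deg_comp := (@deg_comp R n Rp kappa mu).
Notation proj_lt := (@proj_lt R n Rp kappa mu).
Notation eigen := (@eigen R n Rp kappa mu).
Notation energy := (@energy_density R n Rp kappa).
Notation kap := (\sum_(v <- Rp) kappa v).
Implicit Types (x y : 'rV[R]_d).

Let HW := finite_ball_weight H.

Variables (f : 'rV[R]_d -> R) (df : 'I_d -> 'rV[R]_d -> R).
Hypothesis fg : C1_ball f df.
Hypothesis f1 : wI (fun x => f x ^+ 2) = 1.
Variable S : R.
Hypothesis SP : forall N, \sum_(k < N) eigen k * ip (deg_comp k f) (deg_comp k f) <= S.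

Let f2 := wL2_bounded_mfun H (bounded_mfun_C1 fg).

Let bI F (bF : bounded_mfun Bo F) := bounded_mfun_wintegrable HW bF.

(** The spectral gap: constants are the only eigenfunctions with eigenvalue less
    than [1 + 2 lambda], and [f] is orthogonal to them. *)
Lemma spectral_gap : wI f = 0 -> (1 + 2 * lambda) / 2 <= S.
Proof.
move=> f0; have l0 := lambda_ge0 H.
have h0 : 0 < (2^-1 : R) by rewrite invr_gt0.
have [N NP] := proj_dense H fg h0.
(* [deg_comp 0 f] is a constant, and [f] has mean 0. *)
have c0 : ip (deg_comp 0 f) (deg_comp 0 f) = 0.
  have [sc _] := orthopoly_deg_comp H 0 f2.
  rewrite (ip_proj_deg_comp H f2 (orthopoly_deg_comp H 0 f2)).
  rewrite (mpoly.msize1_polyC sc); set c := mpoly.mcoeff _ _.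
  rewrite -[RHS](mulr0 c) -f0 -(wintZ HW); last exact/bI/bounded_mfun_C1/fg.
  by apply: eq_wint => x _; rewrite poly_funC mulrC.
apply: le_trans (SP N); have := NP; rewrite (dist_proj H)// f1 => {}NP.
have : (1 + 2 * lambda) * ip (proj_lt N f) (proj_lt N f) <=
    \sum_(k < N) eigen k * ip (deg_comp k f) (deg_comp k f).
  rewrite -(sum_deg_comp H N f2) (ip_sum_sqr H (e := fun k => deg_comp k f)); last first.
    by move=> k; exact: orthopoly_deg_comp.
  rewrite mulr_sumr; apply: ler_sum => -[[|k] kN] _ /=; first by rewrite c0 !mulr0.
  by rewrite ler_wpM2r ?(ip_ge0 H)// eigen_ge.
by nra.
Qed.

(** The limit of [poly_uncertainty] along the projections [P] of [f].  The factor 2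
    comes from [P^2 <= 2 f^2 + 2 (f - P)^2], which avoids a comparison, for [u = dotv x y], of the
    integrals of [(1 - u) P^2] and [(1 - u) f^2]. *)
Lemma uncertainty y (e : R) : dotv y y = 1 -> 0 < e ->
  1 + 2 * lambda - 2 * kap <= e * S +
   2 * ((2 + 4 * kap) / e + (1 + 2 * lambda)) * wI (fun x => (1 - dotv x y) * f x ^+ 2).
Proof.
move=> y1 e0; have l0 := lambda_ge0 H.
have kap0 : 0 <= kap by rewrite big_seq; apply: sumr_ge0 => v; exact: (rw_kappa H).
set a := 1 + _ - _; set c := _ / e + _; set delta := wI _.
have c0 : 0 <= c.
  by apply: addr_ge0; [apply: divr_ge0; [lra|exact: ltW]|lra].
have a0 : 0 < a.
  have := rw_mu H; have : 0 <= n%:R :> R by [].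
  have : d%:R = n%:R + 1 :> R by rewrite natr1.
  by rewrite /a /ball_lambda; lra.
apply/ler_addgt0Pr => r r0.
have s0 : 0 < a + 4 * c by lra.
have [N NP] := proj_dense H fg (divr_gt0 r0 s0).
set P := proj_lt N f in NP; move: NP; set z := r / _ => NP.
have A : wI (fun x => poly_fun P x ^+ 2) = ip P P by apply: eq_wint => x _; rewrite expr2.
have Az : 1 - z <= ip P P by move: NP; rewrite (dist_proj H)// f1 -/P; lra.
have bf := bounded_mfun_C1 fg; have bP := bounded_mfun_poly P.
have b1u : bounded_mfun Bo (fun x => 1 - dotv x y).
  by apply: bounded_mfunB; [exact: bounded_mfun_cst|exact: bounded_mfun_dotv].
have bP2 : bounded_mfun Bo (fun x => poly_fun P x ^+ 2) by exact: bounded_mfunX.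
have bf2 : bounded_mfun Bo (fun x => f x ^+ 2) by exact: bounded_mfunX.
have bd : bounded_mfun Bo (fun x => (f x - poly_fun P x) ^+ 2).
  by apply: bounded_mfunX; exact: bounded_mfunB.
have bu P' : bounded_mfun Bo P' -> bounded_mfun Bo (fun x => (1 - dotv x y) * P' x).
  by move=> bP'; exact: bounded_mfunM.
(* The factor 4 is 2 times the bound 2 of [1 - dotv x y]. *)
have Bz : wI (fun x => (1 - dotv x y) * poly_fun P x ^+ 2) <= 2 * delta + 4 * z.
  apply: (@le_trans _ _ (wI (fun x => 2 * ((1 - dotv x y) * f x ^+ 2) + 4 * (f x - poly_fun P x) ^+ 2))).
    apply: (wint_le HW); [exact/bI/bu|apply/bI; apply: bounded_mfunD; apply: bounded_mfunZ => //; exact: bu|].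
    move=> x; rewrite /open_ball/= enorm_lt1 => x1.
    have u1 : dotv x y ^+ 2 <= 1 by apply: le_trans (dotv_CS _ _) _; rewrite y1 mulr1 ltW.
    have {u1} : 0 <= 1 - dotv x y <= 2 by nra.
    move: (1 - dotv x y) (f x) (poly_fun P x) => u fx px /andP[u0 u2].
    have := mulr_ge0 u0 (sqr_ge0 (2 * fx - px)).
    have : 0 <= (2 - u) * (fx - px) ^+ 2 by rewrite mulr_ge0 ?sqr_ge0 ?subr_ge0.
    by lra.
  rewrite (wintD HW); [|apply/bI/bounded_mfunZ; exact: bu|exact/bI/bounded_mfunZ].
  rewrite (wintZ HW 2 (bI (bu _ bf2))) (wintZ HW 4 (bI bd)) -/delta.
  by rewrite lerD2l ler_pM2l.
have := poly_uncertainty H y1 P e0.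
rewrite (energy_proj H N fg) A.
have -> : wI (fun x => dotv x y * poly_fun P x ^+ 2) = ip P P - wI (fun x => (1 - dotv x y) * poly_fun P x ^+ 2).
  rewrite -A -(wintB HW); [|exact: bI|exact/bI/bu].
  by apply: eq_wint => x _; ring.
set B := wI _ in Bz *; set E := \sum_(k < N) _ => main.
have ES : e * E <= e * S by rewrite ler_pM2l//; exact: SP.
have cB : c * B <= c * (2 * delta + 4 * z) by rewrite ler_wpM2l.
have aA : a * (1 - z) <= a * ip P P by rewrite ler_pM2l.
have zr : z * (a + 4 * c) = r by rewrite divfK// gt_eqF.
have {}main : a * ip P P <= e * E + c * B by move: main; rewrite /a /c; set K := _ / e; lra.
by rewrite -zr; lra.
Qed.

(** If [delta] is large, the spectral gap is enough.  Otherwise the term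
    [2 (1 + 2 lambda) delta] of [uncertainty] is at most [a / 2], and
    [e = 8 K delta / a] balances the others. *)
Lemma uncertainty_product y (K : R) : dotv y y = 1 -> wI f = 0 -> 2 + 4 * kap <= K ->
  Num.min ((d%:R + 2 * mu) ^+ 2 / (32 * K)) ((d%:R + 2 * mu) / 8) <= wI (fun x => (1 - dotv x y) * f x ^+ 2) * S.
Proof.
move=> y1 f0 kapK; set a := d%:R + _; set delta := wI _.
have kap0 : 0 <= kap by rewrite big_seq; apply: sumr_ge0 => v; exact: (rw_kappa H).
have aE : a = 1 + 2 * lambda - 2 * kap by rewrite /a /ball_lambda; lra.
have a0 : 0 < a.
  by have := rw_mu H; have : 0 < d%:R :> R by []; rewrite /a; lra.
have L0 := lambda_ge0 H; have SL := spectral_gap f0.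
have d0 : 0 <= delta.
  apply: (wint_ge0 HW) => x; rewrite /open_ball/= enorm_lt1 => x1.
  have := dotv_ge0 (y - x); rewrite dotvBl !dotvBr y1 (dotvC y x) => xy.
  by apply: mulr_ge0; [lra|exact: sqr_ge0].
have main e : 0 < e -> a <= e * S + 2 * (K / e + (1 + 2 * lambda)) * delta.
  move=> e0; rewrite aE; apply: le_trans (uncertainty y1 e0) _.
  rewrite lerD2l ler_wpM2r// ler_pM2l// lerD2r ler_wpM2r// invr_ge0; exact: ltW.
rewrite ge_min; have [big|small] := leP a (4 * (1 + 2 * lambda) * delta).
  apply/orP; right.
  have : delta * ((1 + 2 * lambda) / 2) <= delta * S by rewrite ler_wpM2l.
  by lra.
apply/orP; left.
have K0 : 0 < K by lra.
have S0 : 0 < S by lra.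
have [d00|dn0] := eqVneq delta 0.
  have := main (a / (2 * S)); rewrite d00 mulr0 addr0 (_ : a / (2 * S) * S = a / 2); last by field; lra.
  by move=> h; have : a <= a / 2; [apply: h; apply: divr_gt0 => //; lra|lra].
have dp : 0 < delta by rewrite lt_def dn0.
have e0 : 0 < 8 * K * delta / a by apply: divr_gt0 => //; apply: mulr_gt0 => //; lra.
have := main _ e0.
rewrite [leRHS](_ : _ = 8 * K * (delta * S) / a + a / 4 + 2 * (1 + 2 * lambda) * delta); last first.
  by field; rewrite (gt_eqF dp) (gt_eqF K0) (gt_eqF a0).
move=> h; have : a / 4 <= 8 * K * (delta * S) / a by lra.
rewrite ler_pdivlMr// => {}h; rewrite ler_pdivrMr; last by lra.
by lra.
Qed.

End uncertainty_principle.

(** The direction of [X], or any unit vector when [X = 0]. *)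
Lemma exists_closest_direction (R : realType) (n : nat) (X : 'rV[R]_n.+1) :
  exists y0 : 'rV[R]_n.+1, dotv y0 y0 = 1 /\ forall y, unit_ball n.+1 y -> dotv y X <= dotv y0 X.
Proof.
have [->|X0] := eqVneq X 0.
  exists (delta_mx 0 0); split=> [|y _].
    rewrite /dotv (bigD1 0)//= big1 => [|i i0]; last by rewrite !mxE (negbTE i0) andbF mul0r.
    by rewrite !mxE eqxx mulr1 addr0.
  by rewrite /dotv !big1// => i _; rewrite !mxE mulr0.
have XX : 0 < enorm X by rewrite lt_def enorm_ge0 andbT sqrtr_eq0 -ltNge lt_def dotv_ge0 andbT dotv_eq0.
exists ((enorm X)^-1 *: X); split=> [|y].
  by rewrite dotvZl dotvZr -sqr_enorm; field; rewrite gt_eqF.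
have -> : dotv ((enorm X)^-1 *: X) X = enorm X.
  by rewrite dotvZl -sqr_enorm; field; rewrite gt_eqF.
rewrite /unit_ball/= enorm_le1 => y1.
apply: le_trans (ler_norm _) _; rewrite -ler_sqr ?nnegrE ?enorm_ge0// real_normK ?num_real//.
apply: le_trans (dotv_CS _ _) _; rewrite sqr_enorm.
by rewrite ler_piMl ?dotv_ge0.
Qed.

Theorem theorem5p1 (R : realType) (d : nat) (hd : (0 < d)%N)
  (G : set 'M[R]_d) (Rts : {fset 'rV[R]_d}) (kappa : 'rV[R]_d -> R) (mu : R)
  (hG : finite_reflection_group Rts G)
  (hnorm : forall v, v \in Rts -> dotv v v = 2)
  (hkappa_ge0 : forall v, v \in Rts -> 0 <= kappa v)
  (hkappa_inv : forall g v, G g -> v \in Rts -> kappa (v *m g) = kappa v)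
  (hmu : 0 <= mu) :
  exists2 C : R, 0 < C &
  forall (Rp : {fset 'rV[R]_d}), positive_subsystem Rts Rp ->
  forall f : 'rV[R]_d -> R, C1_unit_ball f ->
    ball_int Rp kappa mu f = 0 ->
    ball_int Rp kappa mu (fun x => `|f x| ^+ 2) = 1 ->
    let I y := ball_int Rp kappa mu (fun x => (1 - dotv x y) * `|f x| ^+ 2) in
    let sqrtDf := ball_laplace_pow Rp kappa mu (1 / 2) f in
    exists y0 : 'rV[R]_d,
      [/\ unit_ball d y0,
          forall y, unit_ball d y -> I y0 <= I y
        & C <= I y0 * ball_int Rp kappa mu (fun x => `|sqrtDf x| ^+ 2)].
Proof.
case: d => // n in hd G Rts kappa hG hnorm hkappa_ge0 hkappa_inv *.
pose K := 2 + 4 * \sum_(v <- Rts) kappa v.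
pose a : R := n.+1%:R + 2 * mu.
have K0 : 0 < K.
  have : 0 <= \sum_(v <- Rts) kappa v by rewrite big_seq; exact: sumr_ge0.
  by rewrite /K; lra.
have a0 : 0 < a by have : 0 < n.+1%:R :> R by []; rewrite /a; lra.
exists (Num.min (a ^+ 2 / (32 * K)) (a / 8)).
  rewrite lt_min divr_gt0 ?exprn_gt0 ?mulr_gt0//=; lra.
move=> Rp hRp f C1f f0 f1 I sqrtDf.
have H := positive_root_weight hG hnorm hkappa_ge0 hkappa_inv hmu hRp.
have [df fg] := C1_unit_ball_C1_ball C1f.
have mU := @measurable_unit_ball R n.+1.
have mf : measurable_fun (unit_ball n.+1) f by apply: continuous_measurable_rV => //; case: C1f.
have mf2 : measurable_fun (unit_ball n.+1) (fun x => `|f x| ^+ 2).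
  by apply: measurable_funX; exact: measurableT_comp.
have HW := finite_ball_weight H.
set wI := wint (lebesgue_rV n.+1) (open_ball n.+1) (ball_weight Rp kappa mu).
have {}f0 : wI f = 0 by rewrite -[RHS]f0 ball_intE.
have {}f1 : wI (fun x => f x ^+ 2) = 1.
  by rewrite -[RHS]f1 ball_intE//; apply: eq_wint => x _; rewrite real_normK ?num_real.
have IE y : I y = wI (fun x => (1 - dotv x y) * f x ^+ 2).
  rewrite /I ball_intE; last first.
    apply: measurable_funM => //; apply: measurable_funB => //.
    by apply: measurable_funTS; exact: measurable_dotv.
  by apply: eq_wint => x _; rewrite real_normK ?num_real.
have bf := bounded_mfun_C1 fg.
have bf2 : bounded_mfun (open_ball n.+1) (fun x => f x ^+ 2) by exact: bounded_mfunX.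
have bI F (bF : bounded_mfun (open_ball n.+1) F) := bounded_mfun_wintegrable HW bF.
pose X : 'rV[R]_n.+1 := \row_i wI (fun x => x 0 i * f x ^+ 2).
(* [I] is affine, so its minimum is attained in the direction of the first moment [X]. *)
have IX y : I y = 1 - dotv y X.
  have bx i : bounded_mfun (open_ball n.+1) (fun x : 'rV[R]_n.+1 => x 0 i * f x ^+ 2).
    apply: bounded_mfunM => //; have := bounded_mfun_poly (mpoly.mpolyX R (mpoly.mnm1 i)).
    by congr bounded_mfun; apply/funext => x; exact: poly_funX.
  have bS i : bounded_mfun (open_ball n.+1) (fun x : 'rV[R]_n.+1 => y 0 i * (x 0 i * f x ^+ 2)).
    exact: bounded_mfunZ.
  rewrite IE; transitivity (wI (fun x => f x ^+ 2) - wI (fun x => \sum_i y 0 i * (x 0 i * f x ^+ 2))).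
    rewrite -(wintB HW (bI _ bf2)); last by apply: bI; exact: bounded_mfun_sum.
    apply: eq_wint => x _; rewrite mulrBl mul1r /dotv mulr_suml; congr (_ - _).
    by apply: eq_bigr => i _; ring.
  rewrite f1 /wI (wint_sum HW); last by move=> i _; exact: bI.
  congr (_ - _); apply: eq_bigr => i _; rewrite mxE /wI (wintZ HW)//; exact: bI.
have [y0 [y01 y0P]] := exists_closest_direction X.
exists y0; split.
- by rewrite /unit_ball/= enorm_le1 y01.
- by move=> y /y0P; rewrite !IX lerD2l lerN2.
have Df : is_ball_laplace_pow Rp kappa mu (1 / 2) f sqrtDf.
  by apply: xgetPex; exact: laplace_sqrt_exists fg.
have [mD _] := (ball_L2P _).1 Df.1.
have -> : ball_int Rp kappa mu (fun x => `|sqrtDf x| ^+ 2) = wI (fun x => sqrtDf x ^+ 2).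
  rewrite ball_intE; last by apply: measurable_funX; exact: measurableT_comp.
  by apply: eq_wint => x _; rewrite real_normK ?num_real.
rewrite IE; apply: (uncertainty_product H fg f1 _ y01 f0).
  by move=> N; exact: (laplace_sqrt_energy H N mf fg Df).
by rewrite /K lerD2l ler_pM2l//; exact: sum_positive_le hRp.
Qed.
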